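(* If $\mathscr C$ is a small graded category over a field $k$, there is a first quadrant cohomological spectral sequence of graded $k$-modules $$E_2^{p,q}=HH^{p,*}(\operatorname{mod}(\mathscr C),\operatorname{Ext}_{\mathscr C}^{q,*})\Longrightarrow HH^{p+q,*}(\mathscr C,\mathscr C).$$
   Context: ''Graded'' means $\mathbb Z$-graded with the Koszul sign rule. A graded category over $k$ is a category enriched in graded $k$-modules. A right $\mathscr C$-module is a graded functor $\mathscr C^{op}\to$ graded $k$-modules; morphisms may have any degree. $\operatorname{mod}(\mathscr C)$ is the graded category of finitely presented right $\mathscr C$-modules, i.e. cokernels of morphisms between finite direct sums of shifts of representables (replaced by a small equivalent category). $\operatorname{Hom}_{\mathscr C}^*$ denotes graded morphism modules of right $\mathscr C$-modules and $\operatorname{Ext}^{q,*}_{\mathscr C}$ their derived functors, regarded as a graded $\operatorname{mod}(\mathscr C)$-bimodule. A bimodule $M$ over a graded category $\mathscr D$ is a family of graded modules $M(X,Y)$, contravariant in $X$ and covariant in $Y$, with associative unital degree $0$ actions $\mathscr D(Y,Y')\otimes M(X,Y)\otimes\mathscr D(X',X)\to M(X',Y')$. The Hochschild (Hochschild–Mitchell) cohomology $HH^{\star,*}(\mathscr D,M)$ is the cohomology of $C^{n,*}(\mathscr D,M)=\prod_{X_0,\dots,X_n}\operatorname{Hom}_k^*(\mathscr D(X_1,X_0)\otimes\cdots\otimes\mathscr D(X_n,X_{n-1}),M(X_n,X_0))$ with $d(\varphi)(f_1,\dots,f_{n+1})=(-1)^{|\varphi||f_1|}f_1\cdot\varphi(f_2,\dots,f_{n+1})+\sum_{i=1}^n(-1)^i\varphi(\dots,f_if_{i+1},\dots)+(-1)^{n+1}\varphi(f_1,\dots,f_n)\cdot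 f_{n+1}$. The first degree is the Hochschild degree, the second is the internal degree. $\mathscr C$ also denotes the bimodule $\mathscr C(-,-)$. *)

(* Defs.v *)
From HB Require Import structures.
From mathcomp Require Import all_boot all_order all_algebra ring_quotient.
From mathcomp Require Import boolp.

Set Implicit Arguments.
Unset Strict Implicit.
Unset Printing Implicit Defensive.

Import GRing.Theory.
Local Open Scope ring_scope.
Local Open Scope quotient_scope.

Section DProd.
Variables (k : fieldType) (I : Type) (V : I -> lmodType k).

Definition dprod := forall i, V i.

HB.instance Definition _ := gen_eqMixin dprod.
HB.instance Definition _ := gen_choiceMixin dprod.

Implicit Types f g h : dprod.
Let add f g : dprod := fun i => f i + g i.
Let opp f : dprod := fun i => - f i.
Let zero : dprod := fun i => 0.
Let scale (a : k) f : dprod := fun i => a *: f i.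

Let addA : associative add.
Proof. by move=> f g h; apply: functional_extensionality_dep => i; rewrite /add addrA. Qed.
Let addC : commutative add.
Proof. by move=> f g; apply: functional_extensionality_dep => i; rewrite /add addrC. Qed.
Let add0 : left_id zero add.
Proof. by move=> f; apply: functional_extensionality_dep => i; rewrite /add add0r. Qed.
Let addN : left_inverse zero opp add.
Proof. by move=> f; apply: functional_extensionality_dep => i; rewrite /add addNr. Qed.

HB.instance Definition _ := GRing.isZmodule.Build dprod addA addC add0 addN.

Let scaleA a b f : scale a (scale b f) = scale (a * b) f.
Proof. by apply: functional_extensionality_dep => i; rewrite /scale scalerA. Qed.
Let scale1 : left_id 1 scale.
Proof. by move=> f; apply: functional_extensionality_dep => i; rewrite /scale scale1r. Qed.
Let scaleDr : right_distributive scale +%R.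
Proof.
by move=> a f g; apply: functional_extensionality_dep => i; exact: scalerDr.
Qed.
Let scaleDl f : {morph scale^~ f : a b / a + b}.
Proof.
by move=> a b; apply: functional_extensionality_dep => i; exact: scalerDl.
Qed.

HB.instance Definition _ :=
  GRing.Zmodule_isLmodule.Build k dprod scaleA scale1 scaleDr scaleDl.

Lemma dprodZDE (a : k) f g i : (a *: f + g) i = a *: f i + g i.
Proof. by []. Qed.
Lemma dprod0E i : (0 : dprod) i = 0.
Proof. by []. Qed.

End DProd.

Record subspace (k : fieldType) (V : lmodType k) := Subspace {
  in_sub :> V -> Prop;
  in_sub0 : in_sub 0;
  in_subZD : forall (a : k) u v, in_sub u -> in_sub v -> in_sub (a *: u + v)
}.

Section Sub.
Variables (k : fieldType) (V : lmodType k) (S : subspace V).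

Definition sub_pred : pred V := fun x => `[< S x >].

Lemma sub_predP x : reflect (S x) (x \in sub_pred).
Proof. exact: asboolP. Qed.

Lemma sub_pred_closed : submod_closed sub_pred.
Proof.
split; first by apply/asboolP; exact: in_sub0.
by move=> a u v /asboolP Su /asboolP Sv; apply/asboolP; exact: in_subZD.
Qed.

HB.instance Definition _ := GRing.isSubmodClosed.Build k V sub_pred sub_pred_closed.

Record sub_of := SubOf { sub_val : V; sub_valP : sub_val \in sub_pred }.

HB.instance Definition _ := [isSub for sub_val].
HB.instance Definition _ := [Choice of sub_of by <:].
HB.instance Definition _ := [SubChoice_isSubLmodule of sub_of by <:].

Definition quot_of := Quotient.quot (Algebra.ZmodClosed.clone V sub_pred _).

HB.instance Definition _ := GRing.Zmodule.on quot_of.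
HB.instance Definition _ := EqQuotient.on quot_of.

Definition qpi (x : V) : quot_of := \pi_quot_of x.

Lemma qpiP x y : qpi x = qpi y <-> S (x - y).
Proof.
split=> [/eqP|Sxy]; first by rewrite -Quotient.idealrBE => /asboolP.
by apply/eqP; rewrite -Quotient.idealrBE; apply/asboolP.
Qed.

Lemma qpi_surj u : exists x, u = qpi x.
Proof. by exists (repr u); rewrite /qpi reprK. Qed.

Let qpiD x y : qpi (x + y) = qpi x + qpi y.
Proof. exact: Quotient.pi_add. Qed.

Let qscale (a : k) (u : quot_of) : quot_of := qpi (a *: repr u).

Let qscaleE a x : qscale a (qpi x) = qpi (a *: x).
Proof.
apply/eqP; rewrite /qscale -Quotient.idealrBE -scalerBr rpredZ //.
by rewrite Quotient.idealrBE reprK.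
Qed.

Let qscaleA a b u : qscale a (qscale b u) = qscale (a * b) u.
Proof. by have [x ->] := qpi_surj u; rewrite !qscaleE scalerA. Qed.
Let qscale1 : left_id 1 qscale.
Proof. by move=> u; have [x ->] := qpi_surj u; rewrite qscaleE scale1r. Qed.
Let qscaleDr : right_distributive qscale +%R.
Proof.
move=> a u v; have [x ->] := qpi_surj u; have [y ->] := qpi_surj v.
by rewrite -qpiD !qscaleE scalerDr qpiD.
Qed.
Let qscaleDl u : {morph qscale^~ u : a b / a + b}.
Proof. by move=> a b; have [x ->] := qpi_surj u; rewrite !qscaleE scalerDl qpiD. Qed.

HB.instance Definition _ :=
  GRing.Zmodule_isLmodule.Build k quot_of qscaleA qscale1 qscaleDr qscaleDl.

Lemma qpi_linear : linear qpi.
Proof. by move=> a x y; rewrite qpiD -qscaleE. Qed.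
HB.instance Definition _ := GRing.isLinear.Build k V quot_of *:%R qpi qpi_linear.

End Sub.

(* The subquotient Z / B of V (Z / (Z meet B) if B is not contained in Z).
   [cls Z B z] is the class of z when z lies in Z (and 0 otherwise). *)
Section Subquotient.
Variables (k : fieldType) (V : lmodType k) (Z B : subspace V).

Definition pull_sub : subspace (sub_of Z).
Proof.
apply: (@Subspace k (sub_of Z) (fun z => B (sub_val z))); first exact: in_sub0.
by move=> a u v; exact: in_subZD.
Defined.

Definition subquot : lmodType k := quot_of pull_sub.

Definition cls (z : V) : subquot := qpi pull_sub (insubd 0 z).

Let clsE z (Zz : Z z) : cls z = qpi pull_sub (SubOf (introT (sub_predP Z z) Zz)).
Proof.
rewrite /cls; congr qpi; apply: val_inj; rewrite val_insubd /=.
by case: ifP => // /negP[]; exact/(sub_predP Z).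
Qed.

Lemma cls_surj (u : subquot) : exists z, Z z /\ u = cls z.
Proof.
have [z ->] := qpi_surj u; have Zz := elimT (sub_predP Z _) (sub_valP z).
by exists (sub_val z); split=> //; rewrite (clsE Zz); congr qpi; exact: val_inj.
Qed.

Lemma clsP z z' : Z z -> Z z' -> cls z = cls z' <-> B (z - z').
Proof. by move=> Zz Zz'; rewrite (clsE Zz) (clsE Zz'); exact: qpiP. Qed.

Lemma clsZD (a : k) z z' : Z z -> Z z' -> cls (a *: z + z') = a *: cls z + cls z'.
Proof.
move=> Zz Zz'; rewrite (clsE Zz) (clsE Zz') (clsE (in_subZD a Zz Zz')).
by rewrite -linearP; congr qpi; exact: val_inj.
Qed.

End Subquotient.

Section KerIm.
Variables (k : fieldType) (U V W : lmodType k).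

Definition ker_sub (g : {linear V -> W}) : subspace V.
Proof.
exists (fun v => g v = 0); first exact: raddf0.
by move=> a u v gu gv; rewrite linearP gu gv scaler0 addr0.
Defined.

Definition im_sub (f : {linear U -> V}) : subspace V.
Proof.
exists (fun v => exists u, v = f u); first by exists 0; rewrite raddf0.
by move=> a _ _ [u ->] [v ->]; exists (a *: u + v); rewrite linearP.
Defined.

Definition homology (f : {linear U -> V}) (g : {linear V -> W}) : lmodType k :=
  subquot (ker_sub g) (im_sub f).

End KerIm.

Definition zero_sub (k : fieldType) (V : lmodType k) : subspace V.
Proof.
exists (fun v => v = 0) => // a u v -> ->.
by rewrite scaler0 addr0.
Defined.

Definition lin_iso (k : fieldType) (V W : lmodType k) : Prop :=
  exists f : {linear V -> W}, bijective f.

(* A graded k-module is a family of k-modules indexed by int. Degrees of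
   composites are passed as an index l together with a proof of i + j = l,
   which spares all transports along equations between integers. *)
Record gcat (k : fieldType) := GCat {
  ob :> Type;
  hom : ob -> ob -> int -> lmodType k;
  idm : forall X, hom X X 0;
  comp : forall X Y Z (i j l : int), i + j = l ->
    hom Y Z i -> hom X Y j -> hom X Z l;
  compDl : forall X Y Z (i j l : int) (e : i + j = l) (a : k)
    (f f' : hom Y Z i) (g : hom X Y j),
    comp e (a *: f + f') g = a *: comp e f g + comp e f' g;
  compDr : forall X Y Z (i j l : int) (e : i + j = l) (a : k)
    (f : hom Y Z i) (g g' : hom X Y j),
    comp e f (a *: g + g') = a *: comp e f g + comp e f g';
  comp1m : forall X Y (i : int) (e : 0 + i = i) (f : hom X Y i), comp e (idm Y) f = f;
  compm1 : forall X Y (i : int) (e : i + 0 = i) (f : hom X Y i), comp e f (idm X) = f;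
  compA : forall W X Y Z (i j l ij jl n : int) (e1 : i + j = ij) (e2 : j + l = jl)
    (e3 : ij + l = n) (e4 : i + jl = n)
    (f : hom Y Z i) (g : hom X Y j) (h : hom W X l),
    comp e3 (comp e1 f g) h = comp e4 f (comp e2 g h)
}.

Arguments hom {k} C X Y i : rename.
Arguments idm {k C} X : rename.
Arguments comp {k C X Y Z i j l} e f g : rename.

(* A functor out of the opposite category, written as a right action
   x . f = (-1)^(|x||f|) M(f)(x), which absorbs the sign of the opposite
   category. *)
Record rmod (k : fieldType) (C : gcat k) := RMod {
  rm : C -> int -> lmodType k;
  ract : forall X Y (i j l : int), i + j = l -> rm X i -> hom C Y X j -> rm Y l;
  ractDl : forall X Y (i j l : int) (e : i + j = l) (a : k)
    (x x' : rm X i) (f : hom C Y X j),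
    ract e (a *: x + x') f = a *: ract e x f + ract e x' f;
  ractDr : forall X Y (i j l : int) (e : i + j = l) (a : k)
    (x : rm X i) (f f' : hom C Y X j),
    ract e x (a *: f + f') = a *: ract e x f + ract e x f';
  ract1 : forall X (i : int) (e : i + 0 = i) (x : rm X i), ract e x (idm X) = x;
  ractA : forall X Y Z (i j l ij jl n : int) (e1 : i + j = ij) (e2 : j + l = jl)
    (e3 : ij + l = n) (e4 : i + jl = n)
    (x : rm X i) (f : hom C Y X j) (g : hom C Z Y l),
    ract e3 (ract e1 x f) g = ract e4 x (comp e2 f g)
}.

Arguments rm {k C} M X i : rename.
Arguments ract {k C} M {X Y i j l} e x f : rename.

(* Graded morphisms M -> N of degree d. A family of maps M X n -> N X m,
   n + d = m, is stored as a function of (X, n, m, x); is_ghom_fam singles out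
   the families that are k-linear and commute with the action of C (no sign
   occurs: the morphism acts on the left, C on the right). *)
Section GHom.
Variables (k : fieldType) (C : gcat k) (M N : rmod C) (d : int).

Record gidx := GIdx {
  gX : C; gn : int; gm : int; ge : gn + d = gm; gx : rm M gX gn
}.

Definition gfam := dprod (fun c : gidx => rm N (gX c) (gm c)).

Definition is_ghom_fam (phi : gfam) : Prop :=
  (forall X (n m : int) (e : n + d = m) (a : k) (x y : rm M X n),
     phi (GIdx e (a *: x + y)) = a *: phi (GIdx e x) + phi (GIdx e y)) /\
  (forall X Y (n m i n' m' : int) (e : n + d = m) (e' : n' + d = m')
     (h : n + i = n') (h' : m + i = m') (x : rm M X n) (f : hom C Y X i),
     phi (GIdx e' (ract M h x f)) = ract N h' (phi (GIdx e x)) f).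

Definition ghom_sub : subspace gfam.
Proof.
exists is_ghom_fam.
  split=> [*|X Y n m i n' m' e e' h h' x f]; rewrite !dprod0E.
    by rewrite scaler0 addr0.
  have := ractDl h' (-1) (0 : rm N X m) 0 f.
  by rewrite scaler0 addr0 scaleN1r addNr => ->.
move=> a u v [u1 u2] [v1 v2]; split.
  move=> X n m e b x y; rewrite !dprodZDE u1 v1 !scalerDr !scalerA mulrC.
  by rewrite addrACA.
move=> X Y n m i n' m' e e' h h' x f; rewrite !dprodZDE /= ractDl.
by rewrite (u2 _ _ _ _ _ _ _ e e' h h') (v2 _ _ _ _ _ _ _ e e' h h').
Defined.

Definition ghom : lmodType k := sub_of ghom_sub.

Definition gapp (phi : ghom) X (n m : int) (e : n + d = m) (x : rm M X n) : rm N X m :=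
  sub_val phi (GIdx e x).

Lemma gappP (phi : ghom) : is_ghom_fam (sub_val phi).
Proof. by apply/(sub_predP ghom_sub); exact: sub_valP. Qed.

Lemma ghom_eq (phi psi : ghom) :
  (forall X (n m : int) (e : n + d = m) (x : rm M X n), gapp phi e x = gapp psi e x) ->
  phi = psi.
Proof.
move=> eq; apply: val_inj; apply: functional_extensionality_dep.
by case=> X n m e x; exact: eq.
Qed.

Definition mk_ghom (phi : gfam) (H : is_ghom_fam phi) : ghom :=
  SubOf (introT (sub_predP ghom_sub phi) H).

End GHom.

Section GHomComp.
Variables (k : fieldType) (C : gcat k).

Lemma gidm_subproof (M : rmod C) :
  is_ghom_fam (fun c : gidx M 0 =>
    ecast n (rm M (gX c) n) (etrans (esym (addr0 (gn c))) (ge c)) (gx c)).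
Proof.
split=> [X n m e a x y|X Y n m i n' m' e e' h h' x f] /=.
  by move: (etrans _ e) => {e} q; case: m / q.
move: (etrans _ e) (etrans _ e') => {e e'} e e'.
by case: m / e h'; case: n' / h e' => e' h'; case: m' / e' h' => h'; congr ract; exact: eq_irrelevance.
Qed.

Definition gidm M : ghom M M 0 := mk_ghom (gidm_subproof M).

Lemma gcomp_eq1 (n j i l m : int) : i + j = l -> n + l = m -> n + j + i = m.
Proof. by move=> <- <-; rewrite -addrA [i + j]addrC. Qed.

Lemma gcomp_subproof (L M N : rmod C) (i j l : int) (e : i + j = l)
    (g : ghom M N i) (f : ghom L M j) :
  is_ghom_fam (fun c : gidx L l =>
    gapp g (gcomp_eq1 e (ge c)) (gapp f (erefl (gn c + j)) (gx c))).
Proof.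
have [f1 f2] := gappP f; have [g1 g2] := gappP g.
split=> [X n m em a x y|X Y n m p n' m' em em' h h' x r] /=.
  by rewrite /gapp f1 g1.
have hj : n + j + p = n' + j by rewrite -h addrAC.
rewrite /gapp (f2 _ _ _ _ _ _ _ (erefl _) (erefl _) h hj).
exact: g2.
Qed.

Definition gcomp (L M N : rmod C) (i j l : int) (e : i + j = l)
    (g : ghom M N i) (f : ghom L M j) : ghom L N l :=
  mk_ghom (gcomp_subproof e g f).

Lemma gappE (M N : rmod C) d (phi : ghom M N d) X n m m'
    (e : n + d = m) (e' : n + d = m') (h : m = m') (x : rm M X n) :
  gapp phi e' x = ecast z (rm N X z) h (gapp phi e x).
Proof. by case: m' / h e' => e'; congr gapp; exact: eq_irrelevance. Qed.

Lemma gapp_comp (L M N : rmod C) (i j l : int) (e : i + j = l)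
    (g : ghom M N i) (f : ghom L M j) X n p m
    (e1 : n + l = m) (e2 : n + j = p) (e3 : p + i = m) (x : rm L X n) :
  gapp (gcomp e g f) e1 x = gapp g e3 (gapp f e2 x).
Proof.
case: p / e2 e3 => e3; rewrite {1}/gapp /=.
by congr gapp; exact: eq_irrelevance.
Qed.

Lemma gapp_id (M : rmod C) X n (e : n + 0 = n) (x : rm M X n) :
  gapp (gidm M) e x = x.
Proof. by rewrite /gapp /= (eq_irrelevance (etrans _ e) (erefl n)). Qed.

Lemma gappZD (M N : rmod C) d (a : k) (f g : ghom M N d) X n m
    (e : n + d = m) (x : rm M X n) :
  gapp (a *: f + g) e x = a *: gapp f e x + gapp g e x.
Proof. by []. Qed.

Lemma gcompDl (L M N : rmod C) (i j l : int) (e : i + j = l) (a : k)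
    (g g' : ghom M N i) (f : ghom L M j) :
  gcomp e (a *: g + g') f = a *: gcomp e g f + gcomp e g' f.
Proof.
apply: ghom_eq => U n m em x.
by rewrite gappZD !(gapp_comp _ _ _ _ (erefl _) (gcomp_eq1 e em)).
Qed.

Lemma gcompDr (L M N : rmod C) (i j l : int) (e : i + j = l) (a : k)
    (g : ghom M N i) (f f' : ghom L M j) :
  gcomp e g (a *: f + f') = a *: gcomp e g f + gcomp e g f'.
Proof.
apply: ghom_eq => U n m em x.
rewrite gappZD !(gapp_comp _ _ _ _ (erefl _) (gcomp_eq1 e em)) gappZD.
exact: (gappP g).1.
Qed.

Lemma gcomp1m (M N : rmod C) (i : int) (e : 0 + i = i) (f : ghom M N i) :
  gcomp e (gidm N) f = f.
Proof.
apply: ghom_eq => U n m em x.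
by rewrite (gapp_comp _ _ _ _ em (addr0 m)) gapp_id.
Qed.

Lemma gcompm1 (M N : rmod C) (i : int) (e : i + 0 = i) (f : ghom M N i) :
  gcomp e f (gidm M) = f.
Proof.
apply: ghom_eq => U n m em x.
by rewrite (gapp_comp _ _ _ _ (addr0 n) em) gapp_id.
Qed.

Lemma gcompA (K L M N : rmod C) (i j l ij jl n : int) (e1 : i + j = ij)
    (e2 : j + l = jl) (e3 : ij + l = n) (e4 : i + jl = n)
    (f : ghom M N i) (g : ghom L M j) (h : ghom K L l) :
  gcomp e3 (gcomp e1 f g) h = gcomp e4 f (gcomp e2 g h).
Proof.
apply: ghom_eq => U p m em x.
have e5 : p + jl = p + l + j by rewrite -e2 -addrA [l + j]addrC.
have e6 := gcomp_eq1 e1 (gcomp_eq1 e3 em).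
rewrite (gapp_comp _ _ _ _ (erefl (p + l)) (gcomp_eq1 e3 em)).
rewrite (gapp_comp _ _ _ _ (erefl (p + l + j)) e6).
by rewrite (gapp_comp _ _ _ _ e5 e6) (gapp_comp _ _ _ _ (erefl (p + l)) erefl).
Qed.

End GHomComp.

Arguments gcomp {k C L M N i j l} e g f.

Section Modules.
Variables (k : fieldType) (C : gcat k).

Definition repr_mod (X : C) : rmod C.
Proof.
apply: (@RMod k C (fun Y n => hom C Y X n)
  (fun Y Z (i j l : int) (e : i + j = l) x f => comp e x f)).
- by move=> *; exact: compDl.
- by move=> *; exact: compDr.
- by move=> *; exact: compm1.
- by move=> *; exact: compA.
Defined.

Lemma shift_eq (d i j l : int) : i + j = l -> i + d + j = l + d.
Proof. by move=> <-; rewrite addrAC. Qed.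

Definition shift_mod (M : rmod C) (d : int) : rmod C.
Proof.
apply: (@RMod k C (fun Y n => rm M Y (n + d))
  (fun Y Z (i j l : int) (e : i + j = l) x f => ract M (shift_eq d e) x f)).
- by move=> *; exact: ractDl.
- by move=> *; exact: ractDr.
- by move=> *; exact: ract1.
- by move=> *; exact: ractA.
Defined.

Definition dsum_mod (n : nat) (M : 'I_n -> rmod C) : rmod C.
Proof.
apply: (@RMod k C (fun Y i => dprod (fun t => rm (M t) Y i))
  (fun Y Z (i j l : int) (e : i + j = l) x f => (fun t => ract (M t) e (x t) f))).
- by move=> *; apply: functional_extensionality_dep => t; exact: ractDl.
- by move=> *; apply: functional_extensionality_dep => t; exact: ractDr.
- by move=> *; apply: functional_extensionality_dep => t; exact: ract1.
- by move=> *; apply: functional_extensionality_dep => t; exact: ractA.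
Defined.

(* The finite direct sum of the shifted representables C(-, X)[d], (X, d)
   running through s. *)
Definition free_mod (s : seq (C * int)) : rmod C :=
  dsum_mod (fun t : 'I_(size s) =>
    shift_mod (repr_mod (tnth (in_tuple s) t).1) (tnth (in_tuple s) t).2).

Definition gsurj (M N : rmod C) d (f : ghom M N d) : Prop :=
  forall X m (y : rm N X m),
  exists (n : int) (e : n + d = m) (x : rm M X n), gapp f e x = y.

Definition gexact (L M N : rmod C) i j (f : ghom L M i) (g : ghom M N j) : Prop :=
  forall X n (y : rm M X n),
  (forall (m : int) (e : n + j = m), gapp g e y = 0) <->
  (exists (p : int) (e : p + i = n) (x : rm L X p), gapp f e x = y).

Definition is_coker (L M N : rmod C) i (f : ghom L M i) (p : ghom M N 0) : Prop :=
  gsurj p /\ gexact f p.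

Definition finpres (M : rmod C) : Prop :=
  exists (s1 s0 : seq (C * int)) (d : int)
    (f : ghom (free_mod s1) (free_mod s0) d) (p : ghom (free_mod s0) M 0),
  is_coker f p.

Definition giso (M N : rmod C) : Prop :=
  exists (f : ghom M N 0) (g : ghom N M 0),
  gcomp (addr0 0) g f = gidm M /\ gcomp (addr0 0) f g = gidm N.

(* A small category equivalent to the category of all finitely presented
   modules, given as a full subcategory meeting every isomorphism class. *)
Record fp_model := FPModel {
  fp_ob : Type;
  fp_mod : fp_ob -> rmod C;
  fp_finpres : forall X, finpres (fp_mod X);
  fp_all : forall M, finpres M -> exists X, giso (fp_mod X) M
}.

Definition mod_cat (D : fp_model) : gcat k.
Proof.
apply: (@GCat k (fp_ob D) (fun X Y i => ghom (fp_mod X) (fp_mod Y) i)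
  (fun X => gidm (fp_mod X))
  (fun X Y Z (i j l : int) (e : i + j = l) g f => gcomp e g f)).
- by move=> *; exact: gcompDl.
- by move=> *; exact: gcompDr.
- by move=> *; exact: gcomp1m.
- by move=> *; exact: gcompm1.
- by move=> *; exact: gcompA.
Defined.

End Modules.

Record bimod (k : fieldType) (D : gcat k) := Bimod {
  bm : D -> D -> int -> lmodType k;
  bl : forall X Y Y' (i j l : int), i + j = l -> hom D Y Y' i -> bm X Y j -> bm X Y' l;
  br : forall X X' Y (i j l : int), i + j = l -> bm X Y i -> hom D X' X j -> bm X' Y l;
  blDl : forall X Y Y' (i j l : int) (e : i + j = l) (a : k)
    (f f' : hom D Y Y' i) (x : bm X Y j),
    bl e (a *: f + f') x = a *: bl e f x + bl e f' x;
  blDr : forall X Y Y' (i j l : int) (e : i + j = l) (a : k)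
    (f : hom D Y Y' i) (x x' : bm X Y j),
    bl e f (a *: x + x') = a *: bl e f x + bl e f x';
  brDl : forall X X' Y (i j l : int) (e : i + j = l) (a : k)
    (x x' : bm X Y i) (f : hom D X' X j),
    br e (a *: x + x') f = a *: br e x f + br e x' f;
  brDr : forall X X' Y (i j l : int) (e : i + j = l) (a : k)
    (x : bm X Y i) (f f' : hom D X' X j),
    br e x (a *: f + f') = a *: br e x f + br e x f';
  bl1 : forall X Y (i : int) (e : 0 + i = i) (x : bm X Y i), bl e (idm Y) x = x;
  br1 : forall X Y (i : int) (e : i + 0 = i) (x : bm X Y i), br e x (idm X) = x;
  blA : forall X Y Y' Y'' (i j l ij jl n : int) (e1 : i + j = ij) (e2 : j + l = jl)
    (e3 : ij + l = n) (e4 : i + jl = n)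
    (g : hom D Y' Y'' i) (f : hom D Y Y' j) (x : bm X Y l),
    bl e3 (comp e1 g f) x = bl e4 g (bl e2 f x);
  brA : forall X X' X'' Y (i j l ij jl n : int) (e1 : i + j = ij) (e2 : j + l = jl)
    (e3 : ij + l = n) (e4 : i + jl = n)
    (x : bm X Y i) (f : hom D X' X j) (g : hom D X'' X' l),
    br e3 (br e1 x f) g = br e4 x (comp e2 f g);
  blrA : forall X X' Y Y' (i j l ij jl n : int) (e1 : i + j = ij) (e2 : j + l = jl)
    (e3 : ij + l = n) (e4 : i + jl = n)
    (g : hom D Y Y' i) (x : bm X Y j) (f : hom D X' X l),
    br e3 (bl e1 g x) f = bl e4 g (br e2 x f)
}.

Arguments bm {k D} M X Y i : rename.
Arguments bl {k D} M {X Y Y' i j l} e f x : rename.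
Arguments br {k D} M {X X' Y i j l} e x f : rename.

Definition diag_bimod (k : fieldType) (C : gcat k) : bimod C.
Proof.
apply: (@Bimod k C (hom C)
  (fun X Y Y' (i j l : int) (e : i + j = l) f x => comp e f x)
  (fun X X' Y (i j l : int) (e : i + j = l) x f => comp e x f)).
- by move=> *; exact: compDl.
- by move=> *; exact: compDr.
- by move=> *; exact: compDl.
- by move=> *; exact: compDr.
- by move=> *; exact: comp1m.
- by move=> *; exact: compm1.
- by move=> *; exact: compA.
- by move=> *; exact: compA.
- by move=> *; exact: compA.
Defined.

Section Hochschild.
Variables (k : fieldType) (D : gcat k).

(* path n X0 Xn l: the composable sequences (f_1, ..., f_n) with
   f_i in D(X_i, X_(i-1)) homogeneous, of total degree l. *)
Inductive path : nat -> D -> D -> int -> Type :=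
| pnil X : path 0 X X 0
| pcons n X Y Z (i j l : int) :
    i + j = l -> hom D Y X i -> path n Y Z j -> path n.+1 X Z l.

(* [merges e f q] lists, for i = 1, ..., n, the sequences
   (f_1, ..., f_i f_(i+1), ..., f_(n+1)) where f_1 = f and q = (f_2, ...). *)
Fixpoint merges n X Y Z (i j l : int) (e : i + j = l) (f : hom D Y X i)
    (q : path n Y Z j) {struct q} : seq (path n X Z l) :=
  match q in path m Y0 Z0 j0
    return i + j0 = l -> hom D Y0 X i -> seq (path m X Z0 l) with
  | pnil _ => fun _ _ => [::]
  | pcons _ _ _ _ i' j' _ e' g q' => fun e f =>
      pcons (etrans (esym (addrA i i' j')) (etrans (congr1 (+%R i) e') e))
        (comp (erefl (i + i')) f g) q'
      :: [seq pcons e f r | r <- merges e' g q']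
  end e f.

Record lastcut n (X Z : D) (l : int) := LastCut {
  lc_ob : D; lc_i : int; lc_j : int; lc_e : lc_i + lc_j = l;
  lc_init : path n X lc_ob lc_i; lc_last : hom D Z lc_ob lc_j
}.

(* The decomposition of (f, q) as ((f_1, ..., f_n), f_(n+1)). *)
Fixpoint cut_last n X Y Z (i j l : int) (e : i + j = l) (f : hom D Y X i)
    (q : path n Y Z j) {struct q} : lastcut n X Z l :=
  match q in path m Y0 Z0 j0
    return i + j0 = l -> hom D Y0 X i -> lastcut m X Z0 l with
  | pnil _ => fun e f => LastCut (etrans (addrC 0 i) e) (pnil X) f
  | pcons _ _ _ _ _ _ _ e' g q' => fun e f =>
      let c := cut_last e' g q' in
      LastCut (etrans (esym (addrA i (lc_i c) (lc_j c)))
                      (etrans (congr1 (+%R i) (lc_e c)) e))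
        (pcons (erefl (i + lc_i c)) f (lc_init c)) (lc_last c)
  end e f.

Variable M : bimod D.

Record chain (n : nat) := Chain {
  ch_tgt : D; ch_src : D; ch_deg : int; ch_path : path n ch_tgt ch_src ch_deg
}.

(* All families of maps from composable sequences of length n to M raising
   degrees by s; the Hochschild cochains are the multilinear ones. *)
Definition precochain n (s : int) : lmodType k :=
  dprod (fun c : chain n => bm M (ch_src c) (ch_tgt c) (ch_deg c + s)).

Definition ev n s (phi : precochain n s) X Z l (p : path n X Z l) :
  bm M Z X (l + s) := phi (Chain p).

(* [plin a p q r]: r arises from p by replacing one entry f with
   a *: f + g, and q by replacing it with g. *)
Inductive plin (a : k) : forall n X Z l,
    path n X Z l -> path n X Z l -> path n X Z l -> Prop :=
| plin_head n X Y Z (i j l : int) (e : i + j = l) (f g : hom D Y X i)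
    (p : path n Y Z j) :
    plin a (pcons e f p) (pcons e g p) (pcons e (a *: f + g) p)
| plin_tail n X Y Z (i j l : int) (e : i + j = l) (f : hom D Y X i)
    (p q r : path n Y Z j) :
    plin a p q r -> plin a (pcons e f p) (pcons e f q) (pcons e f r).

Definition multilinear n s (phi : precochain n s) : Prop :=
  forall a X Z l (p q r : path n X Z l),
  plin a p q r -> ev phi r = a *: ev phi p + ev phi q.

Lemma left_eq (i j l s : int) : i + j = l -> i + (j + s) = l + s.
Proof. by move=> <-; rewrite addrA. Qed.

Lemma right_eq (i j l s : int) : i + j = l -> i + s + j = l + s.
Proof. by move=> <-; rewrite addrAC. Qed.

(* The value of d phi on (f_1, ..., f_(n+1)), where f_1 = f and
   q = (f_2, ..., f_(n+1)). *)
Definition hd_cons n s (phi : precochain n s) X Y Z (i j l : int) (e : i + j = l)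
    (f : hom D Y X i) (q : path n Y Z j) : bm M Z X (l + s) :=
  let ms := merges e f q in
  let c := cut_last e f q in
  (-1) ^+ `|(s * i)%R|%N *: bl M (left_eq s e) f (ev phi q)
  + \sum_(t < size ms) (-1) ^+ t.+1 *: ev phi (tnth (in_tuple ms) t)
  + (-1) ^+ n.+1 *: br M (right_eq s (lc_e c)) (ev phi (lc_init c)) (lc_last c).

Definition hd_path n s (phi : precochain n s) X Z l (p : path n.+1 X Z l) :
    bm M Z X (l + s) :=
  match p in path m X0 Z0 l0
    return (if m is m'.+1 then precochain m' s -> bm M Z0 X0 (l0 + s) else unit)
  with
  | pnil _ => tt
  | pcons _ _ _ _ _ _ _ e f q => fun phi => hd_cons phi e f q
  end phi.

Definition hd n s (phi : precochain n s) : precochain n.+1 s :=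
  fun c => hd_path phi (ch_path c).

Lemma hd_consP n s X Y Z (i j l : int) (e : i + j = l) (f : hom D Y X i)
    (q : path n Y Z j) (a : k) (phi psi : precochain n s) :
  hd_cons (a *: phi + psi) e f q = a *: hd_cons phi e f q + hd_cons psi e f q.
Proof.
rewrite /hd_cons; set ms := merges _ _ _; set c := cut_last _ _ _.
have evZD X' Z' l' (p : path n X' Z' l') :
  ev (a *: phi + psi) p = a *: ev phi p + ev psi p by [].
have smZ (r b : k) (V : lmodType k) (x y : V) :
  b *: (r *: x + y) = r *: (b *: x) + b *: y.
  by rewrite scalerDr !scalerA mulrC.
rewrite !evZD blDr brDl !smZ.
under eq_bigr do rewrite evZD smZ.
rewrite big_split /= -scaler_sumr !scalerDr.
have ac6 (V : zmodType) (x x' y y' z z' : V) :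
  x + x' + (y + y') + (z + z') = x + y + z + (x' + y' + z').
  by rewrite [RHS]addrACA (addrACA x).
exact: ac6.
Qed.

Lemma hd_linear n s : linear (@hd n s).
Proof.
move=> a phi psi; apply: functional_extensionality_dep => -[X Z l p].
rewrite dprodZDE /hd /=; move: phi psi.
refine (match p in path m X0 Z0 l0 return
  (match m return path m X0 Z0 l0 -> Prop with
   | 0 => fun _ => True
   | m'.+1 => fun p0 => forall phi psi : precochain m' s,
       hd_path (a *: phi + psi) p0 = a *: hd_path phi p0 + hd_path psi p0
   end p) with pnil _ => I | pcons _ _ _ _ _ _ _ e f q => _ end).
by move=> phi psi; exact: hd_consP.
Qed.

HB.instance Definition _ n s :=
  GRing.isLinear.Build k (precochain n s) (precochain n.+1 s) *:%R (@hd n s)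
    (@hd_linear n s).

Definition multilinear_sub n s : subspace (precochain n s).
Proof.
exists (@multilinear n s) => [|b u v mu mv] a X Z l p q r pqr.
  by rewrite /ev !dprod0E scaler0 addr0.
rewrite /ev !dprodZDE -!/(ev _ _) (mu _ _ _ _ _ _ _ pqr) (mv _ _ _ _ _ _ _ pqr).
by rewrite !scalerDr !scalerA mulrC addrACA.
Defined.

Definition hh_cocycle n s : subspace (precochain n s).
Proof.
exists (fun phi => multilinear phi /\ hd phi = 0).
  by split; [exact: (in_sub0 (multilinear_sub n s)) | exact: raddf0].
move=> a u v [mu du] [mv dv]; split; first exact: (in_subZD (s := multilinear_sub n s)).
by rewrite (hd_linear a u v) du dv scaler0 addr0.
Defined.

Definition hh_cobound_succ n s : subspace (precochain n.+1 s).
Proof.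
exists (fun phi => exists psi : precochain n s, multilinear psi /\ phi = hd psi).
  by exists 0; split; [exact: (in_sub0 (multilinear_sub n s)) | rewrite raddf0].
move=> a _ _ [u [mu ->]] [v [mv ->]]; exists (a *: u + v); rewrite (hd_linear a u v).
by split=> //; exact: (in_subZD (s := multilinear_sub n s)).
Defined.

Definition hh_cobound n s : subspace (precochain n s) :=
  match n with
  | 0 => zero_sub (precochain 0 s)
  | n'.+1 => hh_cobound_succ n' s
  end.

Definition HH n s : lmodType k := subquot (hh_cocycle n s) (hh_cobound n s).

End Hochschild.

Section Ext.
Variables (k : fieldType) (C : gcat k).

Definition projective (P : rmod C) : Prop :=
  forall (M N : rmod C) (p : ghom M N 0), gsurj p ->
  forall d (g : ghom P N d), exists h : ghom P M d, gcomp (add0r d) p h = g.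

Record resolution (M : rmod C) := Resolution {
  res_mod :> nat -> rmod C;
  res_proj : forall n, projective (res_mod n);
  res_d : forall n, ghom (res_mod n.+1) (res_mod n) 0;
  res_aug : ghom (res_mod 0) M 0;
  res_surj : gsurj res_aug;
  res_exact0 : gexact (res_d 0) res_aug;
  res_exact : forall n, gexact (res_d n.+1) (res_d n)
}.

Arguments res_proj {M} r n.
Arguments res_exact {M} r n.
Arguments res_surj {M} r.
Arguments res_exact0 {M} r.

Definition precomp (L M N : rmod C) s (f : ghom L M 0) (z : ghom M N s) :
  ghom L N s := gcomp (addr0 s) z f.

Lemma precomp_linear (L M N : rmod C) s (f : ghom L M 0) :
  linear (@precomp L M N s f).
Proof. by move=> a z w; exact: gcompDl. Qed.

HB.instance Definition _ (L M N : rmod C) s (f : ghom L M 0) :=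
  GRing.isLinear.Build k (ghom M N s) (ghom L N s) *:%R (precomp f)
    (@precomp_linear L M N s f).

Definition ext_cocycle M (P : resolution M) N q s : subspace (ghom (P q) N s) :=
  ker_sub (precomp (res_d P q)).

Definition ext_cobound M (P : resolution M) N q s : subspace (ghom (P q) N s) :=
  match q with
  | 0 => zero_sub (ghom (P 0) N s)
  | q'.+1 => im_sub (precomp (res_d P q'))
  end.

(* The cohomology of Hom(P, N): the value of the q-th derived functor. *)
Definition Ext M (P : resolution M) N q s : lmodType k :=
  subquot (ext_cocycle P N q s) (ext_cobound P N q s).

(* [phi] is a lift of f to the resolutions: a chain map of internal degree d;
   the differentials having internal degree 0, no sign occurs. *)
Definition is_lift M' M (P' : resolution M') (P : resolution M) d
    (f : ghom M' M d) (phi : forall n, ghom (P' n) (P n) d) : Prop :=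
  gcomp (add0r d) (res_aug P) (phi 0) = gcomp (addr0 d) f (res_aug P') /\
  forall n, gcomp (add0r d) (res_d P n) (phi n.+1) =
            gcomp (addr0 d) (phi n) (res_d P' n).

Arguments is_lift {M' M} P' P {d} f phi.

Lemma gcomp0m (L M N : rmod C) (i j l : int) (e : i + j = l) (f : ghom L M j) :
  gcomp e (0 : ghom M N i) f = 0.
Proof.
by have := gcompDl e (-1) (0 : ghom M N i) 0 f; rewrite scaler0 addr0 scaleN1r addNr.
Qed.

Lemma gcompm0 (L M N : rmod C) (i j l : int) (e : i + j = l) (g : ghom M N i) :
  gcomp e g (0 : ghom L M j) = 0.
Proof.
by have := gcompDr e (-1) g (0 : ghom L M j) 0; rewrite scaler0 addr0 scaleN1r addNr.
Qed.

Lemma gapp0 (M N : rmod C) d X (n m : int) (e : n + d = m) (x : rm M X n) :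
  gapp (0 : ghom M N d) e x = 0.
Proof. by []. Qed.

Lemma gexact_comp0 (L M N : rmod C) i j l (e : j + i = l) (f : ghom L M i)
    (g : ghom M N j) : gexact f g -> gcomp e g f = 0.
Proof.
move=> fg; apply: ghom_eq => X n m em x.
rewrite (gapp_comp _ _ _ _ (erefl _) (gcomp_eq1 e em)) gapp0.
by apply: (fg _ _ _).2; exists n, erefl, x.
Qed.

Section Kernel.
Variables (M N : rmod C) (b : ghom M N 0).

Definition kersp X n : subspace (rm M X n).
Proof.
exists (fun x => forall m (e : n + 0 = m), gapp b e x = 0) => [m e|a u v bu bv m e].
  have := (gappP b).1 _ _ _ e (-1) (0 : rm M X n) 0.
  by rewrite scaler0 addr0 scaleN1r addNr.
by rewrite /gapp (gappP b).1 -!/(gapp _ _ _) bu bv scaler0 addr0.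
Defined.

Lemma ker_ract X Y (i j l : int) (e : i + j = l) (x : sub_of (kersp X i)) (f : hom C Y X j) :
  kersp Y l (ract M e (sub_val x) f).
Proof.
move=> m em; have bx := elimT (sub_predP _ _) (sub_valP x).
have em' : i + j = m by rewrite -em addr0.
rewrite /gapp ((gappP b).2 _ _ _ _ _ _ _ (addr0 i) em e em') -/(gapp _ _ _) bx.
have := ractDl em' (-1) (0 : rm N X i) 0 f.
by rewrite scaler0 addr0 scaleN1r addNr.
Qed.

Definition ker_mod : rmod C.
Proof.
apply: (@RMod k C (fun X n => sub_of (kersp X n)) (fun X Y i j l e x f =>
  SubOf (introT (sub_predP (kersp Y l) _) (ker_ract e x f)))).
- by move=> *; apply: val_inj; exact: ractDl.
- by move=> *; apply: val_inj; exact: ractDr.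
- by move=> *; apply: val_inj; exact: ract1.
- by move=> *; apply: val_inj; exact: ractA.
Defined.

Lemma factor_ker L d (g : ghom L M d) (g0 : gcomp (add0r d) b g = 0) :
  exists h : ghom L ker_mod d, forall X (n m : int) (e : n + d = m) (x : rm L X n),
    sub_val (gapp h e x) = gapp g e x.
Proof.
have gK X (n m : int) (e : n + d = m) (x : rm L X n) : kersp X m (gapp g e x).
  move=> p ep; have e' : n + d = p by rewrite -ep addr0.
  by rewrite -(gapp_comp (add0r d) b g e') g0.
pose h (c : gidx L d) : rm ker_mod (gX c) (gm c) :=
  SubOf (introT (sub_predP (kersp _ _) _) (gK _ _ _ (ge c) (gx c))).
have hP : is_ghom_fam h.
  split=> [X n m e a x y|X Y n m i n' m' e e' p p' x f]; apply: val_inj => /=.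
    exact: (gappP g).1.
  exact: (gappP g).2.
by exists (mk_ghom hP).
Qed.

End Kernel.

Lemma proj_lift (P L M N : rmod C) (f : ghom L M 0) (b : ghom M N 0) d
    (g : ghom P M d) : projective P -> gexact f b ->
  gcomp (add0r d) b g = 0 -> exists h : ghom P L d, gcomp (add0r d) f h = g.
Proof.
move=> pP fb g0; have [g' g'E] := factor_ker g0.
have [f' f'E] := factor_ker (gexact_comp0 (add0r 0) fb).
have sf' : gsurj f'.
  move=> X m y; have /fb[n [e [x fx]]] := elimT (sub_predP _ _) (sub_valP y).
  by exists n, e, x; apply: val_inj => /=; rewrite f'E.
have [h hE] := pP _ _ _ sf' _ g'; exists h; apply: ghom_eq => X n m e x.
have em : m + 0 = m by rewrite addr0.
by rewrite (gapp_comp _ _ _ _ e em) -f'E -(gapp_comp (add0r d) _ _ e) hE g'E.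
Qed.

Definition res_low M (P : resolution M) n : rmod C := if n is n'.+1 then P n' else M.
Definition res_out M (P : resolution M) n : ghom (P n) (res_low P n) 0 :=
  if n is n'.+1 then res_d P n' else res_aug P.

Lemma res_outP M (P : resolution M) n : gexact (res_d P n) (res_out P n).
Proof. by case: n => [|n]; [exact: res_exact0 | exact: res_exact]. Qed.

Arguments res_outP {M} P n.

Lemma res_dd M (P : resolution M) n : gcomp (add0r 0) (res_out P n) (res_d P n) = 0.
Proof. exact/gexact_comp0/res_outP. Qed.

Lemma lift_exists M' M (P' : resolution M') (P : resolution M) d
    (f : ghom M' M d) : exists phi, is_lift P' P f phi.
Proof.
pose good n (p : ghom (P' n) (P n) d) : Prop :=
  gcomp (addr0 d) (gcomp (add0r d) (res_out P n) p) (res_d P' n) = 0.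
have [p0 p0E] : exists p, gcomp (add0r d) (res_aug P) p = gcomp (addr0 d) f (res_aug P').
  have pP := res_proj P' 0; exact: (pP _ _ _ (res_surj P)).
have good0 : good 0 p0.
  rewrite /good /= p0E (gcompA _ (add0r 0) _ (addr0 d)).
  by rewrite (res_dd P' 0) gcompm0.
have step n (p : {p | good n p}) : exists q : {q | good n.+1 q},
    gcomp (add0r d) (res_d P n) (sval q) = gcomp (addr0 d) (sval p) (res_d P' n).
  have [|q qE] := @proj_lift _ _ _ _ (res_d P n) (res_out P n) d
    (gcomp (addr0 d) (sval p) (res_d P' n)) (res_proj P' n.+1) (res_outP P n).
    by rewrite -(gcompA (add0r d) _ (addr0 d)); exact: (svalP p).
  suff gq : good n.+1 q by exists (exist _ q gq).
  rewrite /good /= qE (gcompA _ (add0r 0) _ (addr0 d)).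
  by rewrite (res_dd P' n.+1) gcompm0.
pose nxt n p := sval (cid (step n p)).
pose phi := fix phi n : {p | good n p} :=
  if n is n'.+1 then nxt n' (phi n') else exist _ p0 good0.
exists (fun n => sval (phi n)); split=> // n.
exact: (svalP (cid (step n (phi n)))).
Qed.

Lemma lift0_homotopy M' M (P' : resolution M') (P : resolution M) d phi n :
  is_lift P' P (0 : ghom M' M d) phi ->
  exists (h : ghom (P' n) (P n.+1) d) t,
    phi n = gcomp (add0r d) (res_d P n) h + t /\ ext_cobound P' (P n) n d t.
Proof.
move=> [phi0 phiS]; elim: n => [|n [h [t [phiE tB]]]].
  have [|h hE] := @proj_lift _ _ _ _ (res_d P 0) (res_aug P) d (phi 0)
    (res_proj P' 0) (res_exact0 P); first by rewrite phi0 gcomp0m.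
  by exists h, 0; rewrite addr0 hE.
have t0 : gcomp (addr0 d) t (res_d P' n) = 0.
  case: n t tB {phiE h} => [|n] t /=; first by move->; rewrite gcomp0m.
  case=> u ->; rewrite /precomp (gcompA _ (add0r 0) _ (addr0 d)).
  by rewrite (res_dd P' n.+1) gcompm0.
pose g := - gcomp (addr0 d) h (res_d P' n) + phi n.+1.
have gE : gcomp (add0r d) (res_d P n) g = 0.
  rewrite /g -scaleN1r gcompDr phiS phiE -[X in gcomp _ (X + _)]scale1r gcompDl.
  rewrite t0 addr0 scale1r -(gcompA (add0r d) _ (addr0 d)).
  by rewrite scaleN1r addNr.
have [h' h'E] := proj_lift (res_proj P' n.+1) (res_exact P n) gE.
exists h', (gcomp (addr0 d) h (res_d P' n)); split; last by exists h.
by rewrite h'E /g addrAC addNr add0r.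
Qed.

Lemma lift_comp M1 M2 M3 (P1 : resolution M1) (P2 : resolution M2)
    (P3 : resolution M3) (i j l : int) (e : i + j = l) (g : ghom M2 M3 i)
    (f : ghom M1 M2 j) psi phi :
  is_lift P2 P3 g psi -> is_lift P1 P2 f phi ->
  is_lift P1 P3 (gcomp e g f) (fun n => gcomp e (psi n) (phi n)).
Proof.
move=> [psi0 psiS] [phi0 phiS]; split=> [|n].
  rewrite -(gcompA (add0r i) _ e) psi0 (gcompA _ (add0r j) _ e) phi0.
  by rewrite (gcompA e (addr0 j) (addr0 l) e).
rewrite -(gcompA (add0r i) _ e) psiS (gcompA _ (add0r j) _ e) phiS.
by rewrite (gcompA e (addr0 j) (addr0 l) e).
Qed.

Lemma lift_id M (P : resolution M) : is_lift P P (gidm M) (fun n => gidm (P n)).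
Proof. by split=> [|n]; rewrite gcompm1 gcomp1m. Qed.

Lemma lift_ZD M' M (P' : resolution M') (P : resolution M) d (a : k)
    (f g : ghom M' M d) phi psi :
  is_lift P' P f phi -> is_lift P' P g psi ->
  is_lift P' P (a *: f + g) (fun n => a *: phi n + psi n).
Proof.
move=> [phi0 phiS] [psi0 psiS].
by split=> [|n]; rewrite gcompDr gcompDl ?phi0 ?psi0 ?phiS ?psiS.
Qed.

Lemma cocycleP M (P : resolution M) N q s (z : ghom (P q) N s) :
  ext_cocycle P N q s z <-> gcomp (addr0 s) z (res_d P q) = 0.
Proof. by []. Qed.

Lemma cocycle_lift M' M (P' : resolution M') (P : resolution M) N q i j l
    (e : i + j = l) (f : ghom M' M j) phi z :
  is_lift P' P f phi -> ext_cocycle P N q i z ->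
  ext_cocycle P' N q l (gcomp e z (phi q)).
Proof.
move=> [_ phiS] /cocycleP z0; apply/cocycleP.
rewrite (gcompA _ (addr0 j) _ e) -phiS -(gcompA (addr0 i) _ e).
by rewrite z0 gcomp0m.
Qed.

Lemma cobound_lift M' M (P' : resolution M') (P : resolution M) N q i j l
    (e : i + j = l) (f : ghom M' M j) phi z :
  is_lift P' P f phi -> ext_cobound P N q i z ->
  ext_cobound P' N q l (gcomp e z (phi q)).
Proof.
case: q z => [|q] z [_ phiS] /=; first by move->; rewrite gcomp0m.
case=> w ->; exists (gcomp e w (phi q)); rewrite /precomp.
by rewrite (gcompA _ (add0r j) _ e) phiS (gcompA e (addr0 j) (addr0 l) e).
Qed.

Lemma cobound_lift0 M' M (P' : resolution M') (P : resolution M) N q i j l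
    (e : i + j = l) phi z :
  is_lift P' P (0 : ghom M' M j) phi -> ext_cocycle P N q i z ->
  ext_cobound P' N q l (gcomp e z (phi q)).
Proof.
move=> phiL /cocycleP z0; have [h [t [-> tB]]] := lift0_homotopy q phiL.
rewrite -[X in X + _]scale1r gcompDr -(gcompA (addr0 i) _ e) z0 gcomp0m.
rewrite scaler0 add0r; case: q t tB {h z0 phiL phi} z => [|q] t /=.
  by move=> -> z; rewrite gcompm0.
by case=> w -> z; exists (gcomp e z w); rewrite /precomp (gcompA e (addr0 j) (addr0 l) e).
Qed.

Lemma cocycle_post M (P : resolution M) N N' q (i j l : int) (e : i + j = l)
    (g : ghom N N' i) z :
  ext_cocycle P N q j z -> ext_cocycle P N' q l (gcomp e g z).
Proof.
move=> /cocycleP z0; apply/cocycleP.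
by rewrite (gcompA _ (addr0 j) _ e) z0 gcompm0.
Qed.

Lemma cobound_post M (P : resolution M) N N' q (i j l : int) (e : i + j = l)
    (g : ghom N N' i) z :
  ext_cobound P N q j z -> ext_cobound P N' q l (gcomp e g z).
Proof.
case: q z => [|q] z /=; first by move->; rewrite gcompm0.
by case=> w ->; exists (gcomp e g w); rewrite /precomp (gcompA e (addr0 j) (addr0 l) e).
Qed.

Definition ecls M (P : resolution M) N q s (z : ghom (P q) N s) : Ext P N q s :=
  cls (ext_cocycle P N q s) (ext_cobound P N q s) z.

Definition erep M (P : resolution M) N q s (u : Ext P N q s) : ghom (P q) N s :=
  sval (cid (cls_surj u)).

Definition ext_lift M' M (P' : resolution M') (P : resolution M) d
    (f : ghom M' M d) : forall n, ghom (P' n) (P n) d :=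
  sval (cid (lift_exists P' P f)).

Definition ext_l M (P : resolution M) N N' q (i j l : int) (e : i + j = l)
    (g : ghom N N' i) (u : Ext P N q j) : Ext P N' q l :=
  ecls (gcomp e g (erep u)).

(* f : M' -> M acts on Ext^q(M, N) by composition with any lift of f to the
   resolutions (ext_rE). *)
Definition ext_r M' M (P' : resolution M') (P : resolution M) N q i j l
    (e : i + j = l) (u : Ext P N q i) (f : ghom M' M j) : Ext P' N q l :=
  ecls (gcomp e (erep u) (ext_lift P' P f q)).

Section ExtActions.
Variable q : nat.

Lemma ecls_surj M (P : resolution M) N s (u : Ext P N q s) :
  exists z, ext_cocycle P N q s z /\ u = ecls z.
Proof. exact: cls_surj. Qed.

Lemma eclsP M (P : resolution M) N s (z z' : ghom (P q) N s) :
  ext_cocycle P N q s z -> ext_cocycle P N q s z' ->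
  ecls z = ecls z' <-> ext_cobound P N q s (z - z').
Proof. exact: clsP. Qed.

Lemma eclsZD M (P : resolution M) N s (a : k) (z z' : ghom (P q) N s) :
  ext_cocycle P N q s z -> ext_cocycle P N q s z' ->
  ecls (a *: z + z') = a *: ecls z + ecls z'.
Proof. exact: clsZD. Qed.

Lemma erepP M (P : resolution M) N s (u : Ext P N q s) :
  ext_cocycle P N q s (erep u) /\ ecls (erep u) = u.
Proof. by have [Zz uE] := svalP (cid (cls_surj u)); split=> //; rewrite [RHS]uE. Qed.

Lemma gcompBl (L M N : rmod C) (i j l : int) (e : i + j = l)
    (g g' : ghom M N i) (f : ghom L M j) :
  gcomp e (g - g') f = gcomp e g f - gcomp e g' f.
Proof. by rewrite addrC -scaleN1r gcompDl scaleN1r addrC. Qed.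

Lemma gcompBr (L M N : rmod C) (i j l : int) (e : i + j = l)
    (g : ghom M N i) (f f' : ghom L M j) :
  gcomp e g (f - f') = gcomp e g f - gcomp e g f'.
Proof. by rewrite addrC -scaleN1r gcompDr scaleN1r addrC. Qed.

Lemma ext_lE M (P : resolution M) N N' (i j l : int) (e : i + j = l)
    (g : ghom N N' i) z : ext_cocycle P N q j z ->
  ext_l e g (ecls z) = ecls (gcomp e g z).
Proof.
move=> Zz; have [Zr rE] := erepP (ecls z).
apply/eclsP; [exact: cocycle_post | exact: cocycle_post|].
by rewrite -gcompBr; apply: cobound_post; apply/eclsP.
Qed.

Lemma ext_rE M' M (P' : resolution M') (P : resolution M) N i j l
    (e : i + j = l) (f : ghom M' M j) phi z :
  is_lift P' P f phi -> ext_cocycle P N q i z ->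
  ext_r P' e (ecls z) f = ecls (gcomp e z (phi q)).
Proof.
move=> phiL Zz; have [Zr rE] := erepP (ecls z).
have LL := svalP (cid (lift_exists P' P f)); rewrite -/(ext_lift P' P f) in LL.
transitivity (ecls (gcomp e z (ext_lift P' P f q))).
  apply/eclsP; [exact: cocycle_lift LL _ | exact: cocycle_lift LL _ |].
  by rewrite -gcompBl; apply: (cobound_lift _ LL); apply/eclsP.
apply/eclsP; [exact: cocycle_lift LL _ | exact: cocycle_lift phiL _ |].
rewrite -gcompBr; apply: (cobound_lift0 e (phi := fun n => _ n - _ n)) Zz.
have := lift_ZD (-1) phiL LL; rewrite scaleN1r addNr => -[L0 LS].
by split=> [|n]; rewrite [_ - _]addrC -scaleN1r ?L0 // LS [_ - phi n]addrC scaleN1r.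
Qed.

End ExtActions.

Definition ext_bimod (D : fp_model C)
    (P : forall X : fp_ob D, resolution (fp_mod X)) (q : nat) :
  bimod (mod_cat D).
Proof.
apply: (@Bimod k (mod_cat D) (fun X Y s => Ext (P X) (fp_mod Y) q s)
  (fun X Y Y' i j l e g u => ext_l e g u)
  (fun X X' Y i j l e u f => ext_r (P X') e u f)).
- move=> X Y Y' i j l e a f f' u; have [z [Zz ->]] := ecls_surj u.
  rewrite !ext_lE // [LHS](congr1 _ (gcompDl _ _ _ _ _)).
  by rewrite eclsZD //; exact: cocycle_post.
- move=> X Y Y' i j l e a f u v.
  have [z [Zz ->]] := ecls_surj u; have [w [Zw ->]] := ecls_surj v.
  rewrite -eclsZD // !ext_lE //; last exact: in_subZD.
  by rewrite gcompDr eclsZD //; exact: cocycle_post.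
- move=> X X' Y i j l e a u v f; have [phi phiL] := lift_exists (P X') (P X) f.
  have [z [Zz ->]] := ecls_surj u; have [w [Zw ->]] := ecls_surj v.
  rewrite -eclsZD // !(ext_rE _ phiL) //; last exact: in_subZD.
  by rewrite gcompDl eclsZD //; exact: cocycle_lift phiL _.
- move=> X X' Y i j l e a u f g.
  have [phi phiL] := lift_exists (P X') (P X) f.
  have [psi psiL] := lift_exists (P X') (P X) g.
  have [z [Zz ->]] := ecls_surj u.
  rewrite (ext_rE _ phiL) // (ext_rE _ psiL) // (ext_rE _ (lift_ZD a phiL psiL)) //.
  by rewrite gcompDr eclsZD //; [exact: cocycle_lift phiL _ | exact: cocycle_lift psiL _].
- move=> X Y i e u; have [z [Zz ->]] := ecls_surj u.
  by rewrite ext_lE // gcomp1m.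
- move=> X Y i e u; have [z [Zz ->]] := ecls_surj u.
  by rewrite (ext_rE _ (lift_id (P X))) // gcompm1.
- move=> X Y Y' Y'' i j l ij jl n e1 e2 e3 e4 g f u.
  have [z [Zz ->]] := ecls_surj u.
  rewrite !ext_lE //; last exact: cocycle_post.
  by congr ecls; exact: gcompA.
- move=> X X' X'' Y i j l ij jl n e1 e2 e3 e4 u f g.
  have [phi phiL] := lift_exists (P X') (P X) f.
  have [psi psiL] := lift_exists (P X'') (P X') g.
  have [z [Zz ->]] := ecls_surj u.
  rewrite (ext_rE _ (lift_comp e2 phiL psiL)) // (ext_rE _ phiL) //.
  rewrite (ext_rE _ psiL); last exact: cocycle_lift phiL _.
  by congr ecls; exact: gcompA.
- move=> X X' Y Y' i j l ij jl n e1 e2 e3 e4 g u f.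
  have [phi phiL] := lift_exists (P X') (P X) f.
  have [z [Zz ->]] := ecls_surj u.
  rewrite ext_lE // (ext_rE _ phiL); last exact: cocycle_post.
  rewrite (ext_rE _ phiL) // ext_lE; last exact: cocycle_lift phiL _.
  by congr ecls; exact: gcompA.
Defined.

End Ext.

(* Cohomological, starting at page 2; page r p q s is the part of internal
   degree s of E_r^(p,q), and differentials have internal degree 0. Pages and
   differentials with r < 2 are unused. *)
Record spectral_seq (k : fieldType) := SpectralSeq {
  page : nat -> int -> int -> int -> lmodType k;
  sdiff : forall (r : nat) (p q p' q' s : int),
    p + r%:Z = p' -> q + 1 - r%:Z = q' ->
    {linear page r p q s -> page r p' q' s};
  sdiff2 : forall (r : nat) (p q p' q' p'' q'' s : int)
    (ep : p + r%:Z = p') (eq : q + 1 - r%:Z = q')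
    (ep' : p' + r%:Z = p'') (eq' : q' + 1 - r%:Z = q'') (x : page r p q s),
    (2 <= r)%N -> sdiff s ep' eq' (sdiff s ep eq x) = 0;
  sturn : forall (r : nat) (p0 q0 p q p1 q1 s : int)
    (ep : p0 + r%:Z = p) (eq : q0 + 1 - r%:Z = q)
    (ep' : p + r%:Z = p1) (eq' : q + 1 - r%:Z = q1),
    (2 <= r)%N ->
    lin_iso (page r.+1 p q s) (homology (sdiff s ep eq) (sdiff s ep' eq'))
}.

Definition first_quadrant (k : fieldType) (E : spectral_seq k) : Prop :=
  forall (r : nat) (p q s : int), (2 <= r)%N -> (p < 0) || (q < 0) ->
  forall x : page E r p q s, x = 0.

(* In a first quadrant spectral sequence no nonzero differential enters or
   leaves E_r^(p,q) once r > p and r > q + 1. *)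
Definition einfty (k : fieldType) (E : spectral_seq k) (p q : nat) (s : int) :
  lmodType k := page E (maxn p.+1 q.+2) p%:Z q%:Z s.

(* H^n carries a decreasing filtration H^n = F^0 >= F^1 >= ... >= F^(n+1) = 0
   by graded submodules with F^p H^(p+q) / F^(p+1) H^(p+q) = E_infty^(p,q). *)
Definition converges (k : fieldType) (E : spectral_seq k)
    (H : nat -> int -> lmodType k) : Prop :=
  exists F : forall (p n : nat) (s : int), subspace (H n s),
  [/\ forall n s x, F 0 n s x,
      forall n s x, F n.+1 n s x -> x = 0,
      forall p n s x, F p.+1 n s x -> F p n s x
    & forall p q s,
        lin_iso (einfty E p q s) (subquot (F p (p + q)%N s) (F p.+1 (p + q)%N s))].

(* Main.v *)
(* Let G be the cofree module monad of C: (G M)(X) consists of the families of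
   k-linear maps C(Y, X) -> M(Y). Cofree modules are injective, and the unit
   M -> G M starts a functorial resolution d_0 = eta, d_(n+1) = eta - G(d_n) of M
   by iterated cofree modules, contracted over k by the evaluation rho at
   identities. Hence Ext^q(X, Y) is the cohomology of the complex of bimodules
   N^q(X, Y) = Hom(X, G^(q+1) Y) over mod(C); comparing it with Hom(P_q, Y)
   through the double complex Hom(P_i, G^(j+1) Y), both of whose augmentations
   are acyclic, respects the bimodule structures.

   Hochschild cochains, in curried form, are also elements of iterated cofree
   modules (over mod(C) this time). The spectral sequence is the one of the
   double complex K^(p,q) = C^p(mod(C), N^q), filtered by p. As k is a field,
   taking cohomology in the direction of q commutes with C^p, so that
   E_2^(p,q) = HH^p(mod(C), Ext^q). In the direction of p, each N^q(-, Y) is a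
   retract of a cofree module: by the Yoneda lemma Hom(X, G^(q+1) Y) only
   involves the values X(c) = Hom(h_c, X), and the representable modules h_c are
   finitely presented. So the cohomology in the direction of p is concentrated in
   degree 0, where it consists of the natural families
   x |-> (-1)^(|x| s) G^q(x) phi_c, that is, of Hochschild cochains phi of C. *)

From HB Require Import structures.
From mathcomp Require Import all_boot all_order all_algebra.
From mathcomp Require Import classical_sets boolp zify.
(* After MathComp, whose [path] it shadows *)
Require Import Defs.

Set Implicit Arguments.
Unset Strict Implicit.
Unset Printing Implicit Defensive.

Import GRing.Theory.
Local Open Scope ring_scope.

(** * Linear algebra *)

(** Lifts of morphisms to projective resolutions are unique only up to homotopy, so the complexes
    Hom(P_q, Y) are not functorial in X and cannot serve as coefficients of a double complex over
    mod(C). The complexes Hom(X, G^(q+1) Y) are strictly functorial in both variables. The price is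
    a comparison with the projective definition of Ext, but this has to be natural only in
    cohomology. The field enters through one fact: a linear map f admits a linear g with f g f = f.
    It makes G exact, which makes cochains an exact functor of their coefficients, and it makes
    cofree modules injective. Such a g is not linear over C; a layer of G on the target repairs
    this, since a morphism into a cofree module is the same as a k-linear family. For the same
    reason the complex begins with G Y and not with Y. The sign (-1)^(|x| s) answers the Koszul sign
    that the Hochschild differential puts on its left action term. *)

Definition lin_fun (k : fieldType) (V W : lmodType k) (f : V -> W) (H : linear f) :
  {linear V -> W} := HB.pack f (GRing.isLinear.Build k V W *:%R f H).

Section PseudoInverse.
Variables (k : fieldType) (V W : lmodType k) (f : {linear V -> W}).

(* Graphs of partially defined linear right inverses of [f] *)
Definition partial_inverse (A : W -> V -> Prop) : Prop :=
  [/\ forall w v v', A w v -> A w v' -> v = v',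
      forall (a : k) w w' v v', A w v -> A w' v' -> A (a *: w + w') (a *: v + v')
    & forall w v, A w v -> (exists u, w = f u) -> f v = w].

(** The value v0 at w0 has to be right on every a w0 + w in the image of f. If w0 + w1 = f u for
    some w1 in the domain, with value v1, then u - v1 works, the other sums being reduced to the
    domain by subtracting multiples of this one. Otherwise no such sum with a nonzero is in the
    image, and 0 works. *)
Lemma partial_inverse_extend A w0 : A 0 0 -> partial_inverse A -> ~ (exists v, A w0 v) ->
  exists B, [/\ partial_inverse B, forall w v, A w v -> B w v & exists v, B w0 v].
Proof.
move=> A0 [Afun Alin Ainv] Aw0.
have Alin1 (a : k) w v : A w v -> A (a *: w) (a *: v).
  by move=> wv; have := Alin a _ _ _ _ wv A0; rewrite !addr0.
have AlinB w w' v v' : A w v -> A w' v' -> A (w' - w) (v' - v).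
  by move=> wv wv'; rewrite addrC [v' - v]addrC -!scaleN1r; exact: Alin.
have [v0 v0P] : exists v0, forall a w v, A w v -> (exists u, a *: w0 + w = f u) ->
    f (a *: v0 + v) = a *: w0 + w.
  have [[w1 [v1 [wv1 [u w1u]]]]|no] :=
      pselect (exists w1 v1, A w1 v1 /\ exists u, w0 + w1 = f u).
    exists (u - v1) => a w v wv [u' wu'].
    have wE : w - a *: w1 = f (u' - a *: u).
      by rewrite [RHS]linearB [X in _ = _ - X]linearZZ -wu' -w1u scalerDr opprD addrACA subrr add0r.
    have := Ainv _ _ (AlinB _ _ _ _ (Alin1 a _ _ wv1) wv) (ex_intro _ _ wE).
    have -> : a *: (u - v1) + v = a *: u + (v - a *: v1).
      by rewrite scalerBr -addrA [- _ + v]addrC.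
    move=> vE; rewrite linearD linearZZ vE -w1u scalerDr -addrA; congr (_ + _).
    by rewrite addrCA subrr addr0.
  exists 0 => a w v wv [u wu].
  have [a0|a0] := eqVneq a 0.
    by rewrite a0 !scale0r !add0r; apply: (Ainv _ _ wv); exists u; rewrite -wu a0 scale0r add0r.
  case: no; exists (a^-1 *: w), (a^-1 *: v); split; first exact: Alin1.
  by exists (a^-1 *: u); rewrite linearZZ -wu scalerDr scalerA mulVf // scale1r.
pose B w v := exists a w' v', [/\ A w' v', w = a *: w0 + w' & v = a *: v0 + v'].
exists B; split; last 1 first.
- by exists v0, 1, 0, 0; rewrite !scale1r !addr0.
- split.
  + move=> w _ _ [a [w1 [v1 [A1 wE ->]]]] [b [w2 [v2 [A2 wE' ->]]]].
    have E : (b - a) *: w0 = w1 - w2.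
      by rewrite scalerBl -[w1](addKr (a *: w0)) -wE wE' addrA addrK addrC.
    have [ab|ab] := eqVneq (b - a) 0.
      have {ab} ab : a = b by apply/esym/eqP; rewrite -subr_eq0 ab.
      subst b; congr (_ + _); move: wE'; rewrite wE => /addrI w12.
      by subst w2; exact: Afun A1 A2.
    case: Aw0; exists ((b - a)^-1 *: (v1 - v2)).
    have -> : w0 = (b - a)^-1 *: (w1 - w2) by rewrite -E scalerA mulVf // scale1r.
    exact/Alin1/AlinB.
  + move=> c _ _ _ _ [a [w1 [v1 [A1 -> ->]]]] [b [w2 [v2 [A2 -> ->]]]].
    exists (c * a + b), (c *: w1 + w2), (c *: v1 + v2); split; first exact: Alin.
      by rewrite !scalerDr scalerA scalerDl addrACA.
    by rewrite !scalerDr scalerA scalerDl addrACA.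
  + by move=> _ _ [a [w [v [wv -> ->]]]]; exact: v0P.
- by move=> w v wv; exists 0, w, v; rewrite !scale0r !add0r.
Qed.

(** Zorn's lemma on graphs. Their domains may leave the image of f, so a maximal graph is defined on
    all of W. *)
Lemma linear_pseudo_inverse : exists g : {linear W -> V}, forall v, f (g (f v)) = f v.
Proof.
pose P : set (set (W * V)) := fun S => exists2 A : W -> V -> Prop,
  A 0 0 /\ partial_inverse A & S = (fun p => A p.1 p.2).
pose P' : set (set (W * V)) := fun S => S = set0 \/ P S.
have [F FP Ftot|S [PS Smax]] := @Zorn_bigcup (W * V) P'.
  have [[S0 FS0 S0n]|no] := pselect (exists2 S, F S & S <> set0); last first.
    left; rewrite -subset0 => p [S FS Sp].
    by case: no; exists S => // S0; rewrite S0 in Sp.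
  right; exists (fun w v => exists S, F S /\ S (w, v)).
    have FA S : F S -> S <> set0 -> exists2 A : W -> V -> Prop,
        A 0 0 /\ partial_inverse A & S = (fun p => A p.1 p.2).
      by move=> FS Sn; case: (FP _ FS).
    have two S1 S2 p1 p2 : F S1 -> F S2 -> S1 p1 -> S2 p2 ->
        exists S, [/\ F S, S p1, S p2 & P S].
      move=> F1 F2 Sp1 Sp2; have [S12|S21] := Ftot _ _ F1 F2.
        exists S2; split=> //; first exact: S12.
        by apply: FA => // S20; rewrite S20 in Sp2.
      exists S1; split=> //; first exact: S21.
      by apply: FA => // S10; rewrite S10 in Sp1.
    split; first by have [A [A0 _] AE] := FA _ FS0 S0n; exists S0; rewrite AE -AE.
    split.
    - move=> w v v' [S1 [F1 Sp1]] [S2 [F2 Sp2]].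
      have [S [FS h1 h2 [A [_ [Af _ _]] AE]]] := two _ _ _ _ F1 F2 Sp1 Sp2.
      by rewrite AE in h1 h2; exact: Af h1 h2.
    - move=> a w w' v v' [S1 [F1 Sp1]] [S2 [F2 Sp2]].
      have [S [FS h1 h2 [A [_ [_ Al _]] AE]]] := two _ _ _ _ F1 F2 Sp1 Sp2.
      by exists S; split=> //; rewrite AE in h1 h2 *; exact: Al h1 h2.
    - move=> w v [S1 [F1 Sp1]].
      have [S [FS h1 _ [A [_ [_ _ Ai]] AE]]] := two _ _ _ _ F1 F1 Sp1 Sp1.
      by rewrite AE in h1; exact: Ai.
  apply: funext => -[w v]; apply: propext; split; last by move=> [S [FS Sp]]; exists S.
  by move=> [S FS Sp]; exists S.
have P00 : P (fun p => p = (0, 0)).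
  exists (fun w v => w = 0 /\ v = 0); last first.
    by apply: funext => -[w v]; apply: propext; split=> [[-> ->]|[/= -> ->]].
  split=> //; split; first by move=> ? ? ? [_ ->] [_ ->].
    by move=> a ? ? ? ? [-> ->] [-> ->]; rewrite !scaler0 !addr0.
  by move=> ? ? [-> ->] _; rewrite linear0.
have {PS} [A [A0 Ai] SE] : P S.
  case: PS => // S0; case: (Smax (fun p => p = (0, 0))); last by right.
  by rewrite S0; split=> [? []|/(_ (0, 0) erefl)].
have tot w : exists v, A w v.
  have [//|no] := pselect (exists v, A w v).
  have [B [Bi AB [v Bwv]]] := partial_inverse_extend A0 Ai no.
  case: (Smax (fun p => B p.1 p.2)); last by right; exists B => //; split=> //; exact: AB.
  rewrite SE; split=> [[w' v']|/(_ (w, v) Bwv) wv]; first exact: AB.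
  by case: no; exists v.
have [Af Al Ar] := Ai.
pose g w := sval (cid (tot w)); have gP w : A w (g w) := svalP (cid (tot w)).
have gl : linear g by move=> a w w'; exact: Af (gP _) (Al _ _ _ _ _ (gP w) (gP w')).
exists (lin_fun gl) => v; apply: (Ar _ _ (gP _)).
by exists v.
Qed.

End PseudoInverse.

Section SubquotientIso.
Variables (k : fieldType) (V W : lmodType k) (Z B : subspace V).

(* Isomorphisms out of a subquotient are given by relations, since most of them
   involve choices of lifts or of cobounding elements. *)
Variable R : V -> W -> Prop.
Hypothesis Rlin : forall (a : k) z z' w w', R z w -> R z' w' -> R (a *: z + z') (a *: w + w').
Hypothesis Rtot : forall z, Z z -> exists w, R z w.

(** A pointwise choice is already linear on Z: the defect of linearity is related to 0 by R, so it
    vanishes. *)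
Lemma corr_fun : (forall z w, Z z -> R z w -> z = 0 -> w = 0) ->
  exists f : V -> W, (forall z, Z z -> R z (f z)) /\
    (forall (a : k) z z', Z z -> Z z' -> f (a *: z + z') = a *: f z + f z').
Proof.
move=> R0.
pose f z := if pselect (Z z) is left Zz then sval (cid (Rtot Zz)) else 0.
have fP z : Z z -> R z (f z).
  by rewrite /f; case: pselect => // Zz _; exact: (svalP (cid (Rtot Zz))).
exists f; split=> // a z z' Zz Zz'.
have Z3 := in_subZD a Zz Zz'.
have := Rlin (-1) (Rlin a (fP _ Zz) (fP _ Zz')) (fP _ Z3).
rewrite !scaleN1r addNr => /R0 E; apply/eqP; rewrite -subr_eq0 addrC E //.
exact: in_sub0.
Qed.

Hypothesis Rker : forall z w, Z z -> R z w -> w = 0 <-> B z.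

Lemma subquot_iso : (forall w, exists z, Z z /\ R z w) -> lin_iso (subquot Z B) W.
Proof.
move=> Rsurj.
have [f [fR fl]] : exists f : V -> W, (forall z, Z z -> R z (f z)) /\
    (forall (a : k) z z', Z z -> Z z' -> f (a *: z + z') = a *: f z + f z').
  by apply: corr_fun => z w Zz zw z0; apply/(Rker Zz zw); rewrite z0; exact: in_sub0.
have Rfun z w w' : Z z -> R z w -> R z w' -> w = w'.
  move=> Zz zw zw'; have := Rlin (-1) zw' zw; rewrite !scaleN1r addNr addrC.
  move=> R0; apply/eqP; rewrite -subr_eq0; apply/eqP/(Rker (in_sub0 Z) R0).
  exact: in_sub0.
pose g (u : subquot Z B) := f (sval (cid (cls_surj u))).
have gE z : Z z -> g (cls Z B z) = f z.
  move=> Zz; rewrite /g; case: cid => z' [Zz'] /= /esym /(clsP B Zz' Zz) Bzz.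
  have Zd : Z (z' - z) by rewrite addrC -scaleN1r; exact: in_subZD.
  apply/eqP; rewrite -subr_eq0; apply/eqP/(Rker Zd) => //.
  have := Rlin (-1) (fR _ Zz) (fR _ Zz'); rewrite !scaleN1r.
  by rewrite addrC [- f z + _]addrC.
have gl : linear g.
  move=> a u v; have [z [Zz ->]] := cls_surj u; have [z' [Zz' ->]] := cls_surj v.
  by rewrite -clsZD // !gE //; [exact: fl | exact: in_subZD].
exists (lin_fun gl).
pose h w := cls Z B (sval (cid (Rsurj w))).
exists h.
  move=> u; have [z [Zz ->]] := cls_surj u; rewrite /= gE // /h.
  case: cid => z' [Zz'] /= Rz'; apply/clsP => //.
  have Zd : Z (z' - z) by rewrite addrC -scaleN1r; exact: in_subZD.
  apply/(Rker (w := 0) Zd) => //.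
  have := Rlin (-1) (fR _ Zz) Rz'; rewrite !scaleN1r addNr.
  by rewrite addrC.
move=> w; rewrite /= /h; case: cid => z [Zz Rz] /=; rewrite gE //.
exact: Rfun Zz (fR _ Zz) Rz.
Qed.

End SubquotientIso.

(** * Double complexes *)

Section SubquotientMap.
Variables (k : fieldType) (V V' : lmodType k) (Z B : subspace V) (Z' B' : subspace V').
Variable f : {linear V -> V'}.
Hypotheses (fZ : forall z, Z z -> Z' (f z)) (fB : forall z, Z z -> B z -> B' (f z)).

Let g (u : subquot Z B) : subquot Z' B' := cls Z' B' (f (sval (cid (cls_surj u)))).

Let gE z : Z z -> g (cls Z B z) = cls Z' B' (f z).
Proof.
move=> Zz; rewrite /g; case: cid => z' [Zz'] /= /esym /(clsP B Zz' Zz) Bzz.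
apply/clsP; [exact: fZ | exact: fZ | rewrite -linearB; apply: fB => //].
by rewrite addrC -scaleN1r; exact: in_subZD.
Qed.

Let g_linear : linear g.
Proof.
move=> a u v; have [z [Zz ->]] := cls_surj u; have [z' [Zz' ->]] := cls_surj v.
rewrite -clsZD // !gE //; last exact: in_subZD.
by rewrite linearP clsZD //; exact: fZ.
Qed.

(** [fB] speaks only of elements of Z because denominators such as [Br] are not contained in their
    numerators. *)
Definition subquot_map : {linear subquot Z B -> subquot Z' B'} := lin_fun g_linear.

Lemma subquot_mapE z : Z z -> subquot_map (cls Z B z) = cls Z' B' (f z).
Proof. exact: gE. Qed.

End SubquotientMap.

Lemma cls0P (k : fieldType) (V : lmodType k) (Z B : subspace V) z :
  Z z -> cls Z B z = 0 <-> B z.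
Proof.
move=> Zz; have c0 : cls Z B 0 = 0.
  by have := clsZD B (-1) (in_sub0 Z) (in_sub0 Z); rewrite scaler0 addr0 scaleN1r addNr.
by rewrite -{1}c0 -{2}[z]subr0; apply: clsP => //; exact: in_sub0.
Qed.

Lemma in_subB (k : fieldType) (V : lmodType k) (S : subspace V) u v :
  S u -> S v -> S (u - v).
Proof. by move=> Su Sv; rewrite addrC -scaleN1r; exact: in_subZD. Qed.

Lemma in_subD (k : fieldType) (V : lmodType k) (S : subspace V) u v :
  S u -> S v -> S (u + v).
Proof. by move=> Su Sv; rewrite -[u]scale1r; exact: in_subZD. Qed.

(* The two differentials anticommute, so that no sign enters the total differential *)
Record dcomplex (k : fieldType) := DComplex {
  dcx :> nat -> nat -> lmodType k;
  dh : forall p q, {linear dcx p q -> dcx p.+1 q};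
  dv : forall p q, {linear dcx p q -> dcx p q.+1};
  dhh : forall p q (x : dcx p q), dh p.+1 q (dh p q x) = 0;
  dvv : forall p q (x : dcx p q), dv p q.+1 (dv p q x) = 0;
  dhv : forall p q (x : dcx p q), dh p q.+1 (dv p q x) + dv p.+1 q (dh p q x) = 0
}.

Arguments dh {k d p q}.
Arguments dv {k d p q}.

Lemma transpose_dhv (k : fieldType) (A : dcomplex k) q p (x : A p q) :
  dv (dh x) + dh (dv x) = 0.
Proof. by rewrite addrC dhv. Qed.

Definition transpose (k : fieldType) (A : dcomplex k) : dcomplex k :=
  @DComplex k (fun p q => A q p) (fun p q => @dv k A q p) (fun p q => @dh k A q p)
    (fun p q => @dvv k A q p) (fun p q => @dhh k A q p) (@transpose_dhv k A).

Section Total.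
Variables (k : fieldType) (A : dcomplex k).

(* Elements of all bidegrees together: homogeneous elements are cut out by
   subspaces, so that the pages of the spectral sequence are subquotients of a
   single space. *)
Definition tot : lmodType k := dprod (fun i : nat * nat => A i.1 i.2).

Implicit Types x y : tot.

Lemma tot_addE x y i : (x + y) i = x i + y i.
Proof. by []. Qed.
Lemma tot_oppE x i : (- x) i = - x i.
Proof. by []. Qed.
Lemma tot_subE x y i : (x - y) i = x i - y i.
Proof. by []. Qed.

Definition tot_dh x p q : A p q :=
  match p return A p q with 0 => 0 | p'.+1 => dh (x (p', q)) end.
Definition tot_dv x p q : A p q :=
  match q return A p q with 0 => 0 | q'.+1 => dv (x (p, q')) end.

Definition totd_fun x : tot := fun i => tot_dh x i.1 i.2 + tot_dv x i.1 i.2.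

Lemma totd_linear : linear totd_fun.
Proof.
move=> a x y; apply: functional_extensionality_dep => -[p q].
rewrite dprodZDE /totd_fun scalerDr addrACA; congr (_ + _).
  by case: p => [|p] /=; rewrite ?scaler0 ?addr0 // -linearP.
by case: q => [|q] /=; rewrite ?scaler0 ?addr0 // -linearP.
Qed.

Definition totd : {linear tot -> tot} := lin_fun totd_linear.

Lemma totdE x p q : totd x (p, q) = tot_dh x p q + tot_dv x p q.
Proof. by []. Qed.

Lemma eq_tot_dh x y p q :
  (forall p', p'.+1 = p -> x (p', q) = y (p', q)) -> tot_dh x p q = tot_dh y p q.
Proof. by case: p => //= p ->. Qed.

Lemma eq_tot_dv x y p q :
  (forall q', q'.+1 = q -> x (p, q') = y (p, q')) -> tot_dv x p q = tot_dv y p q.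
Proof. by case: q => //= q ->. Qed.

Lemma tot_dh0 x p q : (forall p', p'.+1 = p -> x (p', q) = 0) -> tot_dh x p q = 0.
Proof. by case: p => //= p -> //; rewrite linear0. Qed.

Lemma tot_dv0 x p q : (forall q', q'.+1 = q -> x (p, q') = 0) -> tot_dv x p q = 0.
Proof. by case: q => //= q -> //; rewrite linear0. Qed.

Lemma totdd x : totd (totd x) = 0.
Proof.
apply: functional_extensionality_dep => -[p q]; rewrite totdE dprod0E.
have hh p' q' : dh (tot_dh x p' q') = 0 by case: p' => [|p'] /=; rewrite ?linear0 ?dhh.
have vv p' q' : dv (tot_dv x p' q') = 0 by case: q' => [|q'] /=; rewrite ?linear0 ?dvv.
case: p q => [|p] [|q] /=; rewrite ?addr0 ?add0r // ?totdE ?linearD ?hh ?vv ?add0r ?addr0 //=.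
- exact: linear0.
- exact: linear0.
- exact: dhv.
Qed.

Definition homog (n : int) : subspace tot.
Proof.
exists (fun x => forall p q, (p + q)%:Z != n -> x (p, q) = 0) => // a x y xn yn p q pq.
by rewrite dprodZDE xn // yn // scaler0 addr0.
Defined.

Definition fil (p : int) : subspace tot.
Proof.
exists (fun x => forall p' q, p'%:Z < p -> x (p', q) = 0) => // a x y xn yn p' q pq.
by rewrite dprodZDE xn // yn // scaler0 addr0.
Defined.

Lemma totd_homog n x : homog n x -> homog (n + 1) (totd x).
Proof.
move=> xn p q pq; rewrite totdE.
have -> : tot_dh x p q = 0.
  by case: p pq => //= p pq; rewrite xn ?linear0 //; apply: contraNneq pq => <-; lia.
have -> : tot_dv x p q = 0.
  by case: q pq => //= q pq; rewrite xn ?linear0 //; apply: contraNneq pq => <-; lia.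
exact: addr0.
Qed.

Lemma fil_le p p' x : p' <= p -> fil p x -> fil p' x.
Proof. by move=> pp' xp i j ij; apply: xp; lia. Qed.

Lemma fil_all p x : p <= 0 -> fil p x.
Proof. by move=> p0 i j ij; lia. Qed.

Lemma homog_fil0 n p x : homog n x -> fil p x -> n < p -> x = 0.
Proof.
move=> xn xp np; apply: functional_extensionality_dep => -[i j].
have [ip|pi] := Num.Theory.ltrP i%:Z p; first exact: xp.
by apply: xn; apply/eqP; lia.
Qed.

Definition Zr (r : nat) (p q : int) : subspace tot.
Proof.
exists (fun x => [/\ homog (p + q) x, fil p x & fil (p + r%:Z) (totd x)]).
  by rewrite linear0; split; exact: in_sub0.
move=> a x y [x1 x2 x3] [y1 y2 y3].
by rewrite linearP; split; exact: in_subZD.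
Defined.

(** The usual denominator Z_(r-1)^(p+1) + d Z_(r-1)^(p-r+1), without the conditions that membership
    of u + d v in Z_r forces: then u has degree p + q, d u is in F^(p+r) and d v is in F^p. *)
Definition Br (r : nat) (p q : int) : subspace tot.
Proof.
exists (fun x => exists u v,
  [/\ x = u + totd v, fil (p + 1) u, homog (p + q - 1) v & fil (p - r%:Z + 1) v]).
  by exists 0, 0; rewrite linear0 addr0; split=> //; exact: in_sub0.
move=> a x y [u [v [-> ? ? ?]]] [u' [v' [-> ? ? ?]]].
exists (a *: u + u'), (a *: v + v'); split; try exact: in_subZD.
by rewrite linearP scalerDr addrACA.
Defined.

Definition Epage r p q : lmodType k := subquot (Zr r p q) (Br r p q).

Section Diff.
Variables (r : nat) (p q p' q' : int).
Hypotheses (ep : p + r%:Z = p') (eq : q + 1 - r%:Z = q').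

Lemma Zr_totd x : Zr r p q x -> Zr r p' q' (totd x).
Proof.
move=> [x1 x2 x3]; split; last by rewrite totdd; exact: in_sub0.
  by have -> : p' + q' = p + q + 1 by [lia]; exact: totd_homog.
by rewrite -ep.
Qed.

(** Since d x = d u, the bounding element is u. Its homogeneity is not part of [Br] and is recovered
    from x and d v. *)
Lemma Br_totd x : Zr r p q x -> Br r p q x -> Br r p' q' (totd x).
Proof.
move=> [x1 _ _] [u [v [xE u1 v1 v2]]]; exists 0, u.
rewrite xE linearD totdd addr0 add0r; split=> //.
  have -> : u = x - totd v by rewrite xE addrK.
  have -> : p' + q' - 1 = p + q by [lia].
  apply: in_subB => //; have -> : p + q = p + q - 1 + 1 by [lia].
  exact: totd_homog.
by have -> : p' - r%:Z + 1 = p + 1 by [lia].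
Qed.

Definition Ediff : {linear Epage r p q -> Epage r p' q'} := subquot_map Zr_totd Br_totd.

Lemma EdiffE x : Zr r p q x -> Ediff (cls _ _ x) = cls _ _ (totd x).
Proof. exact: subquot_mapE. Qed.

End Diff.

Lemma Ediff2 r p q p' q' p'' q'' (ep : p + r%:Z = p') (eq : q + 1 - r%:Z = q')
    (ep' : p' + r%:Z = p'') (eq' : q' + 1 - r%:Z = q'') (x : Epage r p q) :
  Ediff ep' eq' (Ediff ep eq x) = 0.
Proof.
have [z [Zz ->]] := cls_surj x; rewrite EdiffE // EdiffE ?totdd; last exact: Zr_totd Zz.
by apply/cls0P; exact: in_sub0.
Qed.

Lemma Eturn r p0 q0 p q p1 q1 (ep : p0 + r%:Z = p) (eq : q0 + 1 - r%:Z = q)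
    (ep' : p + r%:Z = p1) (eq' : q + 1 - r%:Z = q1) :
  lin_iso (Epage r.+1 p q) (homology (Ediff ep eq) (Ediff ep' eq')).
Proof.
pose c x : Epage r p q := cls (Zr r p q) (Br r p q) x.
have ZS x : Zr r.+1 p q x -> Zr r p q x.
  by move=> [x1 x2 x3]; split=> //; apply: fil_le x3; lia.
have kerc x : Zr r p q x -> ker_sub (Ediff ep' eq') (c x) <-> Br r p1 q1 (totd x).
  move=> Zx; rewrite -[ker_sub _ _]/(Ediff ep' eq' (c x) = 0) /c EdiffE //; apply: cls0P.
  exact: (Zr_totd ep' eq').
have kc x : Zr r.+1 p q x -> ker_sub (Ediff ep' eq') (c x).
  move=> Zx; have [x1 x2 x3] := Zx; apply/kerc; first exact: ZS.
  exists (totd x), 0; rewrite linear0 addr0; split=> //; try exact: in_sub0.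
  by apply: fil_le x3; lia.
apply: (@subquot_iso _ _ _ _ _ (fun x w => Zr r.+1 p q x /\ w = cls _ _ (c x))).
- move=> a z z' w w' [Zz ->] [Zz' ->]; split; first exact: in_subZD.
  by rewrite /c clsZD ?clsZD //; exact: ZS || exact: kc.
- by move=> z Zz; eexists; split; first exact: Zz.
- move=> x w _ [Zx ->]; have [x1 x2 x3] := Zx.
  rewrite cls0P; last exact: kc.
  split=> [[y]|[u [v [xE u1 v1 v2]]]].
    have [z [Zz ->]] := cls_surj y; rewrite EdiffE // => /(clsP _ (ZS _ Zx) (Zr_totd ep eq Zz)).
    have [z1 z2 z3] := Zz; move=> [u [v [xE u1 v1 v2]]].
    (* From x - d z = u + d v. The element z lies in F^(p-r), the step of the filtration that [Br]
       allows on page r + 1. *)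
    exists u, (v + z); split=> //.
    + by rewrite linearD addrA -xE subrK.
    + by apply: in_subD => //; have -> : p + q - 1 = p0 + q0 by [lia].
    + by apply: in_subD; [apply: fil_le v2 | apply: fil_le z2]; lia.
  (* Here v represents a class of page r that hits the class of x: d v = x - u is in F^p, so v is in
     Z_r. *)
  have dvE : totd v = x - u by rewrite xE addrC addKr.
  have Zv : Zr r p0 q0 v.
    split; first by have -> : p0 + q0 = p + q - 1 by [lia].
      by apply: fil_le v2; lia.
    rewrite dvE ep; apply: in_subB => //; apply: fil_le u1; lia.
  exists (cls _ _ v); rewrite EdiffE //; apply/clsP; first exact: ZS.
    exact: (Zr_totd ep eq).
  exists u, 0; rewrite linear0 addr0; split; try exact: in_sub0; last by [].
  by rewrite dvE opprB addrC subrK.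
- move=> w; have [e [ke ->]] := cls_surj w; have [x [Zx xE]] := cls_surj e.
  move: ke; rewrite xE => /(kerc _ Zx) [u [v [dxE u1 v1 v2]]].
  have [x1 x2 x3] := Zx.
  (* Thus x - v has the class of x on page r, while its differential u lies one step deeper than
     that of x. *)
  have vp : fil (p + 1) v by apply: fil_le v2; lia.
  have Zy : Zr r.+1 p q (x - v).
    split; first by apply: in_subB => //; have -> : p + q = p1 + q1 - 1 by [lia].
      by apply: in_subB => //; apply: fil_le vp; lia.
    by rewrite linearB dxE addrK; apply: fil_le u1; lia.
  exists (x - v); split=> //; split=> //; congr cls; apply/clsP => //; first exact: ZS.
  exists v, 0; rewrite linear0 addr0 opprB addrC subrK; split=> //; exact: in_sub0.
Qed.

(** If p < 0, all of the total complex is in F^(p+1), which the denominator contains. If q < 0, the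
    total degree p + q is below the filtration degree p, so the numerator is 0. *)
Lemma Epage_first_quadrant r p q (x : Epage r p q) : (p < 0) || (q < 0) -> x = 0.
Proof.
have [z [[z1 z2 z3] ->]] := cls_surj x => pq; apply/cls0P; first by split.
have [p0|p0] := Num.Theory.ltrP p 0.
  exists z, 0; rewrite linear0 addr0; split; try exact: in_sub0; first by [].
  by apply: fil_all; lia.
have -> : z = 0 by apply: homog_fil0 z1 z2 _; lia.
exact: in_sub0.
Qed.

(* E_2^(p,q) is the subquotient of A p q formed by the leading terms of the
   elements of Z_2, respectively of B_2 *)
Definition lead_cycle p q : subspace (A p q).
Proof.
exists (fun a => dv a = 0 /\ exists x : tot, dh a = tot_dv x p.+1 q).
  by rewrite !linear0; split=> //; exists 0; case: q => //= q; rewrite linear0.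
move=> c a b [a1 [x ax]] [b1 [y by_]]; rewrite !linearP a1 b1 scaler0 addr0; split=> //.
exists (c *: x + y); rewrite ax by_; case: q {a a1 ax b b1 by_} => /= [|q].
  by rewrite scaler0 addr0.
by rewrite -linearP.
Defined.

(** Witnesses range over [tot] so that [tot_dh] and [tot_dv] supply 0 at the edges p = 0 and q =
    0. *)
Definition lead_bound p q : subspace (A p q).
Proof.
exists (fun a => exists x y : tot, [/\ a = tot_dh x p q + tot_dv y p q
  & forall p', p'.+1 = p -> dv (x (p', q)) = 0]).
  exists 0, 0; split; last by move=> *; exact: linear0.
  by case: p q => [|p] [|q] /=; rewrite ?linear0 ?addr0.
move=> c _ _ [x [y [-> xv]]] [x' [y' [-> xv']]]; exists (c *: x + x'), (c *: y + y').
split; last by move=> p' pp'; rewrite linearP xv // xv' // scaler0 addr0.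
rewrite scalerDr addrACA; congr (_ + _).
  by case: p {xv xv'} => [|p] /=; rewrite ?scaler0 ?addr0 // -linearP.
by case: q {xv xv'} => [|q] /=; rewrite ?scaler0 ?addr0 // -linearP.
Defined.

Definition tot_inj p q (a : A p q) : tot :=
  @dfwith _ (fun i : nat * nat => A i.1 i.2) (fun=> 0) (p, q) a.

Lemma tot_injE p q (a : A p q) : tot_inj a (p, q) = a.
Proof. exact: (@dfwith_in _ (fun i : nat * nat => A i.1 i.2)). Qed.

Lemma tot_inj0 p q (a : A p q) p' q' : (p', q') != (p, q) -> tot_inj a (p', q') = 0.
Proof.
move=> pq; rewrite /tot_inj (@dfwith_out _ (fun i : nat * nat => A i.1 i.2)) //.
by rewrite eq_sym.
Qed.

Lemma tot_inj_linear p q : linear (@tot_inj p q).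
Proof.
move=> c a b; apply: functional_extensionality_dep => -[i j]; rewrite dprodZDE.
have [[-> ->]|ne] := (i, j) =P (p, q); first by rewrite !tot_injE.
by rewrite !tot_inj0 ?scaler0 ?addr0 //; exact/eqP.
Qed.

Lemma tot_inj_homog p q (a : A p q) n : n = (p + q)%:Z -> homog n (tot_inj a).
Proof. by move=> -> i j ij; apply: tot_inj0; apply: contraNneq ij => -[-> ->]. Qed.

Lemma homog_part n (y : tot) :
  exists y', homog n y' /\ forall i j, (i + j)%:Z = n -> y' (i, j) = y (i, j).
Proof.
exists (fun i => if (i.1 + i.2)%:Z == n then y i else 0); split=> i j /=.
  by move=> /negPf ->.
by move=> ->; rewrite eqxx.
Qed.

(** All entries of an element of Z_2 other than the one at (p, q) lie in F^(p+1), hence in the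
    denominator. A leading term needs just one correction, in column p + 1, to become an element of
    Z_2. *)
Lemma Epage2_lead p q : lin_iso (Epage 2 p%:Z q%:Z) (subquot (lead_cycle p q) (lead_bound p q)).
Proof.
pose Z2 := Zr 2 p%:Z q%:Z.
have ZL x : Z2 x -> lead_cycle p q (x (p, q)).
  move=> [x1 x2 x3]; split.
    have := x3 p q.+1; rewrite totdE tot_dh0 ?add0r /= => [-> //|p' pp]; first by lia.
    by apply: x2; lia.
  exists (- x); have := x3 p.+1 q; rewrite totdE /= => /(_ ltac:(lia)) /eqP.
  rewrite addr_eq0 => /eqP ->; case: (q) => /= [|q1]; first exact: oppr0.
  by rewrite -linearN.
apply: (@subquot_iso _ _ _ _ _ (fun x w => Z2 x /\ w = cls _ _ (x (p, q)))).
- move=> c z z' w w' [Zz ->] [Zz' ->]; split; first exact: in_subZD.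
  by rewrite dprodZDE clsZD //; exact: ZL.
- by move=> z Zz; eexists; split; first exact: Zz.
- move=> x w _ [Zx ->]; have [x1 x2 x3] := Zx; rewrite cls0P; last exact: ZL.
  split=> [[y [z [xE yv]]]|[u [v [xE u1 v1 v2]]]].
    have [y' [y'1 y'E]] := homog_part (p%:Z + q%:Z - 1) y.
    have [z' [z'1 z'E]] := homog_part (p%:Z + q%:Z - 1) z.
    (* Column p - 1 is taken from y and column p from z, so that d v has the entry of x at (p, q).
       As dv kills the entry of y, d v has nothing in column p - 1. *)
    pose v : tot := fun i =>
      if i.1.+1 == p then y' i else if i.1 == p then z' i else 0.
    have vl i j : (i.+1 < p)%N -> v (i, j) = 0.
      by move=> ip; rewrite /v /=; case: eqP => [|_]; [lia|]; case: eqP => [|//]; lia.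
    have vy i j : i.+1 = p -> v (i, j) = y' (i, j) by move=> ip; rewrite /v /= ip eqxx.
    have vz j : v (p, j) = z' (p, j).
      by rewrite /v /= eqxx; case: eqP => [|//]; lia.
    have v1 : homog (p%:Z + q%:Z - 1) v.
      move=> i j ij; rewrite /v /=; case: ifP => _; first exact: y'1.
      by case: ifP => // _; exact: z'1.
    exists (x - totd v), v; split=> //; first by rewrite subrK.
      move=> i j ij; rewrite tot_subE.
      have [e|ne] := eqVneq (i + j)%N (p + q)%N; last first.
        by rewrite x1 ?(totd_homog v1) ?subr0 //; lia.
      have [ip|ip] := eqVneq i p; last first.
        rewrite x2; last by lia.
        rewrite totdE tot_dh0 ?add0r => [|i' ii']; last by apply: vl; lia.
        have [ip1|ip1] := eqVneq i.+1 p; last first.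
          by rewrite tot_dv0 ?oppr0 ?addr0 // => j' _; apply: vl; lia.
        have -> : j = q.+1 by lia.
        by rewrite /= vy // y'E ?yv ?oppr0 //; lia.
      subst i; have jq : j = q by lia.
      subst j; apply/eqP; rewrite subr_eq0 xE totdE; apply/eqP.
      congr (_ + _); [apply: eq_tot_dh => i ii | apply: eq_tot_dv => j jj].
        by move: ii => /= ii; rewrite vy // y'E //; lia.
      by move: jj => /= jj; rewrite vz z'E //; lia.
    by move=> i j ij; apply: vl; lia.
  exists v, v; split; last first.
    move=> p' pp'; have := x2 p' q.+1; have := u1 p' q.+1; rewrite xE.
    rewrite tot_addE totdE /= => -> ; last by lia.
    rewrite add0r => /(_ ltac:(lia)); rewrite tot_dh0 ?add0r // => i ii.
    by apply: v2; lia.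
  rewrite {1}xE tot_addE u1; last by lia.
  by rewrite add0r totdE.
- move=> w; have [a [[a1 [b bE]] ->]] := cls_surj w.
  have [b' [b'1 b'E]] := homog_part (p%:Z + q%:Z) b.
  (* Subtracting c cancels dh a, the entry of the differential at (p + 1, q). *)
  pose c : tot := fun i => if i.1 == p.+1 then b' i else 0.
  pose x := tot_inj a - c.
  have xE i j : x (i, j) = tot_inj a (i, j) - (if i == p.+1 then b' (i, j) else 0) by [].
  have xp j : x (p, j) = tot_inj a (p, j).
    by rewrite xE; case: eqP => [|_]; [lia | rewrite subr0].
  have xl i j : (i < p)%N -> x (i, j) = 0.
    move=> ip; rewrite xE tot_inj0; last by apply/eqP => -[]; lia.
    by case: eqP => [|_]; [lia | rewrite subr0].
  have x1 : homog (p%:Z + q%:Z) x.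
    apply: in_subB; first exact: tot_inj_homog.
    by move=> i j ij; rewrite /c /=; case: ifP => // _; exact: b'1.
  have Zx : Z2 x.
    split; [exact: x1 | by move=> i j ij; apply: xl; lia | move=> i j ij].
    have [e|ne] := eqVneq (i + j)%N (p + q).+1; last first.
      by apply: (totd_homog x1); lia.
    rewrite totdE; have [ip|ip] := leqP i p.
      rewrite tot_dh0 ?add0r => [|i' ii']; last by apply: xl; lia.
      have [ip'|ip'] := ltnP i p; first by apply: tot_dv0 => j' _; exact: xl.
      have ? : i = p by lia.
      subst i; have -> : j = q.+1 by lia.
      by rewrite /= xp tot_injE.
    have ? : i = p.+1 by lia.
    subst i; have ? : j = q by lia.
    subst j; rewrite /= xp tot_injE bE (@eq_tot_dv b (- x)) => [|j jj].
      case: (q) => [|q'] /=; first exact: addr0.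
      by rewrite -linearD tot_oppE addNr linear0.
    rewrite tot_oppE xE tot_inj0; last by apply/eqP => -[]; lia.
    by rewrite eqxx add0r opprK b'E //; lia.
  by exists x; split=> //; split=> //; rewrite xp tot_injE.
Qed.

End Total.

(** The kernel of dh on column 0, up to isomorphism, with the differential induced by dv. If the
    rows are exact elsewhere ([dh_exact]), its cohomology is that of the total complex. *)
Record augmentation (k : fieldType) (A : dcomplex k) := Augmentation {
  aug_mod :> nat -> lmodType k;
  aug_d : forall q, {linear aug_mod q -> aug_mod q.+1};
  aug_i : forall q, {linear aug_mod q -> A 0 q};
  aug_inj : forall q w, aug_i q w = 0 -> w = 0;
  aug_ker : forall q (a : A 0 q), dh a = 0 <-> exists w, a = aug_i q w;
  aug_comm : forall q w, dv (aug_i q w) = aug_i q.+1 (aug_d q w)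
}.

Arguments aug_d {k A} W {q} : rename.
Arguments aug_i {k A} W {q} : rename.

Definition dh_exact (k : fieldType) (A : dcomplex k) : Prop :=
  forall p q (a : A p.+1 q), dh a = 0 -> exists b, a = dh b.

Section Augmented.
Variables (k : fieldType) (A : dcomplex k).

Lemma totd_inj p q (a : A p q) : totd A (tot_inj a) = tot_inj (dh a) + tot_inj (dv a).
Proof.
apply: functional_extensionality_dep => -[i j]; rewrite tot_addE totdE.
congr (_ + _).
  have [[ip ->]|/eqP ne] := (i, j) =P (p.+1, q).
    by move: ip => ip; subst i; rewrite tot_injE /= tot_injE.
  rewrite tot_inj0 // tot_dh0 // => i' ii; rewrite tot_inj0 //.
  by apply: contraNneq ne => -[e1 e2]; rewrite -ii e1 e2.
have [[-> jq]|/eqP ne] := (i, j) =P (p, q.+1).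
  by move: jq => jq; subst j; rewrite tot_injE /= tot_injE.
rewrite tot_inj0 // tot_dv0 // => j' jj; rewrite tot_inj0 //.
by apply: contraNneq ne => -[e1 e2]; rewrite -jj e1 e2.
Qed.

Lemma tot_inj00 p q : tot_inj (0 : A p q) = 0.
Proof.
by have := tot_inj_linear (-1) (0 : A p q) 0; rewrite scaler0 addr0 scaleN1r addNr.
Qed.

Hypothesis Aex : dh_exact A.

(** Homogeneity leaves finitely many columns, which are cleared from the right by exactness of the
    rows. Asking d x to vanish only off column 0 makes the lemma apply to cycles and also to
    elements bounding something in column 0. *)
Lemma reduce_column0 (n : int) (x : tot A) :
  homog A n x -> (forall p q, totd A x (p.+1, q) = 0) ->
  exists y, homog A (n - 1) y /\ forall p q, (x - totd A y) (p.+1, q) = 0.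
Proof.
move=> xn dx; have [m xm] : exists m, forall p q, (m < p)%N -> x (p, q) = 0.
  by exists `|n|%N => p q np; apply: xn; lia.
elim: m x xn dx xm => [|m IH] x xn dx xm.
  by exists 0; split; [exact: in_sub0 | move=> p q; rewrite linear0 subr0 xm].
have xb q : exists b : A m q, x (m.+1, q) = dh b.
  apply: Aex; have := dx m.+1 q; rewrite totdE /=.
  by rewrite tot_dv0 ?addr0 // => q' _; exact: xm.
(* Preimages under dh fill column m. The test on degrees is needed because a chosen preimage of 0
   may be nonzero. *)
pose z : tot A := fun i => let: (p, q) := i in
  match p =P m with
  | ReflectT pm => if (p + q)%:Z == n - 1 then ecast i (A i q) (esym pm) (sval (cid (xb q))) else 0
  | ReflectF _ => 0 end.
have zm q : z (m, q) = if (m + q)%:Z == n - 1 then sval (cid (xb q)) else 0.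
  by rewrite /z; case: eqP => // mm; rewrite (eq_irrelevance mm erefl).
have z0 p q : p != m -> z (p, q) = 0 by rewrite /z => /eqP pm; case: eqP.
have zn : homog A (n - 1) z.
  move=> p q pq; have [pm|/z0 //] := eqVneq p m.
  by rewrite pm in pq *; rewrite zm (negPf pq).
have xzm p q : (m < p)%N -> (x - totd A z) (p, q) = 0.
  move=> mp; rewrite tot_subE totdE [tot_dv _ _ _]tot_dv0 => [|q' _]; last by apply: z0; lia.
  rewrite addr0; have [pm|pm] := eqVneq p m.+1; last first.
    rewrite xm; last by lia.
    by rewrite tot_dh0 ?subr0 // => p' pp; apply: z0; apply: contraNneq pm => <-; rewrite pp.
  have dE : tot_dh z m.+1 q = dh (z (m, q)) by [].
  rewrite pm dE zm; case: eqP => [_|ne].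
    by case: (cid (xb q)) => b /= ->; rewrite subrr.
  by rewrite linear0 subr0; apply: xn; apply/eqP; lia.
have [||p q|y [yn yP]] := IH (x - totd A z).
- by apply: in_subB => //; have := totd_homog zn; rewrite subrK.
- by move=> p q; rewrite linearB totdd subr0.
- exact: xzm.
exists (z + y); split; first exact: in_subD.
by move=> p q; rewrite [totd _ _]linearD opprD addrA.
Qed.

Variable W : augmentation A.

Definition aug_bound n : subspace (W n) :=
  match n return subspace (W n) with
  | 0 => zero_sub (W 0) | n'.+1 => im_sub (@aug_d _ _ W n') end.

Lemma column0E (n : nat) x : homog A n%:Z x -> (forall p q, x (p.+1, q) = 0) ->
  x = tot_inj (x (0, n)).
Proof.
move=> xn x0; apply: functional_extensionality_dep => -[i j].
have [[-> ->]|/eqP ne] := (i, j) =P (0, n)%N; first by rewrite tot_injE.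
rewrite [RHS]tot_inj0 //; case: i ne => [|i] ne; last exact: x0.
by apply: xn; apply: contraNneq ne => -[e]; rewrite -e.
Qed.

(** Once moved into column 0, a cycle is a single entry killed by dh, so it comes from W, and killed
    by dv, so it is a cycle there. *)
Lemma tot_cycle_aug (n : nat) x : homog A n%:Z x -> totd A x = 0 ->
  exists w : W n, aug_d W w = 0 /\
  exists y, homog A (n%:Z - 1) y /\ x - totd A y = tot_inj (aug_i W w).
Proof.
move=> xn dx; have [p q|y [yn yP]] := reduce_column0 xn; first by rewrite dx.
set x' := x - totd A y; have x'n : homog A n%:Z x'.
  by apply: in_subB => //; have := totd_homog yn; rewrite subrK.
have dx' : totd A x' = 0 by rewrite /x' linearB totdd dx subr0.
have x'E := column0E x'n yP.
have /aug_ker-/(_ W) [w wE] : dh (x' (0%N, n)) = 0.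
  have : totd A x' (1%N, n) = 0 by rewrite dx'.
  by rewrite totdE /= tot_dv0 ?addr0 // => q _; exact: yP.
exists w; split; last by exists y; split=> //; rewrite -wE.
apply: (@aug_inj _ _ W); rewrite -aug_comm -wE.
have : totd A x' (0%N, n.+1) = 0 by rewrite dx'.
by rewrite totdE /= add0r.
Qed.

(** The bounding element y can itself be moved into column 0, since its differential vanishes
    elsewhere; its entry then comes from W. In degree 0 nothing is left of it. *)
Lemma tot_bound_aug (n : nat) (w : W n) :
  (exists y, homog A (n%:Z - 1) y /\ tot_inj (aug_i W w) = totd A y) <-> aug_bound n w.
Proof.
split=> [[y [yn yE]]|]; last first.
  case: n w => [|n] w => [->|[w' ->]].
    by exists 0; split; [exact: in_sub0 | rewrite !linear0 tot_inj00].
  exists (tot_inj (aug_i W w')); split; first by apply: tot_inj_homog; lia.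
  by rewrite totd_inj ((aug_ker W _).2 _) ?tot_inj00 ?add0r -?aug_comm //; exists w'.
have [p q|z [zn zP]] := reduce_column0 yn.
  by rewrite -yE tot_inj0.
set y' := y - totd A z in zP.
have y'n : homog A (n%:Z - 1) y'.
  by apply: in_subB => //; have := totd_homog zn; rewrite subrK.
have {}yE : tot_inj (aug_i W w) = totd A y' by rewrite /y' linearB totdd subr0.
have wE : aug_i W w = tot_dv y' 0 n by rewrite -[LHS]tot_injE yE totdE /= add0r.
case: n w yn yE y'n wE {zn} => [|n] w yn yE y'n wE /=.
  exact: (@aug_inj _ _ W).
have : dh (y' (0%N, n)) = 0.
  have : totd A y' (1%N, n) = 0 by rewrite -yE tot_inj0.
  by rewrite totdE /= tot_dv0 ?addr0 // => q _; exact: zP.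
move=> /aug_ker-/(_ W) [w' w'E]; exists w'; apply/eqP; rewrite -subr_eq0; apply/eqP.
by apply: (@aug_inj _ _ W); rewrite linearB wE /= w'E aug_comm subrr.
Qed.

End Augmented.

(** * The spectral sequence of a double complex and its convergence *)

Definition dcomplex_ss (k : fieldType) (K : int -> dcomplex k) : spectral_seq k :=
  @SpectralSeq k (fun r p q s => Epage (K s) r p q)
    (fun r p q p' q' s ep eq => Ediff (K s) ep eq)
    (fun r p q p' q' p'' q'' s ep eq ep' eq' x _ => Ediff2 ep eq ep' eq' x)
    (fun r p0 q0 p q p1 q1 s ep eq ep' eq' _ => Eturn (K s) ep eq ep' eq').

Lemma dcomplex_ss_first_quadrant (k : fieldType) (K : int -> dcomplex k) :
  first_quadrant (dcomplex_ss K).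
Proof. by move=> r p q s _ pq x; exact: Epage_first_quadrant. Qed.

(* [c] induces an isomorphism from ker d / B onto H *)
Definition computes (k : fieldType) (V V' H : lmodType k) (d : V -> V') (B : subspace V)
    (c : V -> H) : Prop :=
  [/\ forall (a : k) v v', d v = 0 -> d v' = 0 -> c (a *: v + v') = a *: c v + c v',
      forall v, d v = 0 -> c v = 0 <-> B v
    & forall h, exists v, d v = 0 /\ c v = h].

Section Convergence.
Variables (k : fieldType) (K : int -> dcomplex k) (W : forall s, augmentation (K s)).
Hypothesis Kex : forall s, dh_exact (K s).
Variables (H : nat -> int -> lmodType k) (c : forall n s, W s n -> H n s).
Hypothesis cP : forall n s, computes (aug_d (W s)) (aug_bound (W s) n) (@c n s).

Definition tot_cycle s (n : int) : subspace (tot (K s)).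
Proof.
exists (fun x => homog (K s) n x /\ totd (K s) x = 0).
  by split; [exact: in_sub0 | exact: linear0].
move=> a x y [x1 x2] [y1 y2]; split; first exact: in_subZD.
by rewrite linearP x2 y2 scaler0 addr0.
Defined.

Lemma tot_computes n s : exists u : tot (K s) -> H n s,
  [/\ forall (a : k) x y, tot_cycle s n%:Z x -> tot_cycle s n%:Z y ->
        u (a *: x + y) = a *: u x + u y,
      forall x, tot_cycle s n%:Z x ->
        u x = 0 <-> exists y, homog (K s) (n%:Z - 1) y /\ x = totd (K s) y
    & forall h, exists x, tot_cycle s n%:Z x /\ u x = h].
Proof.
have [cl c0 cs] := cP n s.
pose R x h := exists (w : W s n) y, [/\ aug_d (W s) w = 0, homog (K s) (n%:Z - 1) y,
  x - totd (K s) y = tot_inj (aug_i (W s) w) & h = c w].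
have Rlin (a : k) z z' h h' : R z h -> R z' h' -> R (a *: z + z') (a *: h + h').
  move=> [w [y [w0 y0 e ->]]] [w' [y' [w0' y0' e' ->]]].
  exists (a *: w + w'), (a *: y + y'); split.
  - by rewrite linearP w0 w0' scaler0 addr0.
  - exact: in_subZD.
  - rewrite [aug_i _ _]linearP tot_inj_linear -e -e' [totd _ _]linearP scalerBr.
    by rewrite opprD addrACA.
  - by rewrite cl.
have Rtot x : tot_cycle s n%:Z x -> exists h, R x h.
  move=> [x1 x2]; have [w [w0 [y [y1 e]]]] := tot_cycle_aug (@Kex s) (W s) x1 x2.
  by exists (c w), w, y.
have Rker x h : R x h -> h = 0 <-> exists y, homog (K s) (n%:Z - 1) y /\ x = totd (K s) y.
  move=> [w [y [w0 y0 e ->]]]; rewrite c0 // -(tot_bound_aug (@Kex s)) -e.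
  split=> -[z [z1 z2]].
    exists (z + y); split; first exact: in_subD.
    by rewrite linearD -z2 subrK.
  exists (z - y); split; first exact: in_subB.
  by rewrite linearB -z2.
have [z h _ zh z0|u [uR ul]] := corr_fun Rlin Rtot.
  by apply/(Rker _ _ zh); exists 0; rewrite linear0; split=> //; exact: in_sub0.
exists u; split=> // [x Zx|h]; first exact/Rker/uR.
have [w [w0 wh]] := cs h; exists (tot_inj (aug_i (W s) w)).
have Z : tot_cycle s n (tot_inj (aug_i (W s) w)).
  split; first exact: tot_inj_homog.
  rewrite totd_inj aug_comm w0 linear0 tot_inj00 addr0.
  by rewrite ((aug_ker (W s) _).2 _) ?tot_inj00 //; exists w.
split=> //; apply/eqP; rewrite -subr_eq0; apply/eqP.
have R1 : R (tot_inj (aug_i (W s) w)) h.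
  by exists w, 0; rewrite linear0 subr0; split=> //; exact: in_sub0.
have := Rlin (-1) _ _ _ _ R1 (uR _ Z); rewrite !scaleN1r addNr addrC => R0.
apply/(Rker _ _ R0); exists 0; rewrite linear0; split=> //; exact: in_sub0.
Qed.

Lemma dcomplex_ss_converges : converges (dcomplex_ss K) H.
Proof.
pose u n s := sval (cid (tot_computes n s)).
have uP n s := svalP (cid (tot_computes n s)).
have {uP} [ul [u0 us]] : (forall n s (a : k) x y,
    tot_cycle s n%:Z x -> tot_cycle s n%:Z y -> u n s (a *: x + y) = a *: u n s x + u n s y) /\
  (forall n s x, tot_cycle s n%:Z x ->
      u n s x = 0 <-> exists y, homog (K s) (n%:Z - 1) y /\ x = totd (K s) y) /\
  (forall n s h, exists x, tot_cycle s n%:Z x /\ u n s x = h).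
  by split; [|split] => n s; have [] := uP n s.
have cyc0 n s : tot_cycle s n 0 by exact: in_sub0.
pose Fp p n s h := exists x, [/\ tot_cycle s n%:Z x, fil (K s) p%:Z x & h = u n s x].
have F0 p n s : Fp p n s 0.
  exists 0; split; try exact: in_sub0.
  by apply/esym/u0 => //; exists 0; rewrite linear0; split=> //; exact: in_sub0.
have FZD p n s (a : k) h h' : Fp p n s h -> Fp p n s h' -> Fp p n s (a *: h + h').
  move=> [x [x1 x2 ->]] [y [y1 y2 ->]]; exists (a *: x + y).
  by split; [exact: in_subZD | exact: in_subZD | rewrite ul].
pose F (p n : nat) (s : int) : subspace (H n s) := Subspace (F0 p n s) (FZD p n s).
exists F; split.
- move=> n s h; have [x [x1 xh]] := us n s h; exists x.
  by split; [exact: x1 | exact: fil_all | exact: esym].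
- move=> n s _ [x [x1 x2 ->]]; have -> : x = 0 by apply: (homog_fil0 x1.1 x2); lia.
  by apply/u0 => //; exists 0; rewrite linear0; split=> //; exact: in_sub0.
- move=> p n s _ [x [x1 x2 ->]]; exists x; split=> //; apply: fil_le x2; lia.
move=> p q s; rewrite /einfty /=; set r := maxn _ _.
(* The choice of r serves twice: p < r makes F^(p-r+1) everything, so that [Br] contains all
   boundaries of this degree, and q + 1 < r makes F^(p+r) zero in degree p + q + 1, so that elements
   of [Zr] are cycles. *)
have rp : (p < r)%N by rewrite leq_max ltnSn.
have rq : (q.+1 < r)%N by rewrite leq_max ltnSn orbT.
have ZC x : Zr (K s) r p%:Z q%:Z x -> tot_cycle s (p + q)%N%:Z x.
  move=> [x1 _ x3]; split=> //; apply: (homog_fil0 (totd_homog x1) x3); lia.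
have ZF x : Zr (K s) r p%:Z q%:Z x -> F p (p + q)%N s (u (p + q)%N s x).
  by move=> Zx; have [x1 x2 _] := Zx; exists x; split=> //; exact: ZC.
apply: (@subquot_iso _ _ _ _ _ (fun x w => Zr (K s) r p%:Z q%:Z x /\
   w = cls (F p (p + q)%N s) (F p.+1 (p + q)%N s) (u (p + q)%N s x))).
- move=> a z z' w w' [Zz ->] [Zz' ->]; split; first exact: in_subZD.
  by rewrite ul ?clsZD //; exact: ZF || exact: ZC.
- by move=> z Zz; eexists; split; first exact: Zz.
- move=> x w _ [Zx ->]; rewrite cls0P; last exact: ZF.
  have [x1 x2 _] := Zx; split=> [[y [y1 y2 yE]]|[a [v [xE a1 v1 v2]]]].
    have uB : u (p + q)%N s (x - y) = 0.
      rewrite addrC -scaleN1r ul // ?yE; last exact: ZC.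
      by rewrite scaleN1r addNr.
    have /(u0 _ _ _ (in_subB (ZC _ Zx) y1)) [z [z1 zE]] := uB.
    exists y, z; split=> //; first by rewrite -zE addrC subrK.
      by apply: fil_le y2; lia.
    by apply: fil_all; lia.
  have aE : a = x - totd (K s) v by rewrite xE addrK.
  have ac : tot_cycle s (p + q)%N%:Z a.
    rewrite aE; apply: in_subB; first exact: ZC.
    by split; [have := totd_homog v1; rewrite subrK | exact: totdd].
  exists a; split=> //; first by apply: fil_le a1; lia.
  apply/eqP; rewrite -subr_eq0 -scaleN1r addrC -ul // ?scaleN1r; last exact: ZC.
  apply/eqP/u0; first by rewrite addrC; apply: in_subB => //; exact: ZC.
  by exists v; split=> //; rewrite xE addrA addNr add0r.
- move=> w; have [h [[x [x1 x2 ->]] ->]] := cls_surj w; exists x.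
  by split; [|split=> //]; split; rewrite ?x1.2; exact: x1.1 || exact: in_sub0 || by [].
Qed.

End Convergence.

(** * Cofree modules *)

Section GHomTools.
Variables (k : fieldType) (C : gcat k).
Implicit Types M N : rmod C.

Definition mkhom M N d (f : forall X n m, n + d = m -> rm M X n -> rm N X m)
    (f1 : forall X n m (e : n + d = m), linear (f X n m e))
    (f2 : forall X Y (n m i n' m' : int) (e : n + d = m) (e' : n' + d = m')
      (h : n + i = n') (h' : m + i = m') (x : rm M X n) (g : hom C Y X i),
      f Y n' m' e' (ract M h x g) = ract N h' (f X n m e x) g) : ghom M N d :=
  @mk_ghom k C M N d (fun c => f (gX c) (gn c) (gm c) (ge c) (gx c)) (conj f1 f2).

Lemma gapp_linear M N d (f : ghom M N d) X n m (e : n + d = m) : linear (@gapp k C M N d f X n m e).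
Proof. exact: (gappP f).1. Qed.

Lemma gapp_zero M N d (f : ghom M N d) X n m (e : n + d = m) : gapp f e (0 : rm M X n) = 0.
Proof. exact: (linear0 (lin_fun (gapp_linear f e))). Qed.

Lemma gapp_sub M N d (f : ghom M N d) X n m (e : n + d = m) (x y : rm M X n) :
  gapp f e (x - y) = gapp f e x - gapp f e y.
Proof. exact: (linearB (lin_fun (gapp_linear f e))). Qed.

Lemma gapp_scale M N d (f : ghom M N d) X n m (e : n + d = m) a (x : rm M X n) :
  gapp f e (a *: x) = a *: gapp f e x.
Proof. exact: (linearZZ (lin_fun (gapp_linear f e))). Qed.

Lemma gapp_ract M N d (f : ghom M N d) X Y (n m i n' m' : int) (e : n + d = m)
    (e' : n' + d = m') (h : n + i = n') (h' : m + i = m') (x : rm M X n) (g : hom C Y X i) :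
  gapp f e' (ract M h x g) = ract N h' (gapp f e x) g.
Proof. exact: (gappP f).2. Qed.

Lemma gapp_scalel M N d a (f : ghom M N d) X n m (e : n + d = m) (x : rm M X n) :
  gapp (a *: f) e x = a *: gapp f e x.
Proof. by []. Qed.

Definition ap M N (f : ghom M N 0) X n (x : rm M X n) : rm N X n := gapp f (addr0 n) x.

Lemma gapp_ap M N (f : ghom M N 0) X n (e : n + 0 = n) (x : rm M X n) : gapp f e x = ap f x.
Proof. by congr gapp; exact: eq_irrelevance. Qed.

Lemma ap_comp L M N e (g : ghom M N 0) (f : ghom L M 0) X n (x : rm L X n) :
  ap (gcomp e g f) x = ap g (ap f x).
Proof. exact: gapp_comp. Qed.

Lemma gapp_compl L M N d (e : 0 + d = d) (g : ghom M N 0) (f : ghom L M d) X n m (em : n + d = m)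
  (x : rm L X n) : gapp (gcomp e g f) em x = ap g (gapp f em x).
Proof. exact: gapp_comp. Qed.

Lemma gapp_compr L M N d (e : d + 0 = d) (g : ghom M N d) (f : ghom L M 0) X n m (em : n + d = m)
  (x : rm L X n) : gapp (gcomp e g f) em x = gapp g em (ap f x).
Proof. exact: gapp_comp. Qed.

Lemma ghom0_eq M N (f g : ghom M N 0) :
  (forall X n (x : rm M X n), ap f x = ap g x) -> f = g.
Proof.
move=> fg; apply: ghom_eq => X n m e x; have e' : n = m by rewrite -e addr0.
by case: m / e' e => e; rewrite !gapp_ap.
Qed.

Lemma gexact_ap L M N (f : ghom L M 0) (g : ghom M N 0) :
  gexact f g <-> forall X n (y : rm M X n), ap g y = 0 <-> exists x, y = ap f x.
Proof.
split=> fg X n y.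
  rewrite -[X in X <-> _]/(ap g y = 0); split=> [gy|[x ->]].
    have /fg[m [e [x <-]]] : forall m (e : n + 0 = m), gapp g e y = 0.
      by move=> m e; have e' : n = m by [rewrite -e addr0]; case: m / e' e => e; rewrite gapp_ap.
    have e' : m = n by rewrite -e addr0.
    by case: n / e' {y gy} e => e; exists x; rewrite gapp_ap.
  by apply: (fg _ _ _).2; exists n, (addr0 n), x.
split=> [gy|[m [e [x <-]]]].
  have /fg[x ->] : ap g y = 0 by exact: gy.
  by exists n, (addr0 n), x.
move=> p ep; have e' : m = n by rewrite -e addr0.
have ep' : n = p by rewrite -ep addr0.
case: p / ep' ep => ep; case: n / e' {y} e ep => e ep.
rewrite !gapp_ap; apply/fg; by exists x.
Qed.

Lemma gsurj_ap M N (f : ghom M N 0) :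
  gsurj f <-> forall X n (y : rm N X n), exists x, y = ap f x.
Proof.
split=> fs X n y.
  have [m [e [x <-]]] := fs X n y.
  have e' : m = n by rewrite -e addr0.
  by case: n / e' {y} e => e; exists x; rewrite gapp_ap.
by have [x ->] := fs X n y; exists n, (addr0 n), x.
Qed.

Lemma ap_pseudo_inverse M N (f : ghom M N 0) X n :
  exists s : rm N X n -> rm M X n, linear s /\ forall x, ap f (s (ap f x)) = ap f x.
Proof.
have [s sP] := linear_pseudo_inverse (lin_fun (gapp_linear f (addr0 n) (X := X))).
by exists s; split=> //; exact: linearP.
Qed.

End GHomTools.

Section Cofree.
Variables (k : fieldType) (C : gcat k).

Section Carrier.
Variable M : rmod C.

(** As with [gidx], a family of maps is stored as one function of a record. An element of degree m
    sends C(Y, X)_j to M(Y)_l with m + j = l. *)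
Record cidx (X : C) (m : int) := CIdx {
  cY : C; cj : int; cl : int; ce : m + cj = cl; cg : hom C cY X cj
}.

Definition cofree_fam X m := dprod (fun c : cidx X m => rm M (cY c) (cl c)).

Definition is_cofree_fam X m (phi : cofree_fam X m) : Prop :=
  forall Y j l (e : m + j = l) (a : k) (g g' : hom C Y X j),
   phi (CIdx e (a *: g + g')) = a *: phi (CIdx e g) + phi (CIdx e g').

Definition cofree_sub X m : subspace (cofree_fam X m).
Proof.
exists (@is_cofree_fam X m).
  by move=> *; rewrite !dprod0E scaler0 addr0.
move=> b u v up vp Y j l e a g g'; rewrite !dprodZDE up vp !scalerDr !scalerA mulrC.
by rewrite addrACA.
Defined.

Definition cofree_at X m : lmodType k := sub_of (cofree_sub X m).

Definition cev_at X m (gam : cofree_at X m) Y j l (e : m + j = l) (g : hom C Y X j) : rm M Y l :=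
  sub_val gam (CIdx e g).

Lemma cev_at_linear X m (gam : cofree_at X m) Y j l (e : m + j = l) :
  linear (@cev_at X m gam Y j l e).
Proof. by move=> a g g'; exact: (elimT (sub_predP (cofree_sub X m) _) (sub_valP gam)). Qed.

Lemma cev_at_eq X m (gam gam' : cofree_at X m) :
  (forall Y j l (e : m + j = l) (g : hom C Y X j), cev_at gam e g = cev_at gam' e g) ->
  gam = gam'.
Proof.
move=> eq; apply: val_inj; apply: functional_extensionality_dep.
by case=> Y j l e g; exact: eq.
Qed.

Definition mkcof_at X m (f : forall Y j l, m + j = l -> hom C Y X j -> rm M Y l)
  (fl : forall Y j l (e : m + j = l), linear (f Y j l e)) : cofree_at X m :=
  SubOf (introT (sub_predP (cofree_sub X m)
    (fun c => f (cY c) (cj c) (cl c) (ce c) (cg c))) (fun Y j l e => fl Y j l e)).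

Lemma cact_eq (m i m' j l : int) : m + i = m' -> m' + j = l -> m + (i + j) = l.
Proof. by move=> <- <-; rewrite addrA. Qed.

Lemma cact_linear X Y m i m' (e0 : m + i = m') (gam : cofree_at X m) (h : hom C Y X i)
    Z j l (e : m' + j = l) :
  linear (fun g : hom C Z Y j => cev_at gam (cact_eq e0 e) (comp erefl h g)).
Proof. by move=> a g g'; rewrite compDr cev_at_linear. Qed.

Definition cact X Y m i m' (e0 : m + i = m') (gam : cofree_at X m) (h : hom C Y X i) :
  cofree_at Y m' := mkcof_at (@cact_linear X Y m i m' e0 gam h).

Lemma cact_ev X Y m i m' (e0 : m + i = m') (gam : cofree_at X m) (h : hom C Y X i)
    Z j l (e : m' + j = l) (g : hom C Z Y j) ij (eij : i + j = ij) (e' : m + ij = l) :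
  cev_at (cact e0 gam h) e g = cev_at gam e' (comp eij h g).
Proof. by case: ij / eij e' => e'; rewrite [LHS]/cev_at /=; congr cev_at; exact: eq_irrelevance. Qed.

Definition cofree : rmod C.
Proof.
apply: (@RMod k C cofree_at cact).
- by move=> X Y i j l e a x x' f; exact: cev_at_eq.
- move=> X Y i j l e a x f f'; apply: cev_at_eq => Z p q e' g.
  transitivity (cev_at x (cact_eq e e') (comp erefl (a *: f + f') g)); first by [].
  by rewrite compDl cev_at_linear.
- move=> X i e x; apply: cev_at_eq => Z p q e' g.
  by rewrite (cact_ev e x (idm X) e' g (add0r p) e') comp1m.
- move=> X Y Z i j l ij jl n e1 e2 e3 e4 x f g; apply: cev_at_eq => T p q e h.
  have e5 : ij + (l + p) = q by rewrite addrA e3.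
  have e6 : i + (j + (l + p)) = q by rewrite addrA e1.
  have e7 : jl + p = j + (l + p) by rewrite -e2 addrA.
  rewrite (cact_ev e3 _ g e h erefl e5) (cact_ev e1 _ f e5 _ erefl e6).
  by rewrite (cact_ev e4 x _ e h e7 e6) (compA _ erefl _ erefl).
Defined.

End Carrier.

Section Elements.
Variable M : rmod C.

Definition cev X m (gam : rm (cofree M) X m) Y j l (e : m + j = l) (g : hom C Y X j) : rm M Y l :=
  @cev_at M X m gam Y j l e g.

Lemma cev_linear X m (gam : rm (cofree M) X m) Y j l (e : m + j = l) :
  linear (@cev X m gam Y j l e).
Proof. exact: cev_at_linear. Qed.

Lemma cev_eq X m (gam gam' : rm (cofree M) X m) :
  (forall Y j l (e : m + j = l) (g : hom C Y X j), cev gam e g = cev gam' e g) -> gam = gam'.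
Proof. exact: cev_at_eq. Qed.

Definition mkcof X m (f : forall Y j l, m + j = l -> hom C Y X j -> rm M Y l)
  (fl : forall Y j l (e : m + j = l), linear (f Y j l e)) : rm (cofree M) X m :=
  mkcof_at fl.

Lemma cevZD X m a (gam gam' : rm (cofree M) X m) Y j l (e : m + j = l) (g : hom C Y X j) :
  cev (a *: gam + gam') e g = a *: cev gam e g + cev gam' e g.
Proof. by []. Qed.
Lemma cevB X m (gam gam' : rm (cofree M) X m) Y j l (e : m + j = l) (g : hom C Y X j) :
  cev (gam - gam') e g = cev gam e g - cev gam' e g.
Proof. by []. Qed.
Lemma cevD X m (gam gam' : rm (cofree M) X m) Y j l (e : m + j = l) (g : hom C Y X j) :
  cev (gam + gam') e g = cev gam e g + cev gam' e g.
Proof. by []. Qed.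
Lemma cevZ X m a (gam : rm (cofree M) X m) Y j l (e : m + j = l) (g : hom C Y X j) :
  cev (a *: gam) e g = a *: cev gam e g.
Proof. by []. Qed.
Lemma cev0 X m Y j l (e : m + j = l) (g : hom C Y X j) : cev 0 e g = 0.
Proof. by []. Qed.

Lemma ract_ev X Y m i m' (e0 : m + i = m') (gam : rm (cofree M) X m) (h : hom C Y X i)
    Z j l (e : m' + j = l) (g : hom C Z Y j) ij (eij : i + j = ij) (e' : m + ij = l) :
  cev (ract (cofree M) e0 gam h) e g = cev gam e' (comp eij h g).
Proof. exact: cact_ev. Qed.

(* A retraction of the unit, k-linear but not C-linear *)
Definition rho X m (gam : rm (cofree M) X m) : rm M X m := cev gam (addr0 m) (idm X).

(** All values of a cofree element are read off by [rho] after acting. Hence morphisms into a cofree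
    module are determined by their composite with [rho], as used in [cofr_eq]. *)
Lemma rho_ract X Y m i l (e : m + i = l) (gam : rm (cofree M) X m) (h : hom C Y X i) :
  rho (ract (cofree M) e gam h) = cev gam e h.
Proof. by rewrite /rho (ract_ev e gam h _ _ (addr0 i) e) compm1. Qed.

Lemma rho_linear X m : linear (@rho X m).
Proof. by []. Qed.

End Elements.

Lemma eta_eq (n m j l : int) : n + 0 = m -> m + j = l -> n + j = l.
Proof. by move=> <- <-; rewrite addr0. Qed.

Lemma eta_at_linear (M : rmod C) X n m (en : n + 0 = m) (x : rm M X n) Y j l (e : m + j = l) :
  linear (fun g : hom C Y X j => ract M (eta_eq en e) x g).
Proof. by move=> a g g'; exact: ractDr. Qed.

Definition eta_at (M : rmod C) X n m (en : n + 0 = m) (x : rm M X n) : rm (cofree M) X m :=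
  mkcof (@eta_at_linear M X n m en x).

Lemma eta_at_ev (M : rmod C) X n m (en : n + 0 = m) (x : rm M X n) Y j l
    (e : m + j = l) (e' : n + j = l) (g : hom C Y X j) :
  cev (eta_at en x) e g = ract M e' x g.
Proof. by rewrite /eta_at /cev /cev_at /=; congr ract; exact: eq_irrelevance. Qed.

Definition eta (M : rmod C) : ghom M (cofree M) 0.
Proof.
apply: (@mkhom k C M (cofree M) 0 (@eta_at M)).
  move=> X n m e a x y; apply: cev_eq => Y j l e' g.
  have e1 : n + j = l by rewrite -e' -e addr0.
  by rewrite cevZD !(eta_at_ev _ _ _ e1) ractDl.
move=> X Y n m i n' m' e e' h h' x f; apply: cev_eq => Z j l el g.
have e1 : n' + j = l by rewrite -el -e' addr0.
have e2 : n + (i + j) = l by rewrite addrA h.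
have e3 : m + (i + j) = l by rewrite addrA h'.
by rewrite (eta_at_ev _ _ _ e1) (ract_ev h' _ _ _ _ erefl e3) (eta_at_ev _ _ _ e2) (ractA h erefl e1 e2).
Defined.

Lemma eta_ev (M : rmod C) X n (x : rm M X n) Y j l (e : n + j = l) (g : hom C Y X j) :
  cev (ap (eta M) x) e g = ract M e x g.
Proof. exact: eta_at_ev. Qed.

Lemma rho_eta (M : rmod C) X n (x : rm M X n) : rho (ap (eta M) x) = x.
Proof. by rewrite /rho eta_ev ract1. Qed.

Lemma cmap_eq1 (n d m j l : int) : n + d = m -> m + j = l -> n + j + d = l.
Proof. by move=> <- <-; rewrite addrAC. Qed.

Lemma cmap_at_linear (M N : rmod C) d (f : ghom M N d) X n m (e : n + d = m)
    (gam : rm (cofree M) X n) Y j l (e' : m + j = l) :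
  linear (fun g : hom C Y X j => gapp f (cmap_eq1 e e') (cev gam erefl g)).
Proof. by move=> a g g'; rewrite cev_linear gapp_linear. Qed.

Definition cmap_at (M N : rmod C) d (f : ghom M N d) X n m (e : n + d = m)
    (gam : rm (cofree M) X n) : rm (cofree N) X m :=
  mkcof (@cmap_at_linear M N d f X n m e gam).

Lemma cmap_at_ev (M N : rmod C) d (f : ghom M N d) X n m (e : n + d = m)
    (gam : rm (cofree M) X n) Y j l p (e' : m + j = l) (e1 : n + j = p) (e2 : p + d = l)
    (g : hom C Y X j) :
  cev (cmap_at f e gam) e' g = gapp f e2 (cev gam e1 g).
Proof.
case: p / e1 e2 => e2; rewrite /cmap_at [LHS]/cev /cev_at /=.
by congr gapp; exact: eq_irrelevance.
Qed.

Definition cmap (M N : rmod C) d (f : ghom M N d) : ghom (cofree M) (cofree N) d.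
Proof.
apply: (@mkhom k C (cofree M) (cofree N) d (@cmap_at M N d f)).
  move=> X n m e a x y; apply: cev_eq => Y j l e' g.
  by rewrite cevZD !(cmap_at_ev _ _ _ _ erefl (cmap_eq1 e e')) cevZD gapp_linear.
move=> X Y n m i n' m' e e' h h' x g; apply: cev_eq => Z j l el u.
have e1 : n + (i + j) = n' + j by rewrite addrA h.
have e2 : m + (i + j) = l by rewrite addrA h'.
have e3 : n' + j + d = l by rewrite addrAC e'.
rewrite (cmap_at_ev _ _ _ _ erefl e3) (ract_ev h x _ _ _ erefl e1).
by rewrite (ract_ev h' _ _ _ _ erefl e2) (cmap_at_ev _ _ _ _ e1 e3).
Defined.

Lemma cmap_ev (M N : rmod C) d (f : ghom M N d) X n m (e : n + d = m)
    (gam : rm (cofree M) X n) Y j l p (e' : m + j = l) (e1 : n + j = p) (e2 : p + d = l)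
    (g : hom C Y X j) :
  cev (gapp (cmap f) e gam) e' g = gapp f e2 (cev gam e1 g).
Proof. exact: cmap_at_ev. Qed.

Lemma ap_cmap_ev (M N : rmod C) (f : ghom M N 0) X n (gam : rm (cofree M) X n) Y j l
    (e : n + j = l) (g : hom C Y X j) :
  cev (ap (cmap f) gam) e g = ap f (cev gam e g).
Proof. exact: cmap_ev. Qed.

Lemma rho_cmap (M N : rmod C) d (f : ghom M N d) X n m (e : n + d = m) (gam : rm (cofree M) X n) :
  rho (gapp (cmap f) e gam) = gapp f e (rho gam).
Proof. exact: cmap_ev. Qed.

Lemma cmap_comp (L M N : rmod C) i j l (e : i + j = l) (g : ghom M N i) (f : ghom L M j) :
  cmap (gcomp e g f) = gcomp e (cmap g) (cmap f).
Proof.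
apply: ghom_eq => X n m em x; apply: cev_eq => Y p q e' u.
have e1 : n + p + l = q by rewrite addrAC em.
have e2 : n + j + i = m by rewrite -addrA [j + i]addrC e.
have e3 : n + j + p = n + p + j by rewrite addrAC.
have e4 : n + p + j + i = q by rewrite -addrA [j + i]addrC e.
rewrite (cmap_ev _ _ _ _ erefl e1) (gapp_comp _ _ _ _ erefl e2) (gapp_comp _ _ _ _ erefl e4).
by rewrite (cmap_ev _ _ _ _ e3 e4) (cmap_ev _ _ _ _ erefl erefl).
Qed.

Lemma cmap_id (M : rmod C) : cmap (gidm M) = gidm (cofree M).
Proof.
apply: ghom0_eq => X n x; apply: cev_eq => Y p q e' u.
by rewrite ap_cmap_ev /ap !gapp_id.
Qed.

Lemma cmapZD (M N : rmod C) d a (f g : ghom M N d) : cmap (a *: f + g) = a *: cmap f + cmap g.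
Proof.
apply: ghom_eq => X n m em x; apply: cev_eq => Y p q e' u.
have e1 : n + p + d = q by rewrite addrAC em.
by rewrite gappZD cevZD !(cmap_ev _ _ _ _ erefl e1).
Qed.

Lemma cmap0 (M N : rmod C) d : cmap (0 : ghom M N d) = 0.
Proof. by apply: ghom_eq => X n m em x; apply: cev_eq. Qed.

Lemma eta_nat (M N : rmod C) d (f : ghom M N d) X n m (e : n + d = m) (x : rm M X n) :
  gapp (cmap f) e (ap (eta M) x) = ap (eta N) (gapp f e x).
Proof.
apply: cev_eq => Y j l e' g.
have e1 : n + j + d = l by rewrite addrAC e.
by rewrite (cmap_ev _ _ _ _ erefl e1) !eta_ev (gapp_ract _ e e1 _ e').
Qed.

(** Preimages of the values of y have to depend linearly on u, so they are taken by a k-linear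
    pseudo-inverse of f in each degree. *)
Lemma cmap_exact (L M N : rmod C) (f : ghom L M 0) (g : ghom M N 0) :
  gexact f g -> gexact (cmap f) (cmap g).
Proof.
move=> fg; have gf := gexact_comp0 (addr0 0) fg; move/gexact_ap: fg => fg.
apply/gexact_ap => X n y; split=> [gy|[x ->]]; last first.
  by rewrite -(ap_comp (addr0 0)) -cmap_comp gf cmap0.
pose s Y l := sval (cid (ap_pseudo_inverse f Y l)).
have sl Y l : linear (@s Y l) := (svalP (cid (ap_pseudo_inverse f Y l))).1.
have sP Y l := (svalP (cid (ap_pseudo_inverse f Y l))).2.
pose z Y j l (e : n + j = l) (u : hom C Y X j) := s Y l (cev y e u).
have zl Y j l (e : n + j = l) : linear (z Y j l e).
  by move=> a u v; rewrite /z cev_linear sl.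
exists (mkcof zl); apply: cev_eq => Y j l e u.
have /fg[x xE] : ap g (cev y e u) = 0 by rewrite -ap_cmap_ev gy.
by rewrite ap_cmap_ev {2}/cev /cev_at /= /z -/(cev _ _ _) xE sP.
Qed.

Lemma cmap_surj (M N : rmod C) (f : ghom M N 0) : gsurj f -> gsurj (cmap f).
Proof.
move=> /gsurj_ap fs; apply/gsurj_ap => X n y.
pose s Y l := sval (cid (ap_pseudo_inverse f Y l)).
have sl Y l : linear (@s Y l) := (svalP (cid (ap_pseudo_inverse f Y l))).1.
have sP Y l := (svalP (cid (ap_pseudo_inverse f Y l))).2.
pose z Y j l (e : n + j = l) (u : hom C Y X j) := s Y l (cev y e u).
have zl Y j l (e : n + j = l) : linear (z Y j l e).
  by move=> a u v; rewrite /z cev_linear sl.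
exists (mkcof zl); apply: cev_eq => Y j l e u.
have [x xE] := fs _ _ (cev y e u).
by rewrite ap_cmap_ev {2}/cev /cev_at /= /z -/(cev _ _ _) xE sP.
Qed.

Section Adjunction.
Variables (X M : rmod C) (d : int).

Variable w : forall Y (n m : int), n + d = m -> rm X Y n -> rm M Y m.
Hypothesis wl : forall Y (n m : int) (e : n + d = m), linear (@w Y n m e).

Lemma cofr_at_linear Y n m (e : n + d = m) (x : rm X Y n) Z j l (e' : m + j = l) :
  linear (fun g : hom C Z Y j => w (cmap_eq1 e e') (ract X erefl x g)).
Proof. by move=> a g g'; rewrite ractDr wl. Qed.

Definition cofr_at Y n m (e : n + d = m) (x : rm X Y n) : rm (cofree M) Y m :=
  mkcof (@cofr_at_linear Y n m e x).

Lemma cofr_at_ev Y n m (e : n + d = m) (x : rm X Y n) Z j l p (e' : m + j = l)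
    (e1 : n + j = p) (e2 : p + d = l) (g : hom C Z Y j) :
  cev (cofr_at e x) e' g = w e2 (ract X e1 x g).
Proof.
case: p / e1 e2 => e2; rewrite /cofr_at {1}/cev /cev_at /=.
by congr w; exact: eq_irrelevance.
Qed.

(** The adjunction Hom_k(X, M) = Hom_C(X, G M), with [rho] as counit: w has to be k-linear but not
    compatible with the action of C. *)
Definition cofr : ghom X (cofree M) d.
Proof.
apply: (@mkhom k C X (cofree M) d cofr_at).
  move=> Y n m e a x y; apply: cev_eq => Z j l e' g.
  by rewrite cevZD !(cofr_at_ev _ _ _ erefl (cmap_eq1 e e')) ractDl wl.
move=> Y Z n m i n' m' e e' h h' x g; apply: cev_eq => T j l el u.
have e1 : n + (i + j) = n' + j by rewrite addrA h.
have e2 : m + (i + j) = l by rewrite addrA h'.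
have e3 : n' + j + d = l by rewrite addrAC e'.
rewrite (cofr_at_ev _ _ _ erefl e3) (ract_ev h' _ _ _ _ erefl e2).
by rewrite (cofr_at_ev _ _ _ e1 e3) (ractA h erefl erefl e1).
Defined.

Lemma rho_cofr Y n m (e : n + d = m) (x : rm X Y n) :
  rho (gapp cofr e x) = w e x.
Proof. by rewrite /rho [LHS](cofr_at_ev e x (addr0 m) (addr0 n) e) ract1. Qed.

Lemma cofr_eq (f g : ghom X (cofree M) d) :
  (forall Y n m (e : n + d = m) (x : rm X Y n), rho (gapp f e x) = rho (gapp g e x)) -> f = g.
Proof.
move=> fg; apply: ghom_eq => Y n m e x; apply: cev_eq => Z j l e' u.
have e1 : n + j + d = l by rewrite addrAC e.
by rewrite -!rho_ract -!(gapp_ract _ e e1 erefl) fg.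
Qed.

End Adjunction.

Fixpoint Gn n (M : rmod C) : rmod C := if n is n'.+1 then cofree (Gn n' M) else M.

Fixpoint Gmap n (M N : rmod C) d (f : ghom M N d) : ghom (Gn n M) (Gn n N) d :=
  match n with 0 => f | n'.+1 => cmap (Gmap n' f) end.

(** Unfolded, this is the alternating sum of the maps G^i(eta) for i = 0, ..., n, the differential
    of the cobar resolution of M. *)
Fixpoint Gd n (M : rmod C) : ghom (Gn n M) (Gn n.+1 M) 0 :=
  match n return ghom (Gn n M) (Gn n.+1 M) 0 with
  | 0 => eta M | n'.+1 => eta (cofree (Gn n' M)) - cmap (Gd n' M) end.

Lemma Gmap_comp n (L M N : rmod C) i j l (e : i + j = l) (g : ghom M N i) (f : ghom L M j) :
  Gmap n (gcomp e g f) = gcomp e (Gmap n g) (Gmap n f).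
Proof. by elim: n => //= n ->; exact: cmap_comp. Qed.

Lemma Gmap_id n (M : rmod C) : Gmap n (gidm M) = gidm (Gn n M).
Proof. by elim: n => //= n ->; exact: cmap_id. Qed.

Lemma GmapZD n (M N : rmod C) d a (f g : ghom M N d) : Gmap n (a *: f + g) = a *: Gmap n f + Gmap n g.
Proof. by elim: n => //= n ->; exact: cmapZD. Qed.

Lemma Gmap0 n (M N : rmod C) d : Gmap n (0 : ghom M N d) = 0.
Proof. by elim: n => //= n ->; exact: cmap0. Qed.

Lemma Gmap_exact n (L M N : rmod C) (f : ghom L M 0) (g : ghom M N 0) :
  gexact f g -> gexact (Gmap n f) (Gmap n g).
Proof. by elim: n => //= n IH fg; exact/cmap_exact/IH. Qed.

Lemma Gmap_surj n (M N : rmod C) (f : ghom M N 0) : gsurj f -> gsurj (Gmap n f).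
Proof. by elim: n => //= n IH fg; exact/cmap_surj/IH. Qed.

Lemma ap_GdS n (M : rmod C) X m (x : rm (Gn n.+1 M) X m) :
  ap (Gd n.+1 M) x = ap (eta (Gn n.+1 M)) x - ap (cmap (Gd n M)) x.
Proof. by []. Qed.

Lemma Gd_ev n (M : rmod C) X m (x : rm (Gn n.+1 M) X m) Y j l (e : m + j = l) (g : hom C Y X j) :
  cev (M := Gn n.+1 M) (ap (Gd n.+1 M) x) e g =
  ract (Gn n.+1 M) e x g - ap (Gd n M) (cev (M := Gn n M) x e g).
Proof. by rewrite ap_GdS cevB eta_ev ap_cmap_ev. Qed.

Lemma Gd_nat n (M N : rmod C) d (f : ghom M N d) X p m (e : p + d = m) (x : rm (Gn n M) X p) :
  gapp (Gmap n.+1 f) e (ap (Gd n M) x) = ap (Gd n N) (gapp (Gmap n f) e x).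
Proof.
elim: n X p m e x => [|n IH] X p m e x; first exact: eta_nat.
rewrite !ap_GdS gapp_sub; congr (_ - _); first exact: (eta_nat (cmap (Gmap n f))).
apply: cev_eq => Y j l e' g; have e1 : p + j + d = l by rewrite addrAC e.
rewrite (cmap_ev _ _ _ _ erefl e1) !ap_cmap_ev [LHS]IH.
by rewrite (cmap_ev _ _ _ _ erefl e1).
Qed.

Lemma GdGd n (M : rmod C) X m (x : rm (Gn n M) X m) : ap (Gd n.+1 M) (ap (Gd n M) x) = 0.
Proof.
elim: n X m x => [|n IH] X m x; apply: cev_eq => Y j l e g; rewrite cev0.
  rewrite [LHS](Gd_ev (n := 0)) eta_ev -(gapp_ract _ _ (addr0 l) e) -/(ap _ _).
  exact: subrr.
rewrite [LHS](Gd_ev (n := n.+1)).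
rewrite -(gapp_ract (Gd n.+1 M) (addr0 m) (addr0 l) e e) -/(ap _ _).
rewrite -gapp_sub -/(ap _ _).
(* After the two outer terms are gathered under one differential, its argument is again a
   differential, of the value of x at g, and the induction hypothesis applies. *)
have -> : ract (Gn n.+1 M) e x g - cev (M := Gn n.+1 M) (ap (Gd n.+1 M) x) e g =
    ap (Gd n M) (cev (M := Gn n M) x e g).
  by rewrite Gd_ev opprB addrC subrK.
exact: IH.
Qed.

(** The identity rho d + d rho = 1 of a contracting homotopy, valid over k. *)
Lemma rho_Gd n (M : rmod C) X m (x : rm (Gn n.+1 M) X m) :
  rho (M := Gn n.+1 M) (ap (Gd n.+1 M) x) = x - ap (Gd n M) (rho (M := Gn n M) x).
Proof. by rewrite /rho Gd_ev ract1. Qed.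

Lemma Gd_exact n (M : rmod C) : gexact (Gd n M) (Gd n.+1 M).
Proof.
apply/gexact_ap => X m y; split=> [y0|[x ->]]; last exact: GdGd.
exists (rho y); apply/eqP; rewrite -subr_eq0 -rho_Gd y0; exact/eqP.
Qed.

End Cofree.

Arguments cofr {k C X M d} w wl.
Arguments mkcof {k C M X m} f fl.

(** * The Hochschild complex in curried form *)

Section AlternatingSum.
Variables (k : fieldType) (V : lmodType k).

(** The signed sum of [hd_cons] in recursive form, for inductions along [merges]. *)
Fixpoint altsum T (F : T -> V) (s : seq T) : V :=
  if s is x :: s' then - F x - altsum F s' else 0.

Lemma altsumE T (F : T -> V) (s : seq T) :
  \sum_(t < size s) (-1 : k) ^+ t.+1 *: F (tnth (in_tuple s) t) = altsum F s.
Proof.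
elim: s => [|x s IH] /=; first by rewrite big_ord0.
rewrite big_ord_recl /= expr1 scaleN1r [tnth _ _]/=; congr (_ + _).
rewrite -IH -sumrN; apply: eq_bigr => t _.
rewrite exprS mulN1r scaleNr; congr (- (_ *: F _)).
by rewrite !(tnth_nth x).
Qed.

Lemma altsum_cons T (F : T -> V) x (s : seq T) : altsum F (x :: s) = - F x - altsum F s.
Proof. by []. Qed.

Lemma altsum_map T U (F : U -> V) (h : T -> U) (s : seq T) :
  altsum F [seq h x | x <- s] = altsum (fun x => F (h x)) s.
Proof. by elim: s => //= x s ->. Qed.

Lemma eq_altsum T (F F' : T -> V) (s : seq T) : (forall x, F x = F' x) -> altsum F s = altsum F' s.
Proof. by move=> FF; elim: s => //= x s ->; rewrite FF. Qed.

End AlternatingSum.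

Section Currying.
Variables (k : fieldType) (D : gcat k).

Lemma path0P (P : forall (X Z : D) l, path 0 X Z l -> Prop) :
  (forall X, P X X 0 (pnil X)) -> forall X Z l p, P X Z l p.
Proof.
move=> P0 X Z l p.
refine (match p as p0 in path m X0 Z0 l0
  return (match m return path m X0 Z0 l0 -> Prop with 0 => P X0 Z0 l0 | _ => fun _ => True end p0)
  with pnil X => P0 X | pcons _ _ _ _ _ _ _ _ _ _ => I end).
Qed.

Lemma pathSP n (P : forall (X Z : D) l, path n.+1 X Z l -> Prop) :
  (forall X Y Z i j l (e : i + j = l) (f : hom D Y X i) (q : path n Y Z j), P X Z l (pcons e f q)) ->
  forall X Z l p, P X Z l p.
Proof.
move=> PS X Z l p; move: P PS.
refine (match p as p0 in path m X0 Z0 l0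
  return (match m return path m X0 Z0 l0 -> Prop with 0 => fun _ => True | m'.+1 => fun p0 =>
    forall P : forall (X Z : D) l, path m'.+1 X Z l -> Prop,
    (forall X Y Z i j l (e : i + j = l) (f : hom D Y X i) (q : path m' Y Z j),
        P X Z l (pcons e f q)) -> P X0 Z0 l0 p0 end p0)
  with pnil X => I | pcons _ _ _ _ _ _ _ _ _ _ => _ end).
by move=> P PS; exact: PS.
Qed.

Lemma merges_pcons n (X Y T Z : D) i j l i1 j1 (e : i + j = l) (f : hom D Y X i)
    (e' : i1 + j1 = j) (g : hom D T Y i1) (q : path n T Z j1) :
  merges e f (pcons e' g q) =
    pcons (etrans (esym (addrA i i1 j1)) (etrans (congr1 (+%R i) e') e)) (comp (erefl (i + i1)) f g) q
    :: [seq pcons e f r | r <- merges e' g q].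
Proof. by []. Qed.

Section Module.
Variable R : rmod D.

Lemma unc_eq (m i j l l' : int) : i + j = l -> m + l = l' -> m + i + j = l'.
Proof. by move=> <- <-; rewrite addrA. Qed.

Lemma unc_nil_eq (m l' : int) : m + 0 = l' -> m = l'.
Proof. by rewrite addr0. Qed.

(* Evaluation of an element of an iterated cofree module along a path *)
Fixpoint unc n X Z l (p : path n X Z l) : forall m l', m + l = l' -> rm (Gn n R) X m -> rm R Z l' :=
  match p in path n X Z l return forall m l', m + l = l' -> rm (Gn n R) X m -> rm R Z l' with
  | pnil X => fun m l' e (gam : rm R X m) => ecast z (rm R X z) (unc_nil_eq e) gam
  | pcons n X Y Z i j l e1 f q => fun m l' e (gam : rm (cofree (Gn n R)) X m) =>
      @unc n Y Z j q (m + i) l' (unc_eq e1 e) (cev (M := Gn n R) gam erefl f)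
  end.

Lemma unc_cons n X Y Z i j l (e1 : i + j = l) (f : hom D Y X i) (q : path n Y Z j)
    m l' (e : m + l = l') (gam : rm (Gn n.+1 R) X m) p (e2 : m + i = p) (e3 : p + j = l') :
  unc (pcons e1 f q) e gam = unc q e3 (cev (M := Gn n R) gam e2 f).
Proof. by case: p / e2 e3 => e3 /=; congr unc; exact: eq_irrelevance. Qed.

Lemma unc_nil X m (e : m + 0 = m) (gam : rm R X m) : unc (pnil X) e gam = gam.
Proof. by rewrite /= (eq_irrelevance (unc_nil_eq e) erefl). Qed.

Lemma unc_nil_ract X Y m p i l (e : m + 0 = p) (e1 : p + i = l) (e2 : m + i = l)
    (gam : rm R X m) (f : hom D Y X i) :
  ract R e1 (unc (pnil X) e gam) f = ract R e2 gam f.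
Proof.
have mp := unc_nil_eq e; case: p / mp e e1 => e e1.
by rewrite unc_nil; congr ract; exact: eq_irrelevance.
Qed.

Lemma unc_ract_nil X Y m p i l (e : p + 0 = l) (e1 : m + i = p) (e2 : m + i = l)
    (gam : rm R X m) (f : hom D Y X i) :
  unc (pnil Y) e (ract R e1 gam f) = ract R e2 gam f.
Proof.
have mp := unc_nil_eq e; case: l / mp e e2 => e e2.
by rewrite unc_nil; congr ract; exact: eq_irrelevance.
Qed.

Lemma unc_linear n X Z l (p : path n X Z l) m l' (e : m + l = l') : linear (@unc n X Z l p m l' e).
Proof.
elim: p m l' e => [X0|n0 X0 Y0 Z0 i j l0 e1 f q IH] m l' e a u v.
  by have mp := unc_nil_eq e; case: l' / mp e => e; rewrite !unc_nil.
by rewrite !(unc_cons _ _ _ _ _ erefl (unc_eq e1 e)) cevZD IH.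
Qed.

Lemma unc_sub n X Z l (p : path n X Z l) m l' (e : m + l = l') u v :
  unc p e (u - v) = unc p e u - unc p e v.
Proof. exact: (linearB (lin_fun (unc_linear p e))). Qed.

Lemma unc_scale n X Z l (p : path n X Z l) m l' (e : m + l = l') a u :
  unc p e (a *: u) = a *: unc p e u.
Proof. exact: (linearZZ (lin_fun (unc_linear p e))). Qed.

Lemma unc_inj n X m (gam gam' : rm (Gn n R) X m) :
  (forall Z l l' (p : path n X Z l) (e : m + l = l'), unc p e gam = unc p e gam') -> gam = gam'.
Proof.
elim: n X m gam gam' => [|n IH] X m gam gam' eq.
  by have := eq _ _ _ (pnil X) (addr0 m); rewrite !unc_nil.
apply: cev_eq => Y j l e f; apply: IH => Z j' l' q e'.
have e'' : m + (j + j') = l' by rewrite addrA e.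
by have := eq _ _ _ (pcons erefl f q) e''; rewrite !(unc_cons _ _ _ _ _ e e').
Qed.

Lemma unc_multilinear n X Z l (a : k) (p q r : path n X Z l) m l' (e : m + l = l') gam :
  plin a p q r -> unc r e gam = a *: unc p e gam + unc q e gam.
Proof.
move=> H; elim: H m l' e gam => {n X Z l p q r}
  [n X Y Z i j l e1 f g p|n X Y Z i j l e1 f p q r _ IH] m l' e gam.
  by rewrite !(unc_cons _ _ _ _ _ erefl (unc_eq e1 e)) cev_linear unc_linear.
by rewrite !(unc_cons _ _ _ _ _ erefl (unc_eq e1 e)) IH.
Qed.

(** Fixing the first entry f leaves a multilinear family on shorter paths. The element obtained for
    it by induction is unique by [unc_inj], hence linear in f. *)
Lemma unc_surj n X m (w : forall Z l l', m + l = l' -> path n X Z l -> rm R Z l') :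
  (forall a Z l l' (e : m + l = l') (p q r : path n X Z l),
     plin a p q r -> w _ _ _ e r = a *: w _ _ _ e p + w _ _ _ e q) ->
  exists gam : rm (Gn n R) X m, forall Z l l' (e : m + l = l') p, unc p e gam = w Z l l' e p.
Proof.
elim: n X m w => [|n IH] X m w wm.
  exists (w _ _ _ (addr0 m) (pnil X)) => Z l l' e p.
  move: w wm e; elim/path0P: p => {}X w wm e.
  have mp := unc_nil_eq e; case: l' / mp e => e; rewrite unc_nil.
  by congr w; exact: eq_irrelevance.
have wcons i j l l' (e : m + i = l) (e' : l + j = l') : m + (i + j) = l' by rewrite addrA e.
pose wf (Y : D) i l (e : m + i = l) (f : hom D Y X i) (Z : D) j l' (e' : l + j = l') (q : path n Y Z j) :=
  w Z (i + j) l' (wcons i j l l' e e') (pcons erefl f q).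
have wfP (Y : D) i l (e : m + i = l) (f : hom D Y X i) : exists gam : rm (Gn n R) Y l,
    forall Z j l' (e' : l + j = l') q, unc q e' gam = wf Y i l e f Z j l' e' q.
  by apply: IH => a Z j l' e' p q r pqr; apply: wm; constructor.
pose g Y i l e f := sval (cid (wfP Y i l e f)).
have gP Y i l e f := svalP (cid (wfP Y i l e f)).
have gl Y i l (e : m + i = l) : linear (g Y i l e).
  move=> a f f'; apply: unc_inj => Z j l' q e'.
  by rewrite unc_linear /g !gP; apply: wm; constructor.
exists (mkcof g gl) => Z l l' e p.
move: w wm wcons @wf wfP @g gP gl e; elim/pathSP: p => {}X Y {}Z i j {}l e1 f q w wm wcons wf wfP g gP gl e.
rewrite (unc_cons _ _ _ _ _ erefl (unc_eq e1 e)) [cev _ _ _]/(g Y i (m + i) erefl f) /g gP /wf.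
by case: l / e1 e => e; congr w; exact: eq_irrelevance.
Qed.

(** Up to a global sign, the differential of the cofree resolution produces every term of the
    Hochschild differential except the one with the left action. In d_(n+1) = eta - G(d_n), the unit
    merges the first two entries and G(d_n) acts on the rest of the path. *)
Lemma unc_Gd n X Y Z i j l (e : i + j = l) (f : hom D Y X i) (q : path n Y Z j) m l'
    (el : m + l = l') (gam : rm (Gn n R) X m) p
    (e1 : m + lc_i (cut_last e f q) = p) (e2 : p + lc_j (cut_last e f q) = l') :
  unc (pcons e f q) el (ap (Gd n R) gam) =
  - (altsum (fun r => unc r el gam) (merges e f q) +
     (-1) ^+ n.+1 *: ract R e2 (unc (lc_init (cut_last e f q)) e1 gam) (lc_last (cut_last e f q))).
Proof.
elim: q X i l e f m l' el gam p e1 e2 => [Y0|n0 Y0 Y1 Z0 i1 j1 j0 e' g q IH]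
  X i l e f m l' el gam p e1 e2.
  rewrite add0r expr1 scaleN1r opprK (unc_cons _ _ _ _ _ erefl (unc_eq e el)) eta_ev.
  have e3 : m + i = l' by rewrite -el -e addr0.
  by rewrite [LHS](unc_ract_nil _ _ e3) [RHS](unc_nil_ract _ _ e3).
rewrite (unc_cons _ _ _ _ _ erefl (unc_eq e el)) Gd_ev unc_sub.
have e3 : m + i + (lc_i (cut_last e' g q)) = p by rewrite -e1 /= addrA.
rewrite (IH _ _ _ e' g (m + i) l' (unc_eq e el) (cev gam erefl f) p e3 e2).
rewrite merges_pcons altsum_cons altsum_map opprK.
have e4 : m + (i + i1) + j1 = l' by rewrite -el -e -e' !addrA.
have e5 : m + i + i1 = m + (i + i1) by rewrite addrA.
have aE : unc (pcons e' g q) (unc_eq e el) (ract (Gn n0.+1 R) erefl gam f) =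
    unc (pcons (etrans (esym (addrA i i1 j1)) (etrans (congr1 (+%R i) e') e))
          (comp (erefl (i + i1)) f g) q) el gam.
  by rewrite (unc_cons _ _ _ _ _ e5 e4) (unc_cons _ _ _ _ _ erefl e4) (ract_ev _ _ _ _ _ erefl erefl).
have SE : altsum (fun r => unc r (unc_eq e el) (cev gam erefl f)) (merges e' g q) =
    altsum (fun r => unc (pcons e f r) el gam) (merges e' g q).
  by apply: eq_altsum => r; rewrite (unc_cons _ _ _ _ _ erefl (unc_eq e el)).
have ac (V : lmodType k) (c : k) (x y z z' : V) : z = z' ->
    x + (y + c *: z) = - (- x - y + ((-1) * c) *: z').
  by move=> ->; rewrite mulN1r scaleNr !opprD !opprK addrA.
rewrite aE SE [X in _ = - (_ + X *: _)]exprS; apply: ac.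
by congr ract; rewrite [RHS](unc_cons _ _ _ _ _ erefl e3).
Qed.

End Module.
End Currying.

Definition ksign (k : fieldType) (s i : int) : k := (-1) ^+ `|(s * i)%R|%N.

Lemma ksignE (k : fieldType) s i : ksign k s i = (-1) ^ (s * i).
Proof.
rewrite /ksign; case: (s * i) => n //.
by rewrite [RHS]/exprz -exprVn invrN1.
Qed.

Lemma ksignD (k : fieldType) s i j : ksign k s (i + j) = ksign k s i * ksign k s j.
Proof. by rewrite !ksignE mulrDr expfzDr // oppr_eq0 oner_eq0. Qed.

Section CH.
Variables (k : fieldType) (D : gcat k).

Lemma unc_map (R R' : rmod D) d (f : ghom R R' d) n X Z l (p : path n X Z l) m m' l' l''
    (e : m + d = m') (e1 : m' + l = l'') (e2 : m + l = l') (e3 : l' + d = l'') (gam : rm (Gn n R) X m) :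
  unc p e1 (gapp (Gmap n f) e gam) = gapp f e3 (unc p e2 gam).
Proof.
elim: p m m' l' l'' e e1 e2 e3 gam => [{}X|{}n {}X Y {}Z i j {}l e0 g q IH] m m' l' l'' e e1 e2 e3 gam.
  have ml := unc_nil_eq e2; case: l' / ml e2 e3 => e2 e3; rewrite unc_nil.
  have ml := unc_nil_eq e1; case: l'' / ml e1 e3 => e1 e3; rewrite unc_nil.
  by congr gapp; exact: eq_irrelevance.
have e4 : m + i + d = m' + i by rewrite addrAC e.
rewrite (unc_cons _ _ _ _ _ erefl (unc_eq e0 e1)) (unc_cons _ _ _ _ _ erefl (unc_eq e0 e2)).
by rewrite (cmap_ev (Gmap n f) e gam erefl erefl e4) (IH _ _ _ _ e4 _ (unc_eq e0 e2) e3).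
Qed.

Section Bimodule.
Variable M : bimod D.

Definition brmod (X : D) : rmod D :=
  @RMod k D (fun Z n => bm M Z X n) (fun Z Z' i j l e x f => br M e x f)
    (fun Z Z' i j l e a x x' f => brDl e a x x' f)
    (fun Z Z' i j l e a x f f' => brDr e a x f f')
    (fun Z i e x => br1 e x)
    (fun Z Z' Z'' i j l ij jl n e1 e2 e3 e4 x f g => brA e1 e2 e3 e4 x f g).

Lemma bl_eq (n i m : int) : n + i = m -> i + n = m.
Proof. by rewrite addrC. Qed.

Definition blm X Y i (f : hom D Y X i) : ghom (brmod Y) (brmod X) i.
Proof.
apply: (@mkhom k D (brmod Y) (brmod X) i (fun Z n m e x => bl M (bl_eq e) f x)).
  by move=> Z n m e a x y; exact: blDr.
by move=> Z Z' n m j n' m' e e' h h' x g; rewrite /= -(blrA (bl_eq e) h h').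
Defined.

Lemma blm_ev X Y i (f : hom D Y X i) Z n m (e : n + i = m) (e' : i + n = m) (x : bm M Z Y n) :
  gapp (blm f) e (x : rm (brmod Y) Z n) = bl M e' f x.
Proof. by rewrite /gapp /=; congr bl; exact: eq_irrelevance. Qed.

Lemma blmZD X Y i a (f g : hom D Y X i) : blm (a *: f + g) = a *: blm f + blm g.
Proof. by apply: ghom_eq => Z n m e x; rewrite gappZD !(blm_ev _ _ (bl_eq e)) blDl. Qed.

Lemma blm_comp X Y Z i j l (e : i + j = l) (f : hom D Y X i) (g : hom D Z Y j) :
  blm (comp e f g) = gcomp e (blm f) (blm g).
Proof.
apply: ghom_eq => T n m em x.
have e1 : n + j + i = m by rewrite -addrA [j + i]addrC e.
have e2 : i + (j + n) = m by rewrite addrA e addrC.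
have e3 : i + (n + j) = m by rewrite [n + j]addrC.
rewrite (gapp_comp e (blm f) (blm g) em erefl e1) (blm_ev _ _ (bl_eq em)) (blm_ev g erefl (addrC j n)).
by rewrite (blm_ev f e1 e3) (blA _ (addrC j n) _ e3).
Qed.

(** Curried Hochschild cochains: a path ending at X is fed in from its first entry, each entry using
    one layer of G, and the value lies in M(-, X). The identification is [uncurry]. *)
Definition CH (n : nat) (s : int) : lmodType k := dprod (fun X : D => rm (Gn n (brmod X)) X s).

(** The first term is the left action of f_1 with its Koszul sign; the second one accounts for all
    the others, by [unc_Gd]. *)
Definition dCH_at n s (phi : CH n s) X Y j l (e : s + j = l) (f : hom D Y X j) :
    rm (Gn n (brmod X)) Y l :=
  ksign k s j *: gapp (Gmap n (blm f)) e (phi Y) - cev (M := Gn n (brmod X)) (ap (Gd n (brmod X)) (phi X)) e f.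

Lemma dCH_at_linear n s (phi : CH n s) X Y j l (e : s + j = l) : linear (@dCH_at n s phi X Y j l e).
Proof.
move=> a f g; rewrite /dCH_at blmZD GmapZD cev_linear gappZD scalerDr !scalerA scalerBr scalerA.
by rewrite [ksign _ _ _ * a]mulrC opprD addrACA.
Qed.

Definition dCH_fun n s (phi : CH n s) : CH n.+1 s :=
  fun X => mkcof (dCH_at phi (X := X)) (dCH_at_linear phi (X := X)).

Lemma dCH_funE n s (phi : CH n s) X Y j l (e : s + j = l) (f : hom D Y X j) :
  cev (M := Gn n (brmod X)) (dCH_fun phi X) e f =
  ksign k s j *: gapp (Gmap n (blm f)) e (phi Y) - cev (M := Gn n (brmod X)) (ap (Gd n (brmod X)) (phi X)) e f.
Proof. by []. Qed.

Lemma dCH_linear n s : linear (@dCH_fun n s).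
Proof.
move=> a phi psi; apply: functional_extensionality_dep => X; rewrite dprodZDE.
apply: cev_eq => Y j l e f; rewrite [RHS]cevZD !dCH_funE !dprodZDE.
by rewrite /ap !gapp_linear cevZD !scalerDr !scalerA mulrC opprD addrACA scalerN.
Qed.

Definition dCH n s : {linear CH n s -> CH n.+1 s} := lin_fun (@dCH_linear n s).

Lemma dCHE n s (phi : CH n s) X Y j l (e : s + j = l) (f : hom D Y X j) :
  cev (M := Gn n (brmod X)) (dCH n s phi X) e f =
  ksign k s j *: gapp (Gmap n (blm f)) e (phi Y) - cev (M := Gn n (brmod X)) (ap (Gd n (brmod X)) (phi X)) e f.
Proof. by []. Qed.

(** Two left actions compose by [blm_comp], the mixed terms cancel by [Gd_nat], and the remaining
    ones by [GdGd]. *)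
Lemma dCH2 n s (phi : CH n s) : dCH n.+1 s (dCH n s phi) = 0.
Proof.
apply: functional_extensionality_dep => X; apply: (@cev_eq _ _ (Gn n.+1 (brmod X))).
move=> Y j l e f; apply: (@cev_eq _ _ (Gn n (brmod X))) => Z i p e' g.
have e1 : s + i + j = p by rewrite addrAC e.
have e2 : s + (j + i) = p by rewrite addrA e.
transitivity (0 : rm (Gn n (brmod X)) Z p); last by [].
rewrite dCHE cevB cevZ (cmap_ev (Gmap n (blm f)) e _ e' erefl e1) dCHE.
rewrite Gd_ev cevB (ract_ev _ _ _ e' _ erefl e2) !dCHE.
rewrite gapp_sub gapp_scale /ap gapp_sub cevB gapp_scale -!/(ap _ _) cevZ.
rewrite blm_comp Gmap_comp (gapp_comp _ _ _ _ erefl e1) ksignD scalerBr scalerA.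
rewrite -(Gd_nat (n := n) (blm f) e) (cmap_ev (Gmap n (blm f)) e _ e' erefl e1).
have := GdGd (phi X); move/(congr1 (fun z => cev (M := Gn n (brmod X))
  (cev (M := Gn n.+1 (brmod X)) z e f) e' g)).
rewrite Gd_ev cevB (ract_ev _ _ _ e' _ erefl e2) => /eqP; rewrite subr_eq0 => /eqP ->.
set P := _ *: gapp _ _ _; set Q := _ *: gapp _ _ _; set R := cev _ _ _.
by rewrite !opprB [Q - R + _]addrA subrK addrA subrK subrr.
Qed.

Definition CH_bound n s : subspace (CH n s) :=
  match n return subspace (CH n s) with
  | 0 => zero_sub (CH 0 s) | n'.+1 => im_sub (dCH n' s) end.

Definition uncurry n s (phi : CH n s) : precochain M n s :=
  fun c => unc (ch_path c) (addrC s (ch_deg c)) (phi (ch_tgt c)).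

Lemma uncurryE n s (phi : CH n s) X Z l (p : path n X Z l) (e : s + l = l + s) :
  ev (uncurry phi) p = unc p e (phi X).
Proof. by rewrite (eq_irrelevance e (addrC s l)). Qed.

Lemma uncurry_linear n s : linear (@uncurry n s).
Proof.
move=> a phi psi; apply: functional_extensionality_dep => c.
exact: (unc_linear (R := brmod (ch_tgt c)) (ch_path c) (addrC s _) a (phi _) (psi _)).
Qed.

Lemma uncurry0 n s : @uncurry n s 0 = 0.
Proof. exact: (linear0 (lin_fun (@uncurry_linear n s))). Qed.

Lemma uncurry_inj n s : injective (@uncurry n s).
Proof.
move=> phi psi eq; apply: functional_extensionality_dep => X.
apply: unc_inj => Z l l' p e.
have {eq} := congr1 (fun c : precochain M n s => ev c p) eq.
by rewrite !(uncurryE _ _ (addrC s l)); case: l' / e; move: (addrC s l); rewrite [l + s]addrC => e;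
  rewrite (eq_irrelevance e erefl).
Qed.

Lemma uncurry_multilinear n s (phi : CH n s) : multilinear (uncurry phi).
Proof.
by move=> a X Z l p q r pqr; rewrite !(uncurryE _ _ (addrC s l)); exact: (unc_multilinear (R := brmod X) (addrC s l) (phi X) pqr).
Qed.

Lemma uncurry_surj n s (psi : precochain M n s) :
  multilinear psi -> exists phi, psi = uncurry phi.
Proof.
move=> mpsi; pose w X Z l l' (e : s + l = l') (p : path n X Z l) : bm M Z X l' :=
  ecast z (bm M Z X z) (etrans (addrC l s) e) (ev psi p).
have wE X Z l (e : s + l = l + s) (p : path n X Z l) : w X Z l (l + s) e p = ev psi p.
  by rewrite /w (eq_irrelevance (etrans _ e) erefl).
have wm X a Z l l' (e : s + l = l') (p q r : path n X Z l) :
    plin a p q r -> w X Z l l' e r = a *: w X Z l l' e p + w X Z l l' e q.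
  move=> pqr; rewrite /w; move: (etrans _ _) => t; case: l' / t {e}; exact: mpsi.
pose phi : CH n s := fun X => sval (cid (unc_surj (R := brmod X) (wm X))).
have phiP X := svalP (cid (unc_surj (R := brmod X) (wm X))).
exists phi; apply: functional_extensionality_dep => -[X Z l p].
by rewrite -[RHS]/(ev (uncurry phi) p) (uncurryE _ _ (addrC s l)) /phi phiP wE.
Qed.

Lemma uncurry_d n s (phi : CH n s) : uncurry (dCH n s phi) = hd (uncurry phi).
Proof.
apply: functional_extensionality_dep => -[X Z l p].
rewrite -[LHS]/(ev (uncurry (dCH n s phi)) p) -[RHS]/(hd_path (uncurry phi) p).
move: phi; elim/pathSP: p => {}X Y {}Z i j {}l e f q phi.
rewrite -[RHS]/(hd_cons (uncurry phi) e f q) (uncurryE _ _ (addrC s l)).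
have e1 : s + i + j = l + s by rewrite -addrA e addrC.
rewrite (unc_cons _ _ _ _ _ erefl e1) dCHE unc_sub unc_scale.
rewrite -(unc_cons e f q (addrC s l)).
have e2 : j + s + i = l + s by rewrite addrAC [j + i]addrC e.
rewrite (unc_map (blm f) _ erefl e1 (addrC s j) e2) (blm_ev f e2 (left_eq s e)).
rewrite (unc_Gd _ _ (addrC s _) (right_eq s (lc_e (cut_last e f q)))) opprK /hd_cons.
rewrite -altsumE addrA; congr (_ + _ + _ *: _).
Qed.

Lemma CH_computes n s :
  computes (dCH n s) (CH_bound n s)
    (fun phi => cls (hh_cocycle M n s) (hh_cobound M n s) (uncurry phi)).
Proof.
have Z phi : dCH n s phi = 0 -> hh_cocycle M n s (uncurry phi).
  by move=> d0; split; [exact: uncurry_multilinear | rewrite -uncurry_d d0 uncurry0].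
split=> [a phi psi /Z Zphi /Z Zpsi|phi /Z Zphi|h].
- by rewrite uncurry_linear clsZD.
- rewrite cls0P //; case: n phi Zphi {Z} => [|n] phi Zphi.
    split=> [u0|->]; last exact: uncurry0.
    by apply: uncurry_inj; rewrite uncurry0.
  split=> [[psi [mpsi phiE]]|[psi ->]].
    have [psi' psiE] := uncurry_surj mpsi; exists psi'; apply: uncurry_inj.
    by rewrite uncurry_d -psiE.
  by exists (uncurry psi); split; [exact: uncurry_multilinear | exact: uncurry_d].
have [psi [[mpsi dpsi] ->]] := cls_surj h; have [phi phiE] := uncurry_surj mpsi.
exists phi; split; last by rewrite phiE.
by apply: uncurry_inj; rewrite uncurry_d -phiE dpsi uncurry0.
Qed.

End Bimodule.
End CH.

(** * Change of coefficients and contraction of the Hochschild complex *)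

Section CHFunctor.
Variables (k : fieldType) (D : gcat k).

Section Map.
Variables (M M' : bimod D) (al : forall X, ghom (brmod M X) (brmod M' X) 0).

(** Compatibility with the right action is in the type of [al]; this is compatibility with the left
    one. *)
Definition bimod_natural : Prop := forall X Y i (f : hom D Y X i),
  gcomp (add0r i) (al X) (blm M f) = gcomp (addr0 i) (blm M' f) (al Y).

Definition CHmap n s (phi : CH M n s) : CH M' n s := fun X => ap (Gmap n (al X)) (phi X).

Lemma CHmap_linear n s : linear (@CHmap n s).
Proof.
move=> a phi psi; apply: functional_extensionality_dep => X; rewrite dprodZDE.
exact: gapp_linear.
Qed.

Lemma CHmap_scale n s a (phi : CH M n s) : CHmap (a *: phi) = a *: CHmap phi.
Proof. exact: (linearZZ (lin_fun (@CHmap_linear n s))). Qed.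

Lemma CHmap_d n s (phi : CH M n s) : bimod_natural ->
  dCH M' n s (CHmap phi) = CHmap (dCH M n s phi).
Proof.
move=> nat; apply: functional_extensionality_dep => X.
apply: (@cev_eq _ _ (Gn n (brmod M' X))) => Y j l e f.
rewrite dCHE [RHS](ap_cmap_ev (Gmap n (al X))) dCHE /ap gapp_sub gapp_scale -!/(ap _ _).
rewrite -(Gd_nat (n := n) (al X) (addr0 s)) (ap_cmap_ev (Gmap n (al X))).
congr (_ *: _ - _).
rewrite -(gapp_compr (addr0 j)) -(gapp_compl (add0r j)) -!Gmap_comp.
by rewrite nat.
Qed.

End Map.

Section Contraction.
Variables (M : bimod D) (h0 : forall X, ghom (cofree (brmod M X)) (brmod M X) 0).
Hypothesis h0_eta : forall X Z n (x : rm (brmod M X) Z n), ap (h0 X) (ap (eta _) x) = x.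
Hypothesis h0_nat : forall X Y i (f : hom D Y X i),
  gcomp (add0r i) (h0 X) (cmap (blm M f)) = gcomp (addr0 i) (blm M f) (h0 Y).

Fixpoint contr n X : ghom (Gn n.+1 (brmod M X)) (Gn n (brmod M X)) 0 :=
  match n return ghom (Gn n.+1 (brmod M X)) (Gn n (brmod M X)) 0 with
  | 0 => h0 X | n'.+1 => cmap (contr n' X) end.

Lemma contr_nat n X Y i (f : hom D Y X i) :
  gcomp (add0r i) (contr n X) (Gmap n.+1 (blm M f)) =
  gcomp (addr0 i) (Gmap n (blm M f)) (contr n Y).
Proof. by elim: n => [|n IH]; [exact: h0_nat | rewrite /= -!cmap_comp -IH]. Qed.

(** G^(n+1)(h0) commutes with all summands of the differential but the innermost one, (-1)^(n+1)
    G^(n+1)(eta), which it cancels because h0 retracts eta. *)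
Lemma contr_Gd n X Z m (y : rm (Gn n.+1 (brmod M X)) Z m) :
  ap (contr n.+1 X) (ap (Gd n.+1 _) y) =
  ap (Gd n _) (ap (contr n X) y) + (-1) ^+ n.+1 *: y.
Proof.
elim: n Z m y => [|n IH] Z m y; apply: cev_eq => Y j l e g.
  rewrite [LHS](ap_cmap_ev (h0 X)) (Gd_ev (n := 0)) /ap gapp_sub -!/(ap _ _).
  rewrite h0_eta cevD cevZ expr1 scaleN1r eta_ev; congr (_ - _).
  exact: (gapp_ract (h0 X) _ _ e).
rewrite [LHS](ap_cmap_ev (contr n.+1 X)) (Gd_ev (n := n.+1)) /ap gapp_sub -!/(ap _ _).
have sE : (-1 : k) ^+ n.+2 = - (-1) ^+ n.+1 by rewrite exprS mulN1r.
rewrite IH [RHS]cevD cevZ [in RHS](Gd_ev (n := n)) sE scaleNr opprD addrA.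
congr (_ - _ - _); first exact: (gapp_ract (contr n.+1 X) _ _ e).
by rewrite (ap_cmap_ev (contr n X)).
Qed.

(** The homotopy works on the innermost layer, that of the last argument, and so leaves the left
    action on the first argument in place. It passes through that term by [h0_nat]. *)
Lemma CH_contr_exact n s (phi : CH M n.+1 s) :
  dCH M n.+1 s phi = 0 -> exists psi, phi = dCH M n s psi.
Proof.
move=> d0; pose psi : CH M n s := fun X => ap (contr n X) (phi X).
exists ((-1) ^+ n.+1 *: psi); rewrite linearZZ.
apply: functional_extensionality_dep => X; apply: (@cev_eq _ _ (Gn n (brmod M X))) => Y j l e f.
have := congr1 (fun z : CH M n.+2 s => ap (contr n X) (cev (M := Gn n.+1 (brmod M X)) (z X) e f)) d0.
rewrite dprod0E dCHE [RHS](gapp_zero (contr n X) Y (addr0 l)).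
rewrite /ap gapp_sub gapp_scale -!/(ap _ _).
rewrite -(ap_cmap_ev (contr n X)) [ap (cmap _) _](contr_Gd (phi X)).
rewrite -(gapp_compl (add0r j)) contr_nat (gapp_compr (addr0 j)) cevD cevZ opprD addrA.
move/eqP; rewrite subr_eq0 => /eqP E.
have dE := dCHE psi e f; rewrite E in dE.
have -> : ((-1) ^+ n.+1 *: dCH M n s psi : CH M n.+1 s) X = (-1) ^+ n.+1 *: (dCH M n s psi X) by [].
by rewrite cevZ dE scalerA -expr2 sqrr_sign scale1r.
Qed.

End Contraction.

End CHFunctor.

(** * Representable modules *)

Section Representable.
Variables (k : fieldType) (C : gcat k).

(** Built from the diagonal bimodule, so that the cochains of C with values in C lie in iterated
    cofree modules over the [hmod c]. *)
Definition hmod (c : C) : rmod C := brmod (diag_bimod C) c.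

Section Tilde.
Variables (c : C) (N : rmod C).

Definition tilde n (x : rm N c n) : ghom (hmod c) N n.
Proof.
apply: (@mkhom k C (hmod c) N n (fun Y p m e (y : hom C Y c p) => ract N (bl_eq e) x y)).
  by move=> Y p m e a y y'; exact: ractDr.
by move=> Y Z p m i p' m' e e' h h' y g; rewrite (ractA (bl_eq e) h h' (bl_eq e')).
Defined.

Lemma tilde_ev n (x : rm N c n) Y p m (e : p + n = m) (e' : n + p = m) (y : hom C Y c p) :
  gapp (tilde x) e (y : rm (hmod c) Y p) = ract N e' x y.
Proof. by rewrite /gapp /=; congr ract; exact: eq_irrelevance. Qed.

Lemma tilde_id n (x : rm N c n) : gapp (tilde x) (add0r n) (idm c : rm (hmod c) c 0) = x.
Proof. by rewrite (tilde_ev x (add0r n) (addr0 n)) ract1. Qed.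

Lemma tilde_eq n (f : ghom (hmod c) N n) x :
  gapp f (add0r n) (idm c : rm (hmod c) c 0) = x -> f = tilde x.
Proof.
move=> <-; apply: ghom_eq => Y p m e y; have e' : n + p = m by rewrite addrC.
rewrite (tilde_ev _ e e') -(gapp_ract f (add0r n) e (add0r p) e'); congr gapp.
by rewrite /= comp1m.
Qed.

Lemma tildeZD n a (x y : rm N c n) : tilde (a *: x + y) = a *: tilde x + tilde y.
Proof. by apply/esym/tilde_eq; rewrite gappZD !tilde_id. Qed.

End Tilde.

Lemma tilde_post c (N N' : rmod C) n d m (e : d + n = m) (e' : n + d = m) (f : ghom N N' d)
  (x : rm N c n) : gcomp e f (tilde x) = tilde (gapp f e' x).
Proof. by apply: tilde_eq; rewrite (gapp_comp e f _ _ (add0r n) e') tilde_id. Qed.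

Lemma tilde_ract c c' (N : rmod C) n i m (e : n + i = m) (x : rm N c n) (g : hom C c' c i) :
  tilde (ract N e x g) = gcomp e (tilde x) (blm (diag_bimod C) g).
Proof.
apply/esym/tilde_eq; have e' : i + n = m by rewrite addrC.
rewrite (gapp_comp e _ _ _ (add0r i) e') (blm_ev _ (add0r i) (addr0 i)) (tilde_ev _ e' e).
by rewrite /= compm1.
Qed.

Section FinitePresentation.
Variable c : C.

Let s0 : seq (C * int) := [:: (c, 0)].

Definition gen_at Y n m (e : n + 0 = m) (x : rm (free_mod s0) Y n) : rm (hmod c) Y m :=
  ecast z (hom C Y c z) e (x ord0).

Lemma gen_at_linear Y n m (e : n + 0 = m) : linear (@gen_at Y n m e).
Proof. by case: m / e. Qed.

Lemma gen_at_ract Y Z (n m i n' m' : int) (e : n + 0 = m) (e' : n' + 0 = m')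
    (h : n + i = n') (h' : m + i = m') (x : rm (free_mod s0) Y n) (g : hom C Z Y i) :
  gen_at e' (ract (free_mod s0) h x g) = ract (hmod c) h' (gen_at e x) g.
Proof.
by case: m / e h'; case: m' / e' => h'; congr comp; exact: eq_irrelevance.
Qed.

Definition gen : ghom (free_mod s0) (hmod c) 0 := mkhom gen_at_linear gen_at_ract.

(** Up to a product with one factor and a shift by 0, this is the free module on one generator,
    presented by the empty sum of relations. *)
Lemma hmod_finpres : finpres (hmod c).
Proof.
exists [::], s0, 0, 0, gen; split.
  move=> Y m y; exists m, (addr0 m).
  exists (fun t : 'I_1 => ecast t0 (hom C Y (tnth (in_tuple s0) t0).1 (m + (tnth (in_tuple s0) t0).2))
    (esym (ord1 t)) (ecast z (hom C Y c z) (esym (addr0 m)) y)).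
  rewrite /gapp /= /gen_at (eq_irrelevance (ord1 ord0) erefl) /=.
  have castK (i j : int) (e : i = j) (z : hom C Y c j) :
      ecast t (hom C Y c t) e (ecast t (hom C Y c t) (esym e) z) = z by case: j / e z.
  exact: castK.
move=> Y n y; split=> [py|[m [e [x <-]]] m' e']; last exact: gapp_zero.
exists n, (addr0 n), 0; apply: functional_extensionality_dep => t.
rewrite (ord1 t); exact/esym/(py _ erefl).
Qed.

End FinitePresentation.

End Representable.

(** * The double complex *)

Section Main.
Variables (k : fieldType) (C : gcat k) (modC : fp_model C).

Let D := mod_cat modC.
Notation mo := (@fp_mod k C modC).

Section Yoneda.
Variable c : C.

Let yo_ex : exists X : fp_ob modC, giso (mo X) (hmod c) := fp_all modC (hmod_finpres c).

(** The model of mod(C) need not contain h_c, only a module isomorphic to it. *)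
Definition yo : fp_ob modC := sval (cid yo_ex).

Let yo_iso : giso (mo yo) (hmod c) := svalP (cid yo_ex).

(** The Yoneda lemma carried along the isomorphism, u being the image of the identity of c. Unlike
    [tilde x], the morphism [hat x] belongs to mod(C) when N does. *)
Lemma yu_ex : exists u : rm (mo yo) c 0, forall N n (x : rm N c n),
  exists2 f : ghom (mo yo) N n, gapp f (add0r n) u = x &
    forall f', gapp f' (add0r n) u = x -> f' = f.
Proof.
have [a [b [ba ab]]] := yo_iso; exists (ap b (idm c : rm (hmod c) c 0)) => N n x.
exists (gcomp (addr0 n) (tilde x) a).
  by rewrite (gapp_compr (addr0 n)) -(ap_comp (addr0 0)) ab /ap gapp_id tilde_id.
move=> f' f'x; have <- : gcomp (addr0 n) f' b = tilde x.
  by apply: tilde_eq; rewrite (gapp_compr (addr0 n)).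
by rewrite (gcompA _ (addr0 0) _ (addr0 n)) ba gcompm1.
Qed.

Definition yu : rm (mo yo) c 0 := sval (cid yu_ex).

Definition hat N n (x : rm N c n) : ghom (mo yo) N n := s2val (cid2 (svalP (cid yu_ex) N n x)).

Lemma hat_yu N n (x : rm N c n) : gapp (hat x) (add0r n) yu = x.
Proof. exact: (s2valP (cid2 (svalP (cid yu_ex) N n x))). Qed.

Lemma hat_eq N n (x : rm N c n) f : gapp f (add0r n) yu = x -> f = hat x.
Proof. exact: (s2valP' (cid2 (svalP (cid yu_ex) N n x))). Qed.

Lemma hatZD N n a (x y : rm N c n) : hat (a *: x + y) = a *: hat x + hat y.
Proof. by apply/esym/hat_eq; rewrite gappZD !hat_yu. Qed.

Lemma hat_post N N' n d m (e : d + n = m) (e' : n + d = m) (f : ghom N N' d)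
  (x : rm N c n) : gcomp e f (hat x) = hat (gapp f e' x).
Proof. by apply: hat_eq; rewrite (gapp_comp e f _ _ (add0r n) e') hat_yu. Qed.

Lemma tilde_hat N n (x : rm N c n) :
  gcomp (addr0 n) (tilde x) (hat (idm c : rm (hmod c) c 0)) = hat x.
Proof. by rewrite (hat_post _ (add0r n)) tilde_id. Qed.

Lemma hat_tilde : gcomp (addr0 0) (hat (idm c : rm (hmod c) c 0)) (tilde yu) = gidm (hmod c).
Proof.
rewrite (tilde_post _ (add0r 0)) hat_yu; apply/esym/tilde_eq; exact: gapp_id.
Qed.

End Yoneda.

(* [Nbim q] is the bimodule Hom(X, G^(q+1) Y), whose q-th cohomology is Ext^q(X, Y) *)
Definition Nbim (q : nat) : bimod D.
Proof.
apply: (@Bimod k D (fun X Y s => ghom (mo X) (Gn q.+1 (mo Y)) s)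
  (fun X Y Y' i j l e g u => gcomp e (Gmap q.+1 (g : ghom (mo Y) (mo Y') i)) u)
  (fun X X' Y i j l e u f => gcomp e u f)).
- by move=> X Y Y' i j l e a f f' u; rewrite [LHS](congr1 (gcomp e ^~ u) (GmapZD q.+1 a _ _)) gcompDl.
- by move=> *; exact: gcompDr.
- by move=> *; exact: gcompDl.
- by move=> *; exact: gcompDr.
- by move=> X Y i e u; rewrite [LHS](congr1 (gcomp e ^~ u) (Gmap_id q.+1 _)) gcomp1m.
- by move=> *; exact: gcompm1.
- move=> X Y Y' Y'' i j l ij jl n e1 e2 e3 e4 g f u.
  rewrite [LHS](congr1 (gcomp e3 ^~ u) (Gmap_comp q.+1 e1 _ _)); exact: gcompA.
- by move=> *; exact: gcompA.
- by move=> *; exact: gcompA.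
Defined.

Definition Rmod q X : rmod D := brmod (Nbim q) X.

Section Delta.
Variables (q : nat) (X : D).

Definition delta : ghom (Rmod q X) (Rmod q.+1 X) 0.
Proof.
apply: (@mkhom k D (Rmod q X) (Rmod q.+1 X) 0
  (fun Z n m e u => gcomp (bl_eq e) (Gd q.+1 (mo X)) (u : ghom (mo Z) (Gn q.+1 (mo X)) n))).
  by move=> Z n m e a u v; exact: gcompDr.
by move=> Z Z' n m i n' m' e e' h h' u f; rewrite [RHS](gcompA (bl_eq e) h h' (bl_eq e')).
Defined.

Lemma ap_delta Z n (u : ghom (mo Z) (Gn q.+1 (mo X)) n) :
  ap delta (u : rm (Rmod q X) Z n) = gcomp (add0r n) (Gd q.+1 (mo X)) u.
Proof. by rewrite (eq_irrelevance (add0r n) (bl_eq (addr0 n))). Qed.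

End Delta.

Lemma Gd_natm n (M N : rmod C) d (f : ghom M N d) :
  gcomp (addr0 d) (Gmap n.+1 f) (Gd n M) = gcomp (add0r d) (Gd n N) (Gmap n f).
Proof.
apply: ghom_eq => X p m e x.
by rewrite (gapp_compr (addr0 d)) (gapp_compl (add0r d)) Gd_nat.
Qed.

Lemma delta_natural q : bimod_natural (delta q).
Proof.
move=> X Y i f; apply: ghom_eq => Z n m e u.
rewrite (gapp_compl (add0r i)) (gapp_compr (addr0 i)) !(blm_ev _ e (bl_eq e)).
rewrite !ap_delta -[LHS](gcompA (add0r i) _ (bl_eq e)) -[RHS](gcompA (addr0 i) _ (bl_eq e)).
by rewrite -(Gd_natm q.+1 (f : ghom (mo Y) (mo X) i)).
Qed.

Lemma delta2 q X : gcomp (addr0 0) (delta q.+1 X) (delta q X) = 0.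
Proof.
apply: ghom0_eq => Z n u.
rewrite (ap_comp (addr0 0) (delta q.+1 X) (delta q X) u).
apply: etrans (@ap_delta q.+1 X Z n (ap (delta q X) u)) _.
rewrite [in X in gcomp _ _ X](@ap_delta q X Z n u).
rewrite -(gcompA (addr0 0) (add0r n) (add0r n)).
have -> : gcomp (addr0 0) (Gd q.+2 (mo X)) (Gd q.+1 (mo X)) = 0.
  by apply: ghom0_eq => c m x; rewrite (ap_comp (addr0 0)) GdGd.
exact: gcomp0m.
Qed.

Definition Kdv s p q (phi : CH (Nbim q) p s) : CH (Nbim q.+1) p s :=
  (-1) ^+ p *: CHmap (delta q) phi.

Lemma Kdv_linear s p q : linear (@Kdv s p q).
Proof. by move=> a u v; rewrite /Kdv CHmap_linear scalerDr !scalerA mulrC. Qed.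

Lemma Kdvv s p q (phi : CH (Nbim q) p s) : Kdv (Kdv phi) = 0.
Proof.
have c0 : CHmap (delta q.+1) (CHmap (delta q) phi) = 0.
  apply: functional_extensionality_dep => X.
  by rewrite /CHmap -(ap_comp (addr0 0)) -Gmap_comp delta2 Gmap0.
by rewrite /Kdv CHmap_scale c0 !scaler0.
Qed.

Lemma Kdhv s p q (phi : CH (Nbim q) p s) :
  dCH (Nbim q.+1) p s (Kdv phi) + Kdv (dCH (Nbim q) p s phi) = 0.
Proof.
have dZ := linearZZ (dCH (Nbim q.+1) p s) ((-1) ^+ p) (CHmap (delta q) phi).
have E : dCH (Nbim q.+1) p s (Kdv phi) = (-1) ^+ p *: CHmap (delta q) (dCH (Nbim q) p s phi).
  exact: etrans dZ (congr1 _ (CHmap_d phi (@delta_natural q))).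
by rewrite E /Kdv exprS mulN1r scaleNr subrr.
Qed.

Definition K (s : int) : dcomplex k :=
  @DComplex k (fun p q => CH (Nbim q) p s) (fun p q => dCH (Nbim q) p s)
    (fun p q => lin_fun (@Kdv_linear s p q)) (fun p q => @dCH2 k D (Nbim q) p s)
    (@Kdvv s) (@Kdhv s).

(* The right module Hom(-, G^(q+1) X) is a retract of a cofree one: evaluate a
   family at the morphisms out of the representables, then at the universal
   elements. *)
Section Retraction.
Variables (q : nat) (X : D).

Definition ret_val Z n m (e : n + 0 = m) (gam : rm (cofree (Rmod q X)) Z n) (c : C) (p l : int)
    (e' : p + m = l) (x : rm (mo Z) c p) : rm (Gn q (mo X)) c l :=
  rho (gapp (cev gam (etrans (congr1 (+%R^~ p) (unc_nil_eq e)) (etrans (addrC m p) e'))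
               (hat x : hom D (yo c) Z p) : ghom (mo (yo c)) (Gn q.+1 (mo X)) l)
         (add0r l) (yu c)).

Lemma ret_valE Z n m (e : n + 0 = m) (gam : rm (cofree (Rmod q X)) Z n) (c : C) (p l : int)
    (e' : p + m = l) (e1 : n + p = l) (x : rm (mo Z) c p) :
  ret_val e gam e' x =
  rho (gapp (cev gam e1 (hat x : hom D (yo c) Z p) : ghom (mo (yo c)) (Gn q.+1 (mo X)) l)
         (add0r l) (yu c)).
Proof. by rewrite /ret_val (eq_irrelevance (etrans _ _) e1). Qed.

Lemma ret_val_linear Z n m (e : n + 0 = m) gam (c : C) (p l : int) (e' : p + m = l) :
  linear (@ret_val Z n m e gam c p l e').
Proof.
have e1 : n + p = l by rewrite -e' -e addr0 addrC.
move=> a x y; rewrite !(ret_valE _ _ _ e1) hatZD.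
by rewrite [cev _ _ _](cev_linear gam e1 a (hat x : hom D _ _ _)).
Qed.

(** The value at x is linear in x but has no reason to respect the action of C, as [gam] is only
    k-linear on morphisms. The outermost G of G^(q+1) X absorbs this through [cofr]. *)
Definition ret : ghom (cofree (Rmod q X)) (Rmod q X) 0.
Proof.
apply: (@mkhom k D (cofree (Rmod q X)) (Rmod q X) 0
  (fun Z n m e gam => cofr (ret_val e gam) (ret_val_linear e gam))).
  move=> Z n m e a u v; apply: cofr_eq => c p l e' x.
  have e1 : n + p = l by rewrite -e' -e addr0 addrC.
  rewrite (rho_cofr (ret_val_linear e (a *: u + v)) e' x).
  transitivity (a *: rho (gapp (cofr _ (ret_val_linear e u)) e' x) +
    rho (gapp (cofr _ (ret_val_linear e v)) e' x)); last by [].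
  rewrite (rho_cofr (ret_val_linear e u) e' x) (rho_cofr (ret_val_linear e v) e' x).
  by rewrite (ret_valE e u e' e1) (ret_valE e v e' e1) (ret_valE e (a *: u + v) e' e1).
move=> Z Z' n m i n' m' e e' h h' u f; apply: cofr_eq => c p l el x.
have e1 : n' + p = l by rewrite -el -e' addr0 addrC.
have e2 : p + i + m = l by rewrite -el -h' -addrA [i + m]addrC.
have e3 : n + (p + i) = l by rewrite -e2 -e addr0 addrC.
rewrite (rho_cofr (ret_val_linear e' (ract _ h u f)) el x) (ret_valE e' _ el e1).
rewrite (ract_ev h u f e1 _ (addrC i p) e3).
rewrite [X in _ = rho X](gapp_comp h' _ (f : ghom _ _ _) el erefl e2) rho_cofr (ret_valE _ _ _ e3).
have hE : comp (addrC i p) f (hat x : hom D (yo c) Z' p) =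
    hat (gapp (f : ghom (mo Z') (mo Z) i) erefl x) by exact: hat_post.
by rewrite hE.
Defined.

Lemma rho_ret Z n (gam : rm (cofree (Rmod q X)) Z n) (c : C) (p l : int)
    (e' : p + n = l) (e1 : n + p = l) (x : rm (mo Z) c p) :
  rho (gapp (ap ret gam : ghom (mo Z) (Gn q.+1 (mo X)) n) e' x) =
  rho (gapp (cev gam e1 (hat x : hom D (yo c) Z p) : ghom (mo (yo c)) (Gn q.+1 (mo X)) l)
         (add0r l) (yu c)).
Proof. by rewrite [gapp (ap ret gam) _ _]/(gapp (cofr _ _) _ _) rho_cofr (ret_valE _ _ _ e1). Qed.

Lemma ret_eta Z n (u : rm (Rmod q X) Z n) : ap ret (ap (eta _) u) = u.
Proof.
apply: cofr_eq => c p l e x; have e1 : n + p = l by rewrite addrC.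
rewrite (rho_ret _ _ e1) eta_ev [X in rho X = _](gapp_comp e1 u (hat x) _ (add0r p) e).
by rewrite hat_yu.
Qed.

End Retraction.

Lemma ret_nat q X Y i (f : hom D Y X i) :
  gcomp (add0r i) (ret q X) (cmap (blm (Nbim q) f)) = gcomp (addr0 i) (blm (Nbim q) f) (ret q Y).
Proof.
apply: ghom_eq => Z n m e gam; apply: cofr_eq => c p l e' x.
rewrite (gapp_compl (add0r i)) (gapp_compr (addr0 i)) (blm_ev f e (bl_eq e)).
have e1 : m + p = l by rewrite addrC.
have e2 : n + p + i = l by rewrite addrAC e.
rewrite (rho_ret _ _ e1) (cmap_ev _ e gam e1 erefl e2) (blm_ev f e2 (bl_eq e2)).
have e3 : p + n + i = l by rewrite [p + n]addrC.
have e4 : 0 + (n + p) = n + p by rewrite add0r.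
rewrite [X in rho X = _](gapp_comp (bl_eq e2) _ _ (add0r l) e4 e2).
rewrite [X in _ = rho X](gapp_comp (bl_eq e) _ _ e' (addrC p n) e2).
by rewrite !(rho_cmap (Gmap q (f : ghom (mo Y) (mo X) i))) (rho_ret _ _ erefl) (eq_irrelevance e4 (add0r _)).
Qed.

Lemma K_exact s : dh_exact (K s).
Proof.
by move=> p q a da; apply: (CH_contr_exact (@ret_eta q) (@ret_nat q)).
Qed.

End Main.

(** * The Hochschild complex of C as the augmentation of the double complex *)

Section Augment.
Variables (k : fieldType) (C : gcat k) (modC : fp_model C) (s : int).

Let D := mod_cat modC.
Notation mo := (@fp_mod k C modC).
Notation dC := (diag_bimod C).

Section Iota.
Variable q : nat.
Implicit Types phi : CH dC q s.

(** The sign is multiplicative in the degree of x, which makes it match the sign of [dCH_at] when x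
    is moved by a morphism of mod(C). *)
Definition iota_val phi (X : D) (c : C) n m (e : n + s = m) (x : rm (mo X) c n) :
    rm (Gn q (mo X)) c m :=
  ksign k s n *: gapp (Gmap q (tilde x)) (bl_eq e) (phi c : rm (Gn q (hmod c)) c s).

Lemma iota_val_linear phi X c n m (e : n + s = m) : linear (@iota_val phi X c n m e).
Proof. by move=> a x y; rewrite /iota_val tildeZD GmapZD gappZD scalerDr !scalerA mulrC. Qed.

Definition iota_at phi (X : D) : ghom (mo X) (Gn q.+1 (mo X)) s :=
  cofr (@iota_val phi X) (@iota_val_linear phi X).

Lemma rho_iota phi X c n m (e : n + s = m) (e' : s + n = m) (x : rm (mo X) c n) :
  rho (M := Gn q (mo X)) (gapp (iota_at phi X) e x) =
  ksign k s n *: gapp (Gmap q (tilde x)) e' (phi c : rm (Gn q (hmod c)) c s).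
Proof. by rewrite /iota_at rho_cofr /iota_val (eq_irrelevance (bl_eq e) e'). Qed.

Definition iota_fun phi : CH (Nbim modC q) 0 s := iota_at phi.

Lemma iota_linear : linear iota_fun.
Proof.
move=> a phi psi; apply: functional_extensionality_dep => X; rewrite dprodZDE.
apply: cofr_eq => c n m e x; rewrite gappZD [RHS]rho_linear !(rho_iota _ _ (bl_eq e)).
by rewrite dprodZDE gapp_linear scalerDr !scalerA mulrC.
Qed.

Lemma Gmap_hat_tilde c (z : rm (Gn q (hmod c)) c s) :
  ap (Gmap q (hat modC (idm c : rm (hmod c) c 0))) (gapp (Gmap q (tilde (yu modC c))) (addr0 s) z) = z.
Proof.
rewrite -/(ap _ _) -(ap_comp (addr0 0)) -Gmap_comp hat_tilde Gmap_id.
exact: gapp_id.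
Qed.

(** The value at the universal element, where the degree is 0 and the sign is 1, gives back phi c
    through [Gmap_hat_tilde]. *)
Lemma iota_inj phi : iota_fun phi = 0 -> phi = 0.
Proof.
move=> i0; apply: functional_extensionality_dep => c.
rewrite -[LHS](Gmap_hat_tilde (phi c : rm (Gn q (hmod c)) c s)).
have := rho_iota phi (add0r s) (addr0 s) (yu modC c).
have -> : iota_at phi (yo modC c) = 0 by rewrite -[iota_at _ _]/(iota_fun phi (yo modC c)) i0.
rewrite /ksign mulr0 expr0 scale1r => <-; exact: gapp_zero.
Qed.

Lemma iota_cocycle phi : dCH (Nbim modC q) 0 s (iota_fun phi) = 0.
Proof.
apply: functional_extensionality_dep => X; apply: (@cev_eq _ _ (Rmod q X)) => Y j l e f.
rewrite [LHS](dCHE (M := Nbim modC q) (n := 0)) eta_ev; apply/eqP; rewrite subr_eq0; apply/eqP.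
rewrite (blm_ev f e (bl_eq e)); apply: cofr_eq => c n m em x.
have e1 : n + s + j = m by rewrite -em -e addrA.
have e2 : n + j + s = m by rewrite addrAC.
have e3 : s + (n + j) = m by rewrite [s + _]addrC.
rewrite gapp_scalel [X in rho (_ *: X)](gapp_comp (bl_eq e) (Gmap q.+1 (f : ghom (mo Y) (mo X) j)) _ _ erefl e1).
rewrite [X in _ = rho X](gapp_comp e _ (f : ghom (mo Y) (mo X) j) _ erefl e2).
rewrite -[LHS]/(_ *: rho _) (rho_cmap (Gmap q (f : ghom (mo Y) (mo X) j))).
rewrite (rho_iota phi erefl (addrC s n)) (rho_iota phi e2 e3) gapp_scale scalerA mulrC -ksignD.
congr (_ *: _); rewrite -(gapp_comp (addrC j n) _ _ e3) -Gmap_comp.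
by rewrite (tilde_post (addrC j n) erefl).
Qed.

(** A cocycle of degree 0 is a family natural up to sign, so it is determined by its values at the
    universal elements; these are brought from [mo (yo c)] to h_c to define phi. *)
Lemma iota_onto (psi : CH (Nbim modC q) 0 s) : dCH (Nbim modC q) 0 s psi = 0 -> exists phi, psi = iota_fun phi.
Proof.
move=> d0.
pose psi_ (X : D) : ghom (mo X) (Gn q.+1 (mo X)) s := psi X.
pose phi : CH dC q s := fun c =>
  ap (Gmap q (hat modC (idm c : rm (hmod c) c 0)))
     (rho (M := Gn q (mo (yo modC c))) (gapp (psi_ (yo modC c)) (add0r s) (yu modC c))).
exists phi; apply: functional_extensionality_dep => X; apply: cofr_eq => c n m e x.
have e1 : s + n = m by rewrite addrC.
rewrite (rho_iota _ _ e1) /phi -(gapp_compr (addr0 n)) -Gmap_comp tilde_hat.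
pose f : hom D (yo modC c) X n := hat modC x.
(* The cocycle condition at [hat x], which carries the universal element to x. *)
have := congr1 (fun z : CH (Nbim modC q) 1 s => cev (M := Rmod q X) (z X) e1 f) d0.
rewrite [LHS](dCHE (M := Nbim modC q) (n := 0)) eta_ev dprod0E cev0 => /eqP; rewrite subr_eq0 => /eqP.
rewrite (blm_ev f e1 e) => E.
have := congr1 (fun g : ghom (mo (yo modC c)) (Gn q.+1 (mo X)) m =>
  rho (M := Gn q (mo X)) (gapp g (add0r m) (yu modC c))) E.
rewrite gapp_scalel -[LHS]/(_ *: rho _).
rewrite [X in rho X](gapp_comp e (Gmap q.+1 (hat modC x)) _ _ (add0r s) e1).
rewrite (rho_cmap (Gmap q (hat modC x))) => ->.
by rewrite [X in _ = rho X](gapp_comp e1 (psi_ X) (hat modC x) _ (add0r n) e) hat_yu.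
Qed.

End Iota.

(** In d_(q+1) = eta - G(d_q), the unit evaluates the family at x.g and yields the left action term,
    because [tilde] turns the action into composition ([tilde_ract]). G(d_q) yields the other
    terms. *)
Lemma iota_dv q (phi : CH dC q s) : Kdv (iota_fun phi) = iota_fun (dCH dC q s phi).
Proof.
apply: functional_extensionality_dep => X.
rewrite -[LHS]/((-1) ^+ 0 *: ap (delta q X) (iota_fun phi X)) expr0 scale1r.
rewrite (ap_delta (iota_at phi X)) -[RHS]/(iota_at (dCH dC q s phi) X).
apply: (@cofr_eq _ _ _ (Gn q.+1 (mo X))) => c n m e x.
have e1 : s + n = m by rewrite addrC.
rewrite (rho_iota _ _ e1) (gapp_compl (add0r s)) rho_Gd (rho_iota _ _ e1).
apply: (@cev_eq _ _ (Gn q (mo X))) => Y j l el g; rewrite cevB cevZ.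
have e2 : n + j + s = l by rewrite -el -e addrAC.
have e3 : s + (n + j) = l by rewrite [s + _]addrC.
have e4 : s + j + n = l by rewrite -el -e1 addrAC.
rewrite -rho_ract -(gapp_ract (iota_at phi X) e e2 erefl) (rho_iota _ _ e3).
rewrite (cmap_ev (Gmap q (tilde x)) e1 (dCH dC q s phi c) el erefl e4) dCHE.
rewrite gapp_sub gapp_scale scalerBr scalerA -ksignD; congr (_ - _).
  rewrite -(gapp_comp erefl _ _ e3) -Gmap_comp.
  by rewrite (tilde_ract erefl).
rewrite /ap gapp_scale -/(ap _ _) cevZ; congr (_ *: _).
rewrite -(Gd_nat (n := q) (tilde x) e1).
by rewrite (cmap_ev (Gmap q (tilde x)) e1 _ el erefl e4).
Qed.

Definition K_aug : augmentation (K modC s).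
Proof.
apply: (@Augmentation k (K modC s) (fun q => CH dC q s) (fun q => dCH dC q s)
  (fun q => lin_fun (@iota_linear q))).
- by move=> q w; exact: iota_inj.
- move=> q a; split=> [/iota_onto //|[w ->]]; exact: iota_cocycle.
- by move=> q w; exact: iota_dv.
Defined.

End Augment.

(** * Balancing the two augmentations of a double complex *)

Section Balance.
Variables (k : fieldType) (A : dcomplex k).
Notation AT := (transpose A).

Definition flip (x : tot AT) : tot A := fun i => x (i.2, i.1).
Definition unflip (x : tot A) : tot AT := fun i => x (i.2, i.1).

Lemma unflipK x : flip (unflip x) = x.
Proof. by apply: functional_extensionality_dep => -[]. Qed.

Lemma flipB x y : flip (x - y) = flip x - flip y.
Proof. by []. Qed.

Lemma flip_totd x : flip (totd AT x) = totd A (flip x).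
Proof.
apply: functional_extensionality_dep => -[p q].
by rewrite -[LHS]/(totd AT x (q, p)) !totdE addrC; case: p; case: q.
Qed.

Lemma unflip_totd x : unflip (totd A x) = totd AT (unflip x).
Proof.
apply: functional_extensionality_dep => -[p q].
by rewrite -[LHS]/(totd A x (q, p)) !totdE addrC; case: p; case: q.
Qed.

Lemma unflip_inj p q (a : A p q) : unflip (tot_inj a) = @tot_inj k AT q p a.
Proof.
apply: functional_extensionality_dep => -[i j].
have [[-> ->]|/eqP ne] := (i, j) =P (q, p).
  by rewrite -[LHS]/(tot_inj a (p, q)) tot_injE [RHS](@tot_injE k AT).
rewrite -[LHS]/(tot_inj a (j, i)) tot_inj0 ?[RHS](@tot_inj0 k AT) //.
by apply: contraNneq ne => -[-> ->].
Qed.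

Lemma flip_inj p q (a : A p q) : flip (@tot_inj k AT q p a) = tot_inj a.
Proof. by rewrite -unflip_inj unflipK. Qed.

Lemma flip_homog n x : homog AT n x -> homog A n (flip x).
Proof. by move=> xn p q pq; apply: xn; rewrite addnC. Qed.

Lemma unflip_homog n x : homog A n x -> homog AT n (unflip x).
Proof. by move=> xn p q pq; apply: xn; rewrite addnC. Qed.

Variables (W : augmentation A) (V : augmentation AT).
Hypotheses (Aex : dh_exact A) (ATex : dh_exact AT).

Definition aug_col n (v : V n) : A n 0 := aug_i V v.

(** The images of w and v under the two augmentations are cohomologous in the total complex. *)
Definition balanced n (w : W n) (v : V n) : Prop := exists y : tot A,
  homog A (n%:Z - 1) y /\ tot_inj (aug_i W w) - tot_inj (aug_col v) = totd A y.

Lemma balanced_linear n (a : k) (w w' : W n) (v v' : V n) :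
  balanced w v -> balanced w' v' -> balanced (a *: w + w') (a *: v + v').
Proof.
move=> [y [yn yE]] [y' [yn' yE']]; exists (a *: y + y'); split; first exact: in_subZD.
rewrite [totd A _]linearP -yE -yE' [aug_i _ _]linearP /aug_col [aug_i V _]linearP !tot_inj_linear.
by rewrite scalerBr opprD addrACA.
Qed.

Lemma aug_cycle n (w : W n) : aug_d W w = 0 -> totd A (tot_inj (aug_i W w)) = 0.
Proof.
move=> w0; rewrite totd_inj aug_comm w0 linear0 tot_inj00 addr0.
by rewrite ((aug_ker W _).2 _) ?tot_inj00 //; exists w.
Qed.

(** This is [tot_cycle_aug] for the transposed complex, which pushes the cycle to the opposite
    edge. *)
Lemma balanced_exists n (w : W n) : aug_d W w = 0 ->
  exists v : V n, aug_d V v = 0 /\ balanced w v.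
Proof.
move=> w0; have xn : homog AT n%:Z (unflip (tot_inj (aug_i W w))).
  by apply: unflip_homog; exact: tot_inj_homog.
have [|v [v0 [y [yn yE]]]] := tot_cycle_aug ATex V xn.
  by rewrite -unflip_totd aug_cycle.
exists v; split=> //; exists (flip y); split; first exact: flip_homog.
rewrite -flip_totd -(flip_inj (aug_col v)) -yE flipB unflipK opprB addrC subrK.
by [].
Qed.

Lemma balanced_exists_row n (v : V n) : aug_d V v = 0 ->
  exists w : W n, aug_d W w = 0 /\ balanced w v.
Proof.
move=> v0; have xn : homog A n%:Z (tot_inj (aug_col v)).
  by apply: tot_inj_homog; rewrite addn0.
have dx : totd A (tot_inj (aug_col v)) = 0.
  rewrite -flip_inj -flip_totd totd_inj aug_comm v0 linear0 tot_inj00 addr0.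
  by rewrite ((aug_ker V _).2 _) ?tot_inj00 //; exists v.
have [w [w0 [y [yn yE]]]] := tot_cycle_aug Aex W xn dx.
exists w; split=> //; exists (- y); split; first by have := in_subB (in_sub0 _) yn; rewrite sub0r.
by rewrite -yE linearN addrAC subrr add0r.
Qed.

Lemma balanced_bound n (w : W n) (v : V n) : balanced w v ->
  aug_bound W n w <-> aug_bound V n v.
Proof.
move=> [y [yn yE]]; rewrite -(tot_bound_aug Aex) -(tot_bound_aug ATex).
split=> -[z [zn zE]].
  exists (unflip (z - y)); split; first exact/unflip_homog/in_subB.
  by rewrite -unflip_totd linearB -zE -yE opprB addrC subrK unflip_inj.
exists (flip z + y); split; first exact/in_subD/yn/flip_homog.
by rewrite linearD -flip_totd -zE -yE (flip_inj (aug_col v)) addrC subrK.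
Qed.

End Balance.

(** * Ext from the cofree resolution *)

Section ExtComparison.
Variables (k : fieldType) (C : gcat k).

Definition postcomp (L M N : rmod C) s (f : ghom M N 0) (u : ghom L M s) : ghom L N s :=
  gcomp (add0r s) f u.

Lemma postcomp_linear (L M N : rmod C) s (f : ghom M N 0) : linear (@postcomp L M N s f).
Proof. by move=> a u v; exact: gcompDr. Qed.

HB.instance Definition _ (L M N : rmod C) s (f : ghom M N 0) :=
  GRing.isLinear.Build k (ghom L M s) (ghom L N s) *:%R (postcomp f) (@postcomp_linear L M N s f).

Lemma postcomp_scale (L M N : rmod C) s (f : ghom M N 0) a (u : ghom L M s) :
  postcomp f (a *: u) = a *: postcomp f u.
Proof. exact: linearZZ. Qed.

Lemma precomp_scale (L M N : rmod C) s (f : ghom L M 0) a (u : ghom M N s) :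
  precomp f (a *: u) = a *: precomp f u.
Proof. exact: linearZZ. Qed.

(* Cofree modules are injective, as every k-linear map extends *)
Lemma cofree_extend (L M N Q : rmod C) s (f : ghom L M 0) (g : ghom M N 0) (a : ghom M (cofree Q) s) :
  gexact f g -> precomp f a = 0 -> exists b : ghom N (cofree Q) s, a = precomp g b.
Proof.
move=> /gexact_ap fg af.
pose t Y n := sval (cid (ap_pseudo_inverse g Y n)).
have tl Y n : linear (@t Y n) := (svalP (cid (ap_pseudo_inverse g Y n))).1.
have tP Y n := (svalP (cid (ap_pseudo_inverse g Y n))).2.
(* The family extends rho a along a k-linear pseudo-inverse t of g. The choice of t is harmless: x -
   t(g x) is in ker g = im f, where a vanishes. *)
pose w Y n m (e : n + s = m) (x : rm N Y n) := rho (gapp a e (t Y n x)).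
have wl Y n m (e : n + s = m) : linear (w Y n m e).
  by move=> c x y; rewrite /w tl gapp_linear.
exists (cofr w wl); apply: cofr_eq => Y n m e x.
rewrite (gapp_compr (addr0 s)) rho_cofr /w; apply/eqP; rewrite -subr_eq0.
rewrite -[X in X == 0]/(rho (gapp a e x - gapp a e (t Y n (ap g x)))) -gapp_sub.
have /fg[y ->] : ap g (x - t Y n (ap g x)) = 0 by rewrite /ap gapp_sub -!/(ap _ _) tP subrr.
by rewrite -(gapp_compr (addr0 s)) -/(precomp f a) af.
Qed.

Lemma precomp_surj_inj (L M N : rmod C) s (f : ghom L M 0) (a : ghom M N s) :
  gsurj f -> precomp f a = 0 -> a = 0.
Proof.
move=> /gsurj_ap fs af; apply: ghom_eq => Y n m e x; have [y ->] := fs _ _ x.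
by rewrite -(gapp_compr (addr0 s)) -/(precomp f a) af.
Qed.

Lemma postcomp_eta_inj (L N : rmod C) s (a : ghom L N s) : postcomp (eta N) a = 0 -> a = 0.
Proof.
move=> a0; apply: ghom_eq => Y n m e x; rewrite -[LHS]rho_eta -(gapp_compl (add0r s)).
by rewrite -/(postcomp (eta N) a) a0.
Qed.

Section Complex.
Variables (M : rmod C) (P : resolution M) (N : rmod C) (s : int).

Definition hom_cx (i j : nat) : lmodType k := ghom (P i) (Gn j.+1 N) s.

Definition hom_dv i j (u : hom_cx i j) : hom_cx i j.+1 := (-1) ^+ i *: postcomp (Gd j.+1 N) u.

Lemma hom_dv_linear i j : linear (@hom_dv i j).
Proof. by move=> a u v; rewrite /hom_dv postcomp_linear scalerDr !scalerA mulrC. Qed.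

Lemma hom_dhh i j (u : hom_cx i j) : precomp (res_d P i.+1) (precomp (res_d P i) u) = 0.
Proof.
rewrite /precomp (gcompA _ (add0r 0) _ (addr0 s)).
by rewrite (gexact_comp0 (add0r 0) (@res_exact k C M P i)) gcompm0.
Qed.

Lemma hom_dvv i j (u : hom_cx i j) : hom_dv (hom_dv u) = 0.
Proof.
rewrite /hom_dv postcomp_scale; suff -> : postcomp (Gd j.+2 N) (postcomp (Gd j.+1 N) u) = 0.
  by rewrite !scaler0.
rewrite /postcomp -(gcompA (addr0 0) _ (add0r s)).
by rewrite (gexact_comp0 (addr0 0) (@Gd_exact k C j.+1 N)) gcomp0m.
Qed.

Lemma hom_dhv i j (u : hom_cx i j) :
  precomp (res_d P i) (hom_dv u) + hom_dv (precomp (res_d P i) u) = 0.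
Proof.
rewrite /hom_dv precomp_scale exprS mulN1r scaleNr /precomp /postcomp.
by rewrite (gcompA _ (addr0 s) (addr0 s) (add0r s)) subrr.
Qed.

Definition hom_dc : dcomplex k :=
  @DComplex k hom_cx (fun i j => precomp (res_d P i)) (fun i j => lin_fun (@hom_dv_linear i j))
    hom_dhh hom_dvv hom_dhv.

(** Injectivity of cofree modules, applied to the augmented projective resolution of M. *)
Definition hom_dc_row : augmentation hom_dc.
Proof.
apply: (@Augmentation k hom_dc (fun j => ghom M (Gn j.+1 N) s) (fun j => postcomp (Gd j.+1 N))
  (fun j => precomp (res_aug P))).
- by move=> j w; exact/precomp_surj_inj/res_surj.
- move=> j a; split=> [|[w ->]]; first exact/cofree_extend/res_exact0.
  rewrite -[LHS]/(precomp (res_d P 0) (precomp (res_aug P) w)).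
  rewrite /precomp (gcompA _ (add0r 0) _ (addr0 s)).
  by rewrite (gexact_comp0 (add0r 0) (@res_exact0 k C M P)) gcompm0.
- move=> j w; rewrite -[LHS]/((-1) ^+ 0 *: postcomp (Gd j.+1 N) (precomp (res_aug P) w)).
  by rewrite expr0 scale1r; exact/esym/(gcompA (add0r s) (addr0 s) (addr0 s) (add0r s)).
Defined.

Lemma hom_dc_exact : dh_exact hom_dc.
Proof. by move=> i j a; exact/cofree_extend/res_exact. Qed.

Lemma hom_dv_ker i j (u : hom_cx i j) : hom_dv u = 0 <-> postcomp (Gd j.+1 N) u = 0.
Proof.
rewrite /hom_dv; split=> [/(congr1 ( *:%R ((-1) ^+ i)))|->]; last exact: scaler0.
by rewrite scalerA -expr2 sqrr_sign scale1r scaler0.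
Qed.

(** Projectivity of P_i, applied to the cofree resolution of N. *)
Definition hom_dc_col : augmentation (transpose hom_dc).
Proof.
apply: (@Augmentation k (transpose hom_dc) (fun i => ghom (P i) N s) (fun i => precomp (res_d P i))
  (fun i => postcomp (eta N))).
- by move=> i z; exact: postcomp_eta_inj.
- move=> i a; split=> [/hom_dv_ker a0|[z ->]].
    have [z <-] := proj_lift (@res_proj k C M P i) (@Gd_exact k C 0 N) a0.
    by exists z.
  apply/hom_dv_ker; rewrite /postcomp -(gcompA (addr0 0) _ (add0r s)).
  by rewrite (gexact_comp0 (addr0 0) (@Gd_exact k C 0 N)) gcomp0m.
- move=> i z; rewrite -[LHS]/(precomp (res_d P i) (postcomp (eta N) z)).
  exact: (gcompA (add0r s) (addr0 s) (addr0 s) (add0r s)).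
Defined.

Lemma hom_dc_exactT : dh_exact (transpose hom_dc).
Proof.
move=> j i a /hom_dv_ker a0.
have [b bE] := proj_lift (@res_proj k C M P i) (@Gd_exact k C j.+1 N) a0.
exists ((-1) ^+ i *: b); rewrite -[RHS]/((-1) ^+ i *: postcomp (Gd j.+1 N) ((-1) ^+ i *: b)).
by rewrite postcomp_scale scalerA -expr2 sqrr_sign scale1r -bE.
Qed.

(* [w] in Hom(M, G^(q+1) N) and [z] in Hom(P_q, N) represent the same element of Ext^q(M, N) *)
Definition ext_match q (w : ghom M (Gn q.+1 N) s) (z : ghom (P q) N s) : Prop :=
  @balanced k hom_dc hom_dc_row hom_dc_col q w z.

End Complex.

Arguments ext_match {M} P {N s q} w z.

Lemma map_tot_inj (A B : dcomplex k) (f : forall p q, A p q -> B p q) p q (a : A p q) i j :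
  (forall p q, f p q 0 = 0) -> tot_inj (f p q a) (i, j) = f i j (tot_inj a (i, j)).
Proof.
move=> f0; have [[-> ->]|/eqP ne] := (i, j) =P (p, q); first by rewrite !tot_injE.
by rewrite !tot_inj0.
Qed.

Lemma balanced_map (A B : dcomplex k) (W : augmentation A) (V : augmentation (transpose A))
    (W' : augmentation B) (V' : augmentation (transpose B)) (f : forall p q, A p q -> B p q)
    n (w : W n) (v : V n) (w' : W' n) (v' : V' n) :
  (forall p q, linear (f p q)) ->
  (forall p q (a : A p q), f p.+1 q (dh a) = dh (f p q a)) ->
  (forall p q (a : A p q), f p q.+1 (dv a) = dv (f p q a)) ->
  f 0 n (aug_i W w) = aug_i W' w' -> f n 0 (aug_col v) = aug_col v' ->
  balanced w v -> balanced w' v'.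
Proof.
move=> fl fh fv fw fv' [y [yn yE]].
have f0 p q : f p q 0 = 0 by exact: (linear0 (lin_fun (fl p q))).
have fB p q a b : f p q (a - b) = f p q a - f p q b by exact: (linearB (lin_fun (fl p q))).
have fD p q a b : f p q (a + b) = f p q a + f p q b by exact: (linearD (lin_fun (fl p q))).
exists (fun c => f c.1 c.2 (y c)); split.
  by move=> p q pq /=; rewrite yn ?f0.
apply: functional_extensionality_dep => -[i j]; rewrite tot_subE totdE.
rewrite -fw -fv' !map_tot_inj // -fB -[X in f i j X]/((tot_inj _ - tot_inj _) (i, j)) yE totdE fD.
by congr (_ + _); [case: i | case: j] => /=; rewrite ?f0 // => m; rewrite ?fh ?fv.
Qed.

End ExtComparison.

Arguments ext_match {k C M} P {N s q} w z.

(** * The comparison with Ext and its compatibility with both actions *)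

Section Match.
Variables (k : fieldType) (C : gcat k).

Lemma ext_match_post M (P : resolution M) (N N' : rmod C) q i s l (e : i + s = l)
    (g : ghom N N' i) (w : ghom M (Gn q.+1 N) s) (z : ghom (P q) N s) :
  ext_match P w z -> ext_match P (gcomp e (Gmap q.+1 g) w) (gcomp e g z).
Proof.
apply: (@balanced_map k (hom_dc P N s) (hom_dc P N' l) (hom_dc_row P N s) (hom_dc_col P N s) (hom_dc_row P N' l) (hom_dc_col P N' l)
  (fun a b (u : ghom (P a) (Gn b.+1 N) s) => gcomp e (Gmap b.+1 g) u)).
- by move=> a b c u v; exact: gcompDr.
- by move=> a b u; exact/esym/(gcompA e (addr0 s) (addr0 l) e).
- move=> a b u; rewrite -[RHS]/((-1) ^+ a *: gcomp (add0r l) (Gd b.+1 N') (gcomp e (Gmap b.+1 g) u)).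
  rewrite -[LHS]/(gcomp e (Gmap b.+2 g) ((-1) ^+ a *: gcomp (add0r s) (Gd b.+1 N) u)).
  rewrite -[(-1) ^+ a *: gcomp (add0r s) _ _]addr0 gcompDr gcompm0 addr0; congr (_ *: _).
  rewrite -(gcompA (addr0 i) _ e) -(gcompA (add0r i) _ e).
  by rewrite (Gd_natm b.+1 g).
- exact/esym/(gcompA e (addr0 s) (addr0 l) e).
- rewrite -[LHS]/(gcomp e (Gmap 1 g) (gcomp (add0r s) (eta N) z)).
  rewrite -[RHS]/(gcomp (add0r l) (eta N') (gcomp e g z)).
  rewrite -(gcompA (addr0 i) _ e) -(gcompA (add0r i) _ e).
  by rewrite -[eta N]/(Gd 0 N) (Gd_natm 0 g).
Qed.

(** A lift commutes strictly with the differentials, so composing with it is a map of double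
    complexes, whatever lift is chosen. *)
Lemma ext_match_pre M M' (P : resolution M) (P' : resolution M') (N : rmod C) q s j l (e : s + j = l)
    (f : ghom M' M j) phi (w : ghom M (Gn q.+1 N) s) (z : ghom (P q) N s) :
  is_lift (P' := P') (P := P) f phi -> ext_match P w z -> ext_match P' (gcomp e w f) (gcomp e z (phi q)).
Proof.
move=> [phi0 phiS].
apply: (@balanced_map k (hom_dc P N s) (hom_dc P' N l) (hom_dc_row P N s) (hom_dc_col P N s) (hom_dc_row P' N l) (hom_dc_col P' N l)
  (fun a b (u : ghom (P a) (Gn b.+1 N) s) => gcomp e u (phi a))).
- by move=> a b c u v; exact: gcompDl.
- move=> a b u; rewrite -[RHS]/(gcomp (addr0 l) (gcomp e u (phi a)) (res_d P' a)).
  rewrite -[LHS]/(gcomp e (gcomp (addr0 s) u (res_d P a)) (phi a.+1)).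
  by rewrite (gcompA _ (add0r j) _ e) phiS (gcompA _ (addr0 j) _ e).
- move=> a b u; rewrite -[RHS]/((-1) ^+ a *: gcomp (add0r l) (Gd b.+1 N) (gcomp e u (phi a))).
  rewrite -[LHS]/(gcomp e ((-1) ^+ a *: gcomp (add0r s) (Gd b.+1 N) u) (phi a)).
  rewrite -[(-1) ^+ a *: gcomp (add0r s) _ _]addr0 gcompDl gcomp0m addr0; congr (_ *: _).
  by rewrite (gcompA _ e _ (add0r l)).
- rewrite -[LHS]/(gcomp e (gcomp (addr0 s) w (res_aug P)) (phi 0)).
  rewrite -[RHS]/(gcomp (addr0 l) (gcomp e w f) (res_aug P')).
  by rewrite (gcompA _ (add0r j) _ e) phi0 (gcompA _ (addr0 j) _ e).
- exact: (gcompA (add0r s) e e (add0r l)).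
Qed.

Definition postcomp_bound (M N : rmod C) q s (w : ghom M (Gn q.+1 N) s) : Prop :=
  match q return ghom M (Gn q.+1 N) s -> Prop with
  | 0 => fun w => w = 0
  | q'.+1 => fun w => exists w', w = postcomp (Gd q'.+1 N) w' end w.

Lemma ext_match_bound M (P : resolution M) (N : rmod C) q s
    (w : ghom M (Gn q.+1 N) s) (z : ghom (P q) N s) :
  ext_match P w z -> postcomp_bound w <-> ext_cobound P N q s z.
Proof.
move=> /(balanced_bound (@hom_dc_exact k C M P N s) (@hom_dc_exactT k C M P N s)).
by case: q w z.
Qed.

Section ExtClass.
Variables (M : rmod C) (P : resolution M) (N : rmod C) (q : nat) (s : int).

Definition Zsub : subspace (ghom M (Gn q.+1 N) s) := ker_sub (postcomp (Gd q.+1 N)).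

Definition ext_rel (w : ghom M (Gn q.+1 N) s) (u : Ext P N q s) : Prop :=
  exists z, [/\ ext_cocycle P N q s z, ext_match P w z & u = ecls z].

Lemma ext_rel_linear (a : k) w w' u u' :
  ext_rel w u -> ext_rel w' u' -> ext_rel (a *: w + w') (a *: u + u').
Proof.
move=> [z [Zz wz ->]] [z' [Zz' wz' ->]]; exists (a *: z + z').
by split; [exact: in_subZD | exact: balanced_linear | rewrite eclsZD].
Qed.

Lemma ext_rel_total w : Zsub w -> exists u, ext_rel w u.
Proof.
move=> Zw.
have [z [z0 wz]] := balanced_exists (hom_dc_col P N s) (@hom_dc_exactT k C M P N s) (W := hom_dc_row P N s) Zw.
by exists (ecls z), z.
Qed.

Lemma ext_rel_onto u : exists w, Zsub w /\ ext_rel w u.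
Proof.
have [z [Zz ->]] := ecls_surj u.
have [w [w0 wz]] := balanced_exists_row (hom_dc_row P N s) (@hom_dc_exact k C M P N s) (V := hom_dc_col P N s) Zz.
by exists w; split=> //; exists z.
Qed.

Lemma ext_rel0 w u : ext_rel w u -> u = 0 <-> postcomp_bound w.
Proof. by move=> [z [Zz /ext_match_bound wz ->]]; rewrite wz; exact: cls0P. Qed.

Lemma postcomp_bound0 : postcomp_bound (0 : ghom M (Gn q.+1 N) s).
Proof. by case: q => //= n; exists 0; rewrite linear0. Qed.

Lemma ext_rel_fun w u u' : ext_rel w u -> ext_rel w u' -> u = u'.
Proof.
move=> wu wu'; have := ext_rel_linear (-1) wu' wu; rewrite !scaleN1r addNr addrC.
by move=> /ext_rel0[_ /(_ postcomp_bound0)] /eqP; rewrite subr_eq0 => /eqP.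
Qed.

Lemma chi_ex : exists f : ghom M (Gn q.+1 N) s -> Ext P N q s,
  (forall w, Zsub w -> ext_rel w (f w)) /\
  (forall (a : k) w w', Zsub w -> Zsub w' -> f (a *: w + w') = a *: f w + f w').
Proof.
apply: (corr_fun ext_rel_linear ext_rel_total) => w u _ wu w0.
by apply/(ext_rel0 wu); rewrite w0; exact: postcomp_bound0.
Qed.

(** The class in Ext of a cocycle of Hom(M, G^(q+1) N). On cocycles it does not depend on the
    choice, by [ext_rel_fun]. *)
Definition chi_at w : Ext P N q s := sval (cid chi_ex) w.

Lemma chi_rel w : Zsub w -> ext_rel w (chi_at w).
Proof. exact: (svalP (cid chi_ex)).1. Qed.

Lemma chiZD (a : k) w w' : Zsub w -> Zsub w' -> chi_at (a *: w + w') = a *: chi_at w + chi_at w'.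
Proof. exact: (svalP (cid chi_ex)).2. Qed.

Lemma chi0 w : Zsub w -> chi_at w = 0 <-> postcomp_bound w.
Proof. by move=> /chi_rel; exact: ext_rel0. Qed.

Lemma chi_onto u : exists w, Zsub w /\ chi_at w = u.
Proof.
have [w [Zw wu]] := ext_rel_onto u; exists w; split=> //.
exact: ext_rel_fun (chi_rel Zw) wu.
Qed.

End ExtClass.

Lemma Zsub_post M (N N' : rmod C) q i s l (e : i + s = l) (g : ghom N N' i)
    (w : ghom M (Gn q.+1 N) s) : Zsub M N q s w -> Zsub M N' q l (gcomp e (Gmap q.+1 g) w).
Proof.
rewrite /Zsub /= => w0.
rewrite /postcomp -(gcompA (add0r i) _ e) -(Gd_natm q.+1 g) (gcompA _ (add0r s) _ e).
by rewrite -/(postcomp _ w) w0 gcompm0.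
Qed.

Lemma Zsub_pre M M' (N : rmod C) q s j l (e : s + j = l) (f : ghom M' M j)
    (w : ghom M (Gn q.+1 N) s) : Zsub M N q s w -> Zsub M' N q l (gcomp e w f).
Proof.
rewrite /Zsub /= => w0.
by rewrite /postcomp -(gcompA (add0r s) _ e) -/(postcomp _ w) w0 gcomp0m.
Qed.

Lemma chi_post M (P : resolution M) (N N' : rmod C) q i s l (e : i + s = l)
    (g : ghom N N' i) (w : ghom M (Gn q.+1 N) s) : Zsub M N q s w ->
  chi_at P (gcomp e (Gmap q.+1 g) w) = ext_l e g (chi_at P w).
Proof.
move=> Zw; have [z [Zz wz ->]] := chi_rel P Zw.
apply: ext_rel_fun (chi_rel P (Zsub_post e g Zw)) _.
rewrite ext_lE //; exists (gcomp e g z); split=> //; first exact: cocycle_post.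
exact: ext_match_post.
Qed.

Lemma chi_pre M M' (P : resolution M) (P' : resolution M') (N : rmod C) q s j l (e : s + j = l)
    (f : ghom M' M j) (w : ghom M (Gn q.+1 N) s) : Zsub M N q s w ->
  chi_at P' (gcomp e w f) = ext_r P' e (chi_at P w) f.
Proof.
move=> Zw; have [z [Zz wz ->]] := chi_rel P Zw.
have [phi phiL] := lift_exists P' P f.
apply: ext_rel_fun (chi_rel P' (Zsub_pre e f Zw)) _.
rewrite (ext_rE _ phiL) //; exists (gcomp e z (phi q)); split=> //.
  exact: cocycle_lift phiL _.
exact: ext_match_pre.
Qed.

Section DegreeZero.
Variables (M N : rmod C) (f : forall X n, rm M X n -> rm N X n).
Hypotheses (fl : forall X n, linear (@f X n))
  (fa : forall X Y i j l (e : i + j = l) (x : rm M X i) (g : hom C Y X j),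
     f (ract M e x g) = ract N e (f x) g).

Definition hom0_fun X n m (e : n + 0 = m) (x : rm M X n) : rm N X m :=
  ecast z (rm N X z) (unc_nil_eq e) (f x).

Lemma hom0_linear X n m (e : n + 0 = m) : linear (@hom0_fun X n m e).
Proof. by rewrite /hom0_fun; move: (unc_nil_eq e) => e'; case: m / e' e => _; exact: fl. Qed.

Lemma hom0_ract X Y (n m i n' m' : int) (e : n + 0 = m) (e' : n' + 0 = m')
  (h : n + i = n') (h' : m + i = m') (x : rm M X n) (g : hom C Y X i) :
  hom0_fun e' (ract M h x g) = ract N h' (hom0_fun e x) g.
Proof.
rewrite /hom0_fun; move: (unc_nil_eq e) (unc_nil_eq e') => {e e'} e e'.
by case: m / e h'; case: m' / e' => h'; rewrite fa; congr ract; exact: eq_irrelevance.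
Qed.

Definition hom0 : ghom M N 0 := mkhom hom0_linear hom0_ract.

Lemma ap_hom0 X n (x : rm M X n) : ap hom0 x = f x.
Proof. by rewrite /ap /gapp /= /hom0_fun (eq_irrelevance (unc_nil_eq _) erefl). Qed.

End DegreeZero.

End Match.

(** * The second page: Hochschild cohomology with coefficients in Ext *)

Section SecondPage.
Variables (k : fieldType) (C : gcat k) (modC : fp_model C).
Variable P : forall X : fp_ob modC, resolution (fp_mod X).

Let D := mod_cat modC.
Notation mo := (@fp_mod k C modC).
Notation Nb := (Nbim modC).
Notation Eb := (ext_bimod P).

Section Cocycles.
Variable q : nat.

Definition Zc (X Y : D) s := sub_of (Zsub (mo X) (mo Y) q s).

Lemma ZcP X Y s (u : Zc X Y s) : Zsub (mo X) (mo Y) q s (sub_val u).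
Proof. by apply/(sub_predP (Zsub (mo X) (mo Y) q s)); exact: sub_valP. Qed.

Definition mkZc X Y s (w : ghom (mo X) (Gn q.+1 (mo Y)) s) (Zw : Zsub (mo X) (mo Y) q s w) : Zc X Y s :=
  SubOf (introT (sub_predP _ _) Zw).

Definition Zbl (X Y Y' : D) i j l (e : i + j = l) (g : hom D Y Y' i) (u : Zc X Y j) : Zc X Y' l :=
  mkZc (Zsub_post e (g : ghom (mo Y) (mo Y') i) (ZcP u)).

Definition Zbr (X X' Y : D) i j l (e : i + j = l) (u : Zc X Y i) (f : hom D X' X j) : Zc X' Y l :=
  mkZc (Zsub_pre e (f : ghom (mo X') (mo X) j) (ZcP u)).

(** The classes in Ext are defined on cocycles only, so N^q and Ext^q are linked through the
    sub-bimodule Z^q of cocycles: [zinc] includes it into N^q, and [chi] maps it onto Ext^q. *)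
Definition Zbim : bimod D.
Proof.
apply: (@Bimod k D Zc Zbl Zbr).
- by move=> X Y Y' i j l e a f f' x; apply: val_inj; exact: (@blDl k D (Nb q)).
- by move=> X Y Y' i j l e a f x x'; apply: val_inj; exact: (@blDr k D (Nb q)).
- by move=> X X' Y i j l e a x x' f; apply: val_inj; exact: (@brDl k D (Nb q)).
- by move=> X X' Y i j l e a x f f'; apply: val_inj; exact: (@brDr k D (Nb q)).
- by move=> X Y i e x; apply: val_inj; exact: (@bl1 k D (Nb q)).
- by move=> X Y i e x; apply: val_inj; exact: (@br1 k D (Nb q)).
- move=> X Y Y' Y'' i j l ij jl n e1 e2 e3 e4 g f x; apply: val_inj.
  exact: (@blA k D (Nb q) X Y Y' Y'' i j l ij jl n e1 e2 e3 e4 g f (sub_val x)).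
- move=> X X' X'' Y i j l ij jl n e1 e2 e3 e4 x f g; apply: val_inj.
  exact: (@brA k D (Nb q) X X' X'' Y i j l ij jl n e1 e2 e3 e4 (sub_val x) f g).
- move=> X X' Y Y' i j l ij jl n e1 e2 e3 e4 g x f; apply: val_inj.
  exact: (@blrA k D (Nb q) X X' Y Y' i j l ij jl n e1 e2 e3 e4 g (sub_val x) f).
Defined.

Definition zinc_at (Y X : D) n (u : rm (brmod Zbim Y) X n) : rm (Rmod q Y) X n :=
  sub_val (u : Zc X Y n).

Definition zinc (Y : D) : ghom (brmod Zbim Y) (Rmod q Y) 0.
Proof. by apply: (hom0 (f := @zinc_at Y)). Defined.

Lemma ap_zinc (Y X : D) n (u : rm (brmod Zbim Y) X n) : ap (zinc Y) u = zinc_at u.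
Proof. exact: ap_hom0. Qed.

Definition chi_fun (Y X : D) n (u : rm (brmod Zbim Y) X n) : rm (brmod (Eb q) Y) X n :=
  chi_at (P X) (sub_val (u : Zc X Y n)).

Definition chi (Y : D) : ghom (brmod Zbim Y) (brmod (Eb q) Y) 0.
Proof.
apply: (hom0 (f := @chi_fun Y)).
  by move=> X n a u v; exact: (chiZD (P X) a (ZcP u) (ZcP v)).
by move=> X X' i j l e u f; exact: (chi_pre (P X) (P X') e f (ZcP u)).
Defined.

Lemma ap_chi (Y X : D) n (u : rm (brmod Zbim Y) X n) : ap (chi Y) u = chi_fun u.
Proof. exact: ap_hom0. Qed.

Lemma zinc_natural : bimod_natural zinc.
Proof.
move=> X Y i f; apply: ghom_eq => Z n m e u.
rewrite (gapp_compl (add0r i)) (gapp_compr (addr0 i)) (ap_zinc _ (n := n)) (ap_zinc (n := m)).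
by rewrite (blm_ev f e (bl_eq e)) [RHS](@blm_ev k D (Nb q) X Y i f Z n m e (bl_eq e)).
Qed.

Lemma chi_natural : bimod_natural chi.
Proof.
move=> X Y i f; apply: ghom_eq => Z n m e u.
rewrite (gapp_compl (add0r i)) (gapp_compr (addr0 i)) (ap_chi (n := n)) (ap_chi (n := m)).
rewrite (blm_ev f e (bl_eq e)) [RHS](@blm_ev k D (Eb q) X Y i f Z n m e (bl_eq e)).
exact: (chi_post (P Z) (bl_eq e) (f : ghom (mo Y) (mo X) i) (ZcP u)).
Qed.

Lemma chi_surj Y : gsurj (chi Y).
Proof.
apply/gsurj_ap => X n y; have [w [Zw wy]] := chi_onto (P := P X) y.
by exists (mkZc Zw); rewrite ap_chi /chi_fun.
Qed.

Lemma zinc_delta Y : gexact (zinc Y) (delta q Y).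
Proof.
apply/gexact_ap => X n u; rewrite (@ap_delta k C modC q Y X n u); split=> [u0|[v ->]].
  by exists (mkZc u0); rewrite ap_zinc.
by rewrite ap_zinc; exact: (ZcP v).
Qed.

Lemma zinc_inj Y X n (u : rm (brmod Zbim Y) X n) : ap (zinc Y) u = 0 -> u = 0.
Proof. by rewrite ap_zinc => u0; apply: val_inj. Qed.

End Cocycles.
End SecondPage.

Lemma Gmap_inj (k : fieldType) (C : gcat k) n (M N : rmod C) (f : ghom M N 0) :
  (forall X m (x : rm M X m), ap f x = 0 -> x = 0) ->
  forall X m (x : rm (Gn n M) X m), ap (Gmap n f) x = 0 -> x = 0.
Proof.
move=> fi; elim: n => [//|n IH] X m x x0; apply: cev_eq => Y j l e g.
by apply: IH; rewrite -ap_cmap_ev [ap _ _]x0.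
Qed.

Section CHExact.
Variables (k : fieldType) (D : gcat k) (M M' M'' : bimod D).
Variables (al : forall X, ghom (brmod M X) (brmod M' X) 0).
Variables (be : forall X, ghom (brmod M' X) (brmod M'' X) 0).

(** Cochains are a product over X of values of G^n, which is exact, and preimages are chosen
    separately for each X. *)
Lemma CHmap_exact n s (y : CH M' n s) : (forall X, gexact (al X) (be X)) ->
  CHmap be y = 0 <-> exists x, y = CHmap al x.
Proof.
move=> ab; have ex X : gexact (Gmap n (al X)) (Gmap n (be X)) by exact: Gmap_exact.
split=> [y0|[x ->]].
  have xP X : exists x, y X = ap (Gmap n (al X)) x.
    by apply/(proj1 (gexact_ap _ _) (ex X)); exact: (congr1 (fun z : CH M'' n s => z X) y0).
  exists (fun X => sval (cid (xP X))).
  by apply: functional_extensionality_dep => X; exact: (svalP (cid (xP X))).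
apply: functional_extensionality_dep => X.
by apply/(proj1 (gexact_ap _ _) (ex X)); exists (x X).
Qed.

Lemma CHmap_inj n s (x : CH M n s) :
  (forall X Z m (u : rm (brmod M X) Z m), ap (al X) u = 0 -> u = 0) -> CHmap al x = 0 -> x = 0.
Proof.
move=> ai x0; apply: functional_extensionality_dep => X; apply: (Gmap_inj (ai X)).
exact: (congr1 (fun z : CH M' n s => z X) x0).
Qed.

Lemma CHmap_surj n s (y : CH M' n s) : (forall X, gsurj (al X)) -> exists x, y = CHmap al x.
Proof.
move=> asurj; have sj X : gsurj (Gmap n (al X)) by exact: Gmap_surj.
have xP X : exists x, y X = ap (Gmap n (al X)) x by exact: (proj1 (gsurj_ap _) (sj X)).
exists (fun X => sval (cid (xP X))).
by apply: functional_extensionality_dep => X; exact: (svalP (cid (xP X))).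
Qed.

Lemma CHmap0 n s : CHmap al (0 : CH M n s) = 0.
Proof. by apply: functional_extensionality_dep => X; exact: gapp_zero. Qed.

Lemma CHmapB n s (x y : CH M n s) : CHmap al (x - y) = CHmap al x - CHmap al y.
Proof. by apply: functional_extensionality_dep => X; exact: gapp_sub. Qed.

End CHExact.

Section SecondPage.
Variables (k : fieldType) (C : gcat k) (modC : fp_model C).
Variable P : forall X : fp_ob modC, resolution (fp_mod X).

Let D := mod_cat modC.
Notation mo := (@fp_mod k C modC).
Notation Nb := (Nbim modC).
Notation Eb := (ext_bimod P).
Notation Zb := (Zbim modC).

Section Boundaries.
Variable q : nat.

Lemma Zsub_bound (X Y : D) n (u : ghom (mo X) (Gn q.+1 (mo Y)) n) :
  Zsub (mo X) (mo Y) q.+1 n (postcomp (Gd q.+1 (mo Y)) u).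
Proof.
rewrite /Zsub /= /postcomp -(gcompA (addr0 0) (add0r n) (add0r n)).
by rewrite (gexact_comp0 (addr0 0) (@Gd_exact k C q.+1 (mo Y))) gcomp0m.
Qed.

Definition zdel_at (Y X : D) n (u : rm (Rmod q Y) X n) : rm (brmod (Zb q.+1) Y) X n :=
  mkZc (Zsub_bound (u : ghom (mo X) (Gn q.+1 (mo Y)) n)).

(** The differential N^q -> N^(q+1) with its target restricted to Z^(q+1), so that N^q -> Z^(q+1) ->
    Ext^(q+1) is exact. *)
Definition zdel (Y : D) : ghom (Rmod q Y) (brmod (Zb q.+1) Y) 0.
Proof.
apply: (hom0 (f := @zdel_at Y)).
  by move=> X n a u v; apply: val_inj; exact: postcomp_linear.
move=> X X' i j l e u f; apply: val_inj.
exact/esym/(gcompA (add0r i) e e (add0r l)).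
Defined.

Lemma ap_zdel (Y X : D) n (u : rm (Rmod q Y) X n) : ap (zdel Y) u = zdel_at u.
Proof. exact: ap_hom0. Qed.

Lemma zinc_zdel Y : gcomp (addr0 0) (zinc q.+1 Y) (zdel Y) = delta q Y.
Proof.
apply: ghom0_eq => X n u; rewrite (ap_comp (addr0 0) (zinc q.+1 Y) (zdel Y) u).
by rewrite ap_zinc (ap_zdel u) (@ap_delta k C modC q Y X n u).
Qed.

Lemma zdel_chi Y : gexact (zdel Y) (chi P q.+1 Y).
Proof.
apply/gexact_ap => X n u; rewrite ap_chi; split=> [/(chi0 (P X) (ZcP u)) [w wE]|[v ->]].
  by exists w; rewrite (ap_zdel w); apply: val_inj.
rewrite (ap_zdel v); apply/(chi0 (P X) (ZcP _)).
by exists v.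
Qed.

End Boundaries.

Lemma chi0_inj Y X n (u : rm (brmod (Zb 0) Y) X n) : ap (chi P 0 Y) u = 0 -> u = 0.
Proof. by rewrite ap_chi => /(chi0 (P X) (ZcP u)) u0; apply: val_inj. Qed.

Section Lead.
Variables (p q : nat) (s : int).

Notation Ks := (K modC s).

(** Exactness of N^(q-1) -> Z^q -> Ext^q survives in cochains. For q = 0 nothing precedes Z^0, and
    [chi] is injective there. *)
Lemma Kdv_bound (b : CH (Zb q) p s) :
  CHmap (chi P q) b = 0 <-> exists x : tot Ks, CHmap (zinc q) b = tot_dv x p q.
Proof.
case: q b => [|q'] b.
  split=> [b0|[x]]; last by move/(CHmap_inj (@zinc_inj k C modC 0)) => ->; exact: CHmap0.
  by exists 0; rewrite (CHmap_inj (@chi0_inj) b0) CHmap0.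
have incdel (c : CH (Nb q') p s) :
    CHmap (zinc q'.+1) (CHmap (@zdel q') c) = CHmap (delta q') c.
  apply: functional_extensionality_dep => X.
  by rewrite /CHmap -(ap_comp (addr0 0)) -Gmap_comp zinc_zdel.
have KdvE (c : CH (Nb q') p s) : Kdv c = CHmap (zinc q'.+1) (CHmap (@zdel q') ((-1) ^+ p *: c)).
  by rewrite incdel CHmap_scale.
split=> [/(CHmap_exact _ (@zdel_chi q')) [c ->]|[x xE]].
  exists (@tot_inj k Ks p q' ((-1) ^+ p *: c)).
  rewrite -[RHS]/(Kdv (@tot_inj k Ks p q' ((-1) ^+ p *: c) (p, q'))) (@tot_injE k Ks) KdvE.
  by rewrite scalerA -expr2 sqrr_sign scale1r.
apply/(CHmap_exact _ (@zdel_chi q')); exists ((-1) ^+ p *: x (p, q')).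
apply/eqP; rewrite -subr_eq0; apply/eqP/(CHmap_inj (@zinc_inj k C modC q'.+1)).
by rewrite CHmapB -KdvE xE subrr.
Qed.

Lemma Kdv0 (a : CH (Nb q) p s) : Kdv a = 0 <-> exists b, a = CHmap (zinc q) b.
Proof.
rewrite -(CHmap_exact _ (@zinc_delta k C modC q)) /Kdv.
split=> [/(congr1 ( *:%R ((-1) ^+ p)))|->]; last exact: scaler0.
by rewrite scalerA -expr2 sqrr_sign scale1r scaler0.
Qed.

End Lead.

(** A vertical cycle a comes from a unique a' in C^p(Z^q), whose image under [chi] is the cochain
    with values in Ext^q. By [Kdv_bound], dh a is a vertical boundary exactly when that cochain is a
    cocycle. *)
Lemma K_lead p q s : lin_iso (subquot (lead_cycle (K modC s) p q) (lead_bound (K modC s) p q))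
  (HH (Eb q) p s).
Proof.
pose c (phi : CH (Eb q) p s) := cls (hh_cocycle (Eb q) p s) (hh_cobound (Eb q) p s) (uncurry phi).
have [cl c0 cs] : computes (dCH (Eb q) p s) (CH_bound (Eb q) p s) c by exact: CH_computes.
pose chiC n (a : CH (Zb q) n s) : CH (Eb q) n s := CHmap (chi P q) a.
pose inc n (a : CH (Zb q) n s) : CH (Nb q) n s := CHmap (zinc q) a.
have chid n a : dCH (Eb q) n s (chiC n a) = chiC n.+1 (dCH (Zb q) n s a).
  exact/CHmap_d/chi_natural.
have incd n a : dCH (Nb q) n s (inc n a) = inc n.+1 (dCH (Zb q) n s a).
  exact/CHmap_d/zinc_natural.
have inci n a : inc n a = 0 -> a = 0 by exact/CHmap_inj/zinc_inj.
apply: (@subquot_iso _ _ _ _ _ (fun (a : CH (Nb q) p s) h => exists a',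
  [/\ a = inc p a', dCH (Eb q) p s (chiC p a') = 0 & h = c (chiC p a')])).
- move=> b z z' w w' [a [-> a0 ->]] [a' [-> a0' ->]]; exists (b *: a + a'); split.
  + by rewrite /inc CHmap_linear.
  + by rewrite /chiC CHmap_linear linearP a0 a0' scaler0 addr0.
  + by rewrite /chiC CHmap_linear cl.
- move=> a [/Kdv0 [a' aE] [x xE]]; exists (c (chiC p a')), a'; split=> //.
  by rewrite chid; apply/Kdv_bound; exists x; rewrite -/(inc _ _) -incd -/(inc _ _) /inc -aE.
- move=> a h _ [a' [-> a0 ->]]; rewrite c0 //.
  case: p a' a0 {cl c0 cs c a h} => [|p'] a' a0.
    split=> [/Kdv_bound [y yE]|[x [y [yE _]]]].
      by exists 0, y; split=> //; rewrite [X in X + _]/= add0r.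
    by apply/Kdv_bound; exists y; rewrite [LHS]yE [X in X + _]/= add0r.
  split=> [[e eE]|[x [y [yE xv]]]].
    (* The cochain e with values in Ext^q lifts to cocycles; a' - d b is then killed by [chi], hence
       becomes a vertical boundary in N^q. *)
    have [b bE] := CHmap_surj e (@chi_surj k C modC P q).
    have : chiC p'.+1 (a' - dCH (Zb q) p' s b) = 0.
      by rewrite /chiC CHmapB -!/(chiC _ _) -chid [chiC p' b]/chiC -bE eE subrr.
    move=> /Kdv_bound [y yE]; exists (@tot_inj k (K modC s) p' q (inc p' b)), y; split.
      rewrite -yE -[tot_dh _ _ _]/(dCH (Nb q) p' s (@tot_inj k (K modC s) p' q (inc p' b) (p', q))).
      by rewrite (@tot_injE k (K modC s)) incd /inc CHmapB addrC subrK.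
    move=> i [->]; rewrite (@tot_injE k (K modC s)).
    by apply/Kdv0; exists b.
  (* The condition on x in [lead_bound] says that its entry is a vertical cycle, so that it has a
     class in Ext^q. *)
  have /Kdv0 [b bE] := xv p' erefl.
  exists (chiC p' b); rewrite chid; apply/eqP; rewrite -subr_eq0 -CHmapB; apply/eqP.
  apply/Kdv_bound; exists y; rewrite CHmapB [X in X - _]yE -[X in _ - X](incd p' b) /inc -bE.
  by rewrite addrAC subrr add0r.
move=> h; have [e [e0 <-]] := cs h; have [a aE] := CHmap_surj e (@chi_surj k C modC P q).
exists (inc p a); split; last by exists a; rewrite /chiC -aE.
split; first by apply/Kdv0; exists a.
have /Kdv_bound [x xE] : chiC p.+1 (dCH (Zb q) p s a) = 0 by rewrite -chid /chiC -aE.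
by exists x; rewrite -xE; exact: incd.
Qed.

End SecondPage.

Lemma lin_iso_trans (k : fieldType) (U V W : lmodType k) :
  lin_iso U V -> lin_iso V W -> lin_iso U W.
Proof.
move=> [f fb] [g gb]; have gfl : linear (g \o f) by move=> a u v /=; rewrite !linearP.
by exists (lin_fun gfl); exact: bij_comp gb fb.
Qed.

Theorem proposition5p1 (k : fieldType) (C : gcat k) (modC : fp_model C)
    (P : forall X : fp_ob modC, resolution (fp_mod X)) :
  exists E : spectral_seq k,
    first_quadrant E /\
    (forall (p q : nat) (s : int),
       lin_iso (page E 2 p%:Z q%:Z s) (HH (ext_bimod P q) p s)) /\
    converges E (fun n s => HH (diag_bimod C) n s).
Proof.
exists (dcomplex_ss (K modC)); split; first exact: dcomplex_ss_first_quadrant.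
split; first by move=> p q s; exact: lin_iso_trans (Epage2_lead _ p q) (K_lead P p q s).
apply: (dcomplex_ss_converges (W := K_aug modC) (@K_exact k C modC)
  (c := fun n s phi => cls (hh_cocycle (diag_bimod C) n s) (hh_cobound (diag_bimod C) n s)
    (uncurry phi))) => n s.
(* [CH_bound] and [aug_bound] agree by computation once n is 0 or a successor. *)
by have := CH_computes (diag_bimod C) n s; case: n.
Qed.
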